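(* There is an absolute constant $C>0$ such that for every $u\in L^2(\mathbb{R})$, every integer $N\ge 0$ and every scaling factor $\beta>0$, \[ \bigl\|u-\widehat{\Pi}_N^\beta u\bigr\| \le C\Bigl( \bigl\|u\cdot \mathbb{I}_{\{|x|>a\sqrt{N}/\beta\}}\bigr\| + \bigl\|\mathcal{F}[u](k)\cdot \mathbb{I}_{\{|k|>b\sqrt{N}\beta\}}\bigr\| + \|u\|\,e^{-cN}\Bigr), \] where $a=b=\frac{1}{2\sqrt 2}$ and $c=\frac{1}{16}$.
   Context: $\|\cdot\|$ is the $L^2(\mathbb{R})$ norm and $(\cdot,\cdot)$ the $L^2(\mathbb{R})$ inner product. $\mathbb{I}_A$ denotes the indicator function of a set $A$ (equal to $1$ on $A$, $0$ elsewhere). The Fourier transform is $\mathcal{F}[u](k)=\frac{1}{\sqrt{2\pi}}\int_{-\infty}^{\infty}u(x)e^{-ikx}\,dx$ (extended to $L^2$ as usual). For $\beta>0$, $\widehat{P}_N^\beta=\{e^{-\beta^2x^2/2}\psi(x):\ \psi \text{ a polynomial of degree}\le N\}$, and $\widehat{\Pi}_N^\beta:L^2(\mathbb{R})\to\widehat{P}_N^\beta$ is the orthogonal projection, i.e. $(u-\widehat{\Pi}_N^\beta u, v_N)=0$ for all $v_N\in\widehat{P}_N^\beta$. *)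

(* Defs.v *)
(* Complex-valued functions R -> C are represented
   by pairs (real part, imaginary part) of real functions. *)
From HB Require Import structures.
From mathcomp Require Import all_boot all_order all_algebra.
From mathcomp Require Import all_classical all_reals all_analysis.
Set Implicit Arguments. Unset Strict Implicit. Unset Printing Implicit Defensive.
Import Order.TTheory GRing.Theory Num.Theory.
Import numFieldNormedType.Exports.
Local Open Scope classical_set_scope.
Local Open Scope ring_scope.

Section Defs.
Variable R : realType.
Local Notation mu := (@lebesgue_measure R).

Definition L2c (fr fi : R -> R) : Prop :=
  measurable_fun setT fr /\ measurable_fun setT fi /\
  (\int[mu]_x ((fr x ^+ 2 + fi x ^+ 2)%:E) < +oo)%E.

Definition l2norm (fr fi : R -> R) : R :=
  Num.sqrt (fine (\int[mu]_x ((fr x ^+ 2 + fi x ^+ 2)%:E))).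

(* real and imaginary parts of the inner product (f, g) = \int f * conj g *)
Definition l2inner_re (fr fi gr gi : R -> R) : R :=
  Rintegral mu setT (fun x => fr x * gr x + fi x * gi x).
Definition l2inner_im (fr fi gr gi : R -> R) : R :=
  Rintegral mu setT (fun x => fi x * gr x - fr x * gi x).

(* Fourier transform (1/sqrt(2 pi)) \int_{|x| <= n} u(x) e^{-ikx} dx of the
   truncation of u to [-n, n]; real and imaginary parts *)
Definition trunc_fourier_re (n : nat) (ur ui : R -> R) (k : R) : R :=
  (Num.sqrt (2 * pi))^-1 *
  Rintegral mu [set x | `|x| <= n%:R] (fun x => ur x * cos (k * x) + ui x * sin (k * x)).
Definition trunc_fourier_im (n : nat) (ur ui : R -> R) (k : R) : R :=
  (Num.sqrt (2 * pi))^-1 *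
  Rintegral mu [set x | `|x| <= n%:R] (fun x => ui x * cos (k * x) - ur x * sin (k * x)).

(* g = gr + i gi is the (Plancherel) L^2 Fourier transform F[u] of u:
   g is in L^2 and the transforms of the truncations u 1_{[-n,n]} converge
   to g in L^2 ("extended to L^2 as usual"). *)
Definition is_L2_fourier (ur ui gr gi : R -> R) : Prop :=
  L2c gr gi /\
  (fun n : nat => l2norm (fun k => trunc_fourier_re n ur ui k - gr k)
                         (fun k => trunc_fourier_im n ur ui k - gi k)) @ \oo --> 0.

Definition in_hatP (N : nat) (beta : R) (vr vi : R -> R) : Prop :=
  exists pr pi_ : {poly R}, (size pr <= N.+1)%N /\ (size pi_ <= N.+1)%N /\
    vr = (fun x => expR (- (beta ^+ 2 * x ^+ 2) / 2) * pr.[x]) /\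
    vi = (fun x => expR (- (beta ^+ 2 * x ^+ 2) / 2) * pi_.[x]).

Definition is_hatPi (N : nat) (beta : R) (ur ui pr pi_ : R -> R) : Prop :=
  in_hatP N beta pr pi_ /\
  forall vr vi, in_hatP N beta vr vi ->
    l2inner_re (fun x => ur x - pr x) (fun x => ui x - pi_ x) vr vi = 0 /\
    l2inner_im (fun x => ur x - pr x) (fun x => ui x - pi_ x) vr vi = 0.

End Defs.

(* Main.v *)
(** Put A = beta^2 / 2 and e = u - Pi u, which is orthogonal to the Hermite space,
    so that ||e||^2 = (u, e).  Expand this product by the resolution of the identity
    (u, e) = const * \int\int (Vu)(q,k) conj (Ve)(q,k) dq dk, where V is the windowed
    Fourier transform with the Gaussian window exp (- A (x - q)^2), and split phase
    space along the box |q| <= 2 M, |k| <= 2 M' with M = a sqrt N / beta and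
    M' = b sqrt N beta.
    - On |q| > 2 M, Plancherel in k bounds \int\int |Vu|^2 by the mass of u on
      |x| > M plus the Gaussian leakage exp (- N / 8) ||u||^2; on |k| > 2 M' the same
      argument applies to the Fourier transform of u, since V is essentially
      symmetric under the exchange of u with its transform.
    - Inside the box, the window function at (q,k) has squared Hermite coefficients
      proportional to the Poisson weights exp (- X) X^n / n! with
      X = A q^2 + k^2 / (4 A) <= N / 2; a Chernoff bound on the Poisson tail makes
      |Ve|^2 <= const * 2^-N exp (N / 2) ||e||^2, which beats exp (- N / 8) even after
      multiplication by the area N of the box.
    Weighted AM-GM inequalities then absorb the contributions of e.  The transform of
    u is only defined as a limit, so the estimate is proved for the truncations of u
    to [-n, n]; by parity the real and imaginary parts can be treated separately. *)
Require Import Defs.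
From HB Require Import structures.
From mathcomp Require Import all_boot all_order all_algebra.
From mathcomp Require Import all_classical all_reals all_analysis.
From mathcomp Require Import measurable_realfun ring lra.
Import Order.TTheory GRing.Theory Num.Theory.
Import numFieldNormedType.Exports.
Local Open Scope classical_set_scope.
Local Open Scope ring_scope.
Set Implicit Arguments.
Unset Strict Implicit.

(** * Real-valued Lebesgue integration on the line *)

Section RealIntegral.
Context {R : realType}.
Implicit Types f g : R -> R.
Local Notation mu := (@lebesgue_measure R).

(** Every constant is fixed at the level of squares. With a = b = 1 / (2 sqrt 2), both 2 A M^2 and
    M'^2 / (2 A) equal N / 8, the leakage exponent. The box has twice the radii M and M', so each
    half of X contributes at most N / 4 there. Since log 2 - 1/2 > 1/8, the Hermite tail decays
    faster than exp (- N / 8), and the surplus swallows the area. The rate N / 8 for squared norms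
    is N / 16 for norms, whence c. The AM-GM weight in the box is a multiple of exp (- N / 8): the u
    term is then of the admissible size, and the e term, divided by that weight, is still absorbed.
    Only u is truncated in (u, e): truncating e would destroy its orthogonality to the Hermite
    space. The asymmetry is harmless. The truncation of u is integrable, so it has a pointwise
    transform, while e is only transformed after multiplication by a window, which makes it
    integrable as well. Plancherel is therefore needed only for functions that are both integrable
    and square integrable. *)

Definition rint (f : R -> R) : Prop := mu.-integrable setT (EFin \o f).

Lemma rint_meas f : rint f -> measurable_fun setT f.
Proof. by move=> /measurable_int/measurable_EFinP. Qed.

Lemma rint_le f g : measurable_fun setT f -> rint g ->
  (forall x, `|f x| <= g x) -> rint f.
Proof.
move=> mf ig fg; apply: le_integrable ig => //; first exact/measurable_EFinP.
by move=> x _ /=; rewrite lee_fin (le_trans (fg x))// ler_norm.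
Qed.

Lemma rint_eq f g : f =1 g -> rint f -> rint g.
Proof. by move=> /funext ->. Qed.

Lemma rintD f g : rint f -> rint g -> rint (fun x => f x + g x).
Proof. by move=> F G; apply: (integrableD _ F G). Qed.

Lemma rintN f : rint f -> rint (fun x => - f x).
Proof. by move=> F; exact: (integrableN F). Qed.

Lemma rintB f g : rint f -> rint g -> rint (fun x => f x - g x).
Proof. by move=> F G; apply/rintD/rintN. Qed.

Lemma rintZ k f : rint f -> rint (fun x => k * f x).
Proof. by move=> F; exact: (integrableZl measurableT k F). Qed.

Lemma rint_norm f : rint f -> rint (fun x => `|f x|).
Proof. by move=> F; exact: (integrable_norm F). Qed.

Lemma rint0 : rint (fun=> 0).
Proof. exact: integrable0. Qed.

Lemma rintM_bounded C f g : rint f -> measurable_fun setT g ->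
  (forall x, `|g x| <= C) -> rint (fun x => f x * g x).
Proof.
move=> F mg gC; apply: (@rint_le _ (fun x => C * `|f x|)).
- by apply: measurable_funM => //; exact: rint_meas.
- exact/rintZ/rint_norm.
- by move=> x; rewrite normrM mulrC ler_wpM2r.
Qed.

Lemma rint_fin f : rint f -> (\int[mu]_x (f x)%:E = (\int[mu]_x f x)%:E)%E.
Proof. by move=> F; rewrite fineK//; exact: (integrable_fin_num measurableT F). Qed.

Lemma Rint_eq f g : f =1 g -> \int[mu]_x f x = \int[mu]_x g x.
Proof. by move=> /funext ->. Qed.

Lemma RintD f g : rint f -> rint g ->
  \int[mu]_x (f x + g x) = \int[mu]_x f x + \int[mu]_x g x.
Proof. exact: RintegralD. Qed.

Lemma RintB f g : rint f -> rint g ->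
  \int[mu]_x (f x - g x) = \int[mu]_x f x - \int[mu]_x g x.
Proof. exact: RintegralB. Qed.

Lemma RintZ k f : rint f -> \int[mu]_x (k * f x) = k * \int[mu]_x f x.
Proof. exact: RintegralZl. Qed.

Lemma RintN f : rint f -> \int[mu]_x (- f x) = - \int[mu]_x f x.
Proof.
move=> F; rewrite -[RHS]mulN1r -RintZ//; apply: Rint_eq => x; exact/esym/mulN1r.
Qed.

Lemma Rint_zero : \int[mu]_x (0 : R) = 0.
Proof. by rewrite Rintegral_cst//= mul0r. Qed.

Lemma Rint_ge0 f : (forall x, 0 <= f x) -> 0 <= \int[mu]_x f x.
Proof. by move=> f0; apply: Rintegral_ge0. Qed.

Lemma Rint_le f g : rint f -> rint g -> (forall x, f x <= g x) ->
  \int[mu]_x f x <= \int[mu]_x g x.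
Proof. by move=> F G fg; apply: le_Rintegral. Qed.

Lemma Rint_norm_le f g : rint f -> rint g -> (forall x, `|f x| <= g x) ->
  `|\int[mu]_x f x| <= \int[mu]_x g x.
Proof.
move=> F G fg; apply: le_trans (le_normr_Rintegral measurableT F) _.
exact: Rint_le (rint_norm F) G fg.
Qed.

Lemma ge0_rint f (M : R) : measurable_fun setT f -> (forall x, 0 <= f x) ->
  (\int[mu]_x (f x)%:E <= M%:E)%E -> rint f /\ \int[mu]_x f x <= M.
Proof.
move=> mf f0 fM.
have F : rint f.
  apply/integrableP; split; first exact/measurable_EFinP.
  under eq_integral do rewrite /= ger0_norm//.
  by rewrite (le_lt_trans fM)// ltry.
by split=> //; rewrite -lee_fin -rint_fin.
Qed.

Lemma rint_dct (f_ : (R -> R)^nat) f g : (forall n, measurable_fun setT (f_ n)) ->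
  (forall x, f_ n x @[n --> \oo] --> f x) -> rint g ->
  (forall n x, `|f_ n x| <= g x) ->
  rint f /\ \int[mu]_x f_ n x @[n --> \oo] --> \int[mu]_x f x.
Proof.
move=> mf cf ig fg.
have mF : measurable_fun setT f.
  by apply: (measurable_fun_cvg mf) => x _; exact: cf.
have F : rint f.
  apply: (@rint_le _ g) => // x.
  apply: (ler_cvg_to (cvg_norm (cf x)) (cvg_cst (g x))).
  by apply: nearW => n; exact: fg.
split=> //.
have Fn n : rint (f_ n) by apply: (@rint_le _ g).
have := @dominated_cvg _ _ _ mu setT measurableT (fun n => EFin \o f_ n)
  (EFin \o f) (EFin \o g).
have -> : (fun n => \int[mu]_x (EFin \o f_ n) x)%E =
          (fun n => (\int[mu]_x f_ n x)%:E).
  by apply/funext => n; exact: rint_fin.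
rewrite (rint_fin F) => H.
suff HH : (\int[mu]_x f_ n x)%:E @[n --> \oo] --> (\int[mu]_x f x)%:E.
  exact: (fine_cvg HH).
apply: H => //.
- by move=> n; apply/measurable_EFinP; exact: mf.
- by move=> x _; apply: cvg_EFin; [exact: nearW|exact: cf].
- by move=> n x _ /=; rewrite lee_fin.
Qed.

Lemma rint_fatou (f_ : (R -> R)^nat) f M : (forall n, rint (f_ n)) ->
  (forall x, f_ n x @[n --> \oo] --> f x) -> (forall n x, 0 <= f_ n x) ->
  (forall n, \int[mu]_x f_ n x <= M) ->
  rint f /\ \int[mu]_x f x <= M.
Proof.
move=> F cf f0 fM.
have f_0 x : 0 <= f x.
  by apply: (ler_cvg_to (cvg_cst 0) (cf x)); exact: nearW.
apply: ge0_rint => //.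
  by apply: (measurable_fun_cvg (fun n => rint_meas (F n))) => x _; exact: cf.
have ce x : (f_ n x)%:E @[n --> \oo] --> (f x)%:E.
  by apply: cvg_EFin; [exact: nearW|exact: cf].
have -> : (\int[mu]_x (f x)%:E = \int[mu]_x limn_einf (fun n => (f_ n x)%:E))%E.
  apply: eq_integral => x _; rewrite is_cvg_limn_einfE; last exact: cvgP (ce x).
  by apply/esym/cvg_lim => //; exact: ce.
apply: le_trans (fatou mu measurableT _ _) _.
- by move=> n; apply/measurable_EFinP; exact: (rint_meas (F n)).
- by move=> n x _; rewrite lee_fin.
- rewrite limn_einf_lim; apply: lime_le; first exact: is_cvg_einfs.
  apply: nearW => n; apply: (@le_trans _ _ (\int[mu]_x (f_ n x)%:E)%E).
    by apply: ereal_inf_lbound; exists n => /=.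
  by rewrite (rint_fin (F n)) lee_fin.
Qed.

(** No integrability is assumed: the integrals of the positive and negative parts are measurable by
    Tonelli, and the real integral is [fine] of their difference. *)
Lemma measurable_Rint d (X : measurableType d) (F : X * R -> R) :
  measurable_fun setT F ->
  measurable_fun setT (fun x => \int[mu]_y F (x, y)).
Proof.
move=> mF; apply: measurableT_comp => //.
have -> : (fun x => \int[mu]_y (F (x, y))%:E)%E = (fun x =>
   \int[mu]_y (EFin \o F)^\+ (x, y) - \int[mu]_y (EFin \o F)^\- (x, y))%E.
  apply/funext => x; rewrite integralE.
  by congr (_ - _)%E; apply: eq_integral => y _; rewrite ?funeposE ?funenegE.
have mE : measurable_fun setT (EFin \o F) by exact/measurable_EFinP.
apply: emeasurable_funB.
- apply: (measurable_fun_fubini_tonelli_F (m2 := mu) ((EFin \o F)^\+)%E).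
    exact: measurable_funepos.
  by [].
- apply: (measurable_fun_fubini_tonelli_F (m2 := mu) ((EFin \o F)^\-)%E).
    exact: measurable_funeneg.
  by [].
Qed.

(** Integrability of every section, not just of almost every one, keeps the inner real integrals
    away from the default value of [fine] at infinity. *)
Lemma Rint_fubini (F : R * R -> R) : measurable_fun setT F ->
  (forall x, rint (fun y => F (x, y))) -> (forall y, rint (fun x => F (x, y))) ->
  rint (fun x => \int[mu]_y `|F (x, y)|) ->
  [/\ rint (fun x => \int[mu]_y F (x, y)), rint (fun y => \int[mu]_x F (x, y)) &
      \int[mu]_x \int[mu]_y F (x, y) = \int[mu]_y \int[mu]_x F (x, y)].
Proof.
move=> mF F1 F2 FF.
have mE : measurable_fun setT (EFin \o F) by exact/measurable_EFinP.
have iF : (mu \x mu)%E.-integrable setT (EFin \o F).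
  apply/integrable12ltyP => //=.
  under eq_integral => x _ do rewrite (rint_fin (rint_norm (F1 x))).
  by rewrite rint_fin// ltry.
have E1 : (fun x => \int[mu]_y (EFin \o F) (x, y))%E =
          (EFin \o (fun x => \int[mu]_y F (x, y))).
  by apply/funext => x; exact: rint_fin.
have E2 : (fun y => \int[mu]_x (EFin \o F) (x, y))%E =
          (EFin \o (fun y => \int[mu]_x F (x, y))).
  by apply/funext => x; exact: rint_fin.
have I1 : rint (fun x => \int[mu]_y F (x, y)).
  by rewrite /rint -E1; exact: integrable_fubini_F iF.
have I2 : rint (fun y => \int[mu]_x F (x, y)).
  rewrite /rint -E2.
  (* Swapping the variables yields integrability of the second marginal. *)
  have iG : (mu \x mu)%E.-integrable setT (fun z => (F (z.2, z.1))%:E).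
    apply/integrable12ltyP; last by have /integrable21ltyP := iF; exact.
    apply/measurable_EFinP; apply: (measurableT_comp mF) => /=.
    exact: measurable_fun_pair.
  exact: integrable_fubini_F iG.
split=> //; have := Fubini iF.
by rewrite E1 E2 (rint_fin I1) (rint_fin I2) => -[].
Qed.

Lemma Rint_tonelli (F : R * R -> R) : measurable_fun setT F ->
  (forall z, 0 <= F z) ->
  (forall x, rint (fun y => F (x, y))) -> (forall y, rint (fun x => F (x, y))) ->
  rint (fun x => \int[mu]_y F (x, y)) ->
  rint (fun y => \int[mu]_x F (x, y)) /\
  \int[mu]_x \int[mu]_y F (x, y) = \int[mu]_y \int[mu]_x F (x, y).
Proof.
move=> mF F0 F1 F2 FF; have [] := Rint_fubini mF F1 F2 => //.
by apply: rint_eq FF => x; apply: Rint_eq => y; rewrite ger0_norm.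
Qed.

(** The pushforward formula carries invariance from sets to nonnegative functions; the positive and
    negative parts of f give the rest. *)
Lemma rint_preserving (T : R -> R) f : measurable_fun setT T ->
  (forall A, measurable A -> pushforward mu (T : R -> measurableTypeR R) A = mu A) ->
  rint f -> rint (fun x => f (T x)) /\ \int[mu]_x f (T x) = \int[mu]_x f x.
Proof.
move=> mT pT F; have mf := rint_meas F.
have mfN : measurable_fun setT (fun x : R => f (T x)) by exact: measurableT_comp mf mT.
have E (g : R -> R) : measurable_fun setT g -> (forall x, 0 <= g x) ->
    (\int[mu]_x (g (T x))%:E = \int[mu]_x (g x)%:E)%E.
  move=> mg g0.
  rewrite [RHS](_ : _ = \int[pushforward mu (T : R -> measurableTypeR R)]_x (g x)%:E)%E.
    rewrite ge0_integral_pushforward//; first exact/measurable_EFinP.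
    by move=> x _; rewrite lee_fin.
  by apply: eq_measure_integral => A mA _; apply/esym; exact: pT.
split.
  apply/integrableP; split; first exact/measurable_EFinP.
  rewrite (E (fun x : R => `|f x|))//; last exact: measurableT_comp.
  by case/integrableP : F.
rewrite /Rintegral integralE [in RHS]integralE.
have mM g : measurable_fun setT g -> measurable_fun setT (fun x => Num.max (g x) 0).
  by move=> mg; exact: measurable_maxr.
congr (fine (_ - _)).
- under eq_integral do rewrite funeposE -EFin_max.
  under [RHS]eq_integral do rewrite funeposE -EFin_max.
  apply: (E (fun x => Num.max (f x) 0)); first exact: mM.
  by move=> x; rewrite le_max lexx orbT.
- under eq_integral do rewrite funenegE -EFinN -EFin_max.
  under [RHS]eq_integral do rewrite funenegE -EFinN -EFin_max.
  apply: (E (fun x => Num.max (- f x) 0)).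
    by apply: mM; exact: (measurableT_comp (@oppr_measurable R setT) mf).
  by move=> x; rewrite le_max lexx orbT.
Qed.

Lemma rint_reflect f : rint f ->
  rint (fun x => f (- x)) /\ \int[mu]_x f (- x) = \int[mu]_x f x.
Proof.
apply: rint_preserving; first exact: oppr_measurable.
by move=> A mA; exact: lebesgue_measureN.
Qed.

(** By uniqueness of Lebesgue measure it is enough to compare the pushforward with it on the
    intervals ]a, b]. *)
Lemma rint_translate m f : rint f ->
  rint (fun x => f (x + m)) /\ \int[mu]_x f (x + m) = \int[mu]_x f x.
Proof.
have mT : measurable_fun setT ((fun x => x + m) : R -> R).
  by apply: measurable_funD => //; exact: measurable_cst.
apply: rint_preserving => // A mA; apply/esym/lebesgue_measure_unique => //= _ [[a b]] _ <-.
rewrite /pushforward (_ : _ @^-1` _ = `]a - m, b - m]%classic).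
  rewrite !lebesgue_measure_itv/= !lte_fin ltrD2r; case: ifP => // _.
  by rewrite -!EFinB; congr EFin; ring.
by apply/seteqP; split=> x /=; rewrite !in_itv/= ltrBlDr lerBrDr.
Qed.

End RealIntegral.

(** * Rules for measurability and derivatives, driven by the shape of the function *)

Section MeasCont.
Context {R : realType}.
Section meas.
Context d (X : measurableType d).
Implicit Types f g : X -> R.
Lemma measurable_expRf f : measurable_fun setT f -> measurable_fun setT (fun x => expR (f x)).
Proof. by move=> mf; exact: measurableT_comp. Qed.
Lemma measurable_cosf f : measurable_fun setT f -> measurable_fun setT (fun x => cos (f x)).
Proof.
move=> mf; apply: (measurableT_comp _ mf).
by apply: continuous_measurable_fun; exact: continuous_cos.
Qed.
Lemma measurable_sinf f : measurable_fun setT f -> measurable_fun setT (fun x => sin (f x)).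
Proof.
move=> mf; apply: (measurableT_comp _ mf).
by apply: continuous_measurable_fun; exact: continuous_sin.
Qed.
Lemma measurable_normf f : measurable_fun setT f -> measurable_fun setT (fun x => `|f x|).
Proof. by move=> mf; exact: measurableT_comp. Qed.
Lemma measurable_oppf f : measurable_fun setT f -> measurable_fun setT (fun x => - f x).
Proof. by move=> mf; exact: measurableT_comp. Qed.
Lemma measurable_hornerf (p : {poly R}) f : measurable_fun setT f -> measurable_fun setT (fun x => p.[f x]).
Proof.
move=> mf; apply: (measurableT_comp _ mf).
by apply: continuous_measurable_fun; exact: continuous_horner.
Qed.
Lemma measurable_if_lt f g (h k : X -> R) : measurable_fun setT f -> measurable_fun setT g ->
  measurable_fun setT h -> measurable_fun setT k ->
  measurable_fun setT (fun x => if f x < g x then h x else k x).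
Proof.
by move=> mf mg mh mk; apply: measurable_fun_ifT => //; exact: measurable_fun_ltr.
Qed.
Lemma measurable_if_le f g (h k : X -> R) : measurable_fun setT f -> measurable_fun setT g ->
  measurable_fun setT h -> measurable_fun setT k ->
  measurable_fun setT (fun x => if f x <= g x then h x else k x).
Proof.
by move=> mf mg mh mk; apply: measurable_fun_ifT => //; exact: measurable_fun_ler.
Qed.
End meas.
Section der.
Implicit Types (f g : R -> R) (x : R).
Lemma deriv_mul f g x a b : is_derive x 1 f a -> is_derive x 1 g b ->
  is_derive x 1 (fun y => f y * g y) (f x * b + g x * a).
Proof. by move=> df dg; exact: (is_deriveM df dg). Qed.
Lemma deriv_add f g x a b : is_derive x 1 f a -> is_derive x 1 g b ->
  is_derive x 1 (fun y => f y + g y) (a + b).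
Proof. by move=> df dg; exact: (is_deriveD df dg). Qed.
Lemma deriv_opp f x a : is_derive x 1 f a -> is_derive x 1 (fun y => - f y) (- a).
Proof. by move=> df; exact: (is_deriveN df). Qed.
Lemma deriv_cst c x : is_derive x 1 (fun _ => c : R) 0.
Proof. exact: is_derive_cst. Qed.
Lemma deriv_id x : is_derive x 1 (fun y : R => y) 1.
Proof. exact: is_derive_id. Qed.
Lemma deriv_expR f x a : is_derive x 1 f a -> is_derive x 1 (fun y => expR (f y)) (expR (f x) * a).
Proof. by move=> df; exact: (is_derive1_comp (is_derive_expR (f x)) df). Qed.
Lemma deriv_cos f x a : is_derive x 1 f a -> is_derive x 1 (fun y => cos (f y)) (- sin (f x) * a).
Proof. by move=> df; exact: (is_derive1_comp (is_derive_cos (f x)) df). Qed.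
Lemma deriv_sin f x a : is_derive x 1 f a -> is_derive x 1 (fun y => sin (f y)) (cos (f x) * a).
Proof. by move=> df; exact: (is_derive1_comp (is_derive_sin (f x)) df). Qed.
Lemma deriv_sqr f x a : is_derive x 1 f a -> is_derive x 1 (fun y => f y ^+ 2) (2 * f x * a).
Proof.
by move=> df; apply: is_derive_eq (deriv_mul df df) _; rewrite -mulrA mulrDl mul1r.
Qed.
Lemma deriv_horner (p : {poly R}) x : is_derive x 1 (fun y => p.[y]) (p^`().[x]).
Proof.
elim/poly_ind: p => [|p c ih].
  have -> : (fun y : R => (0 : {poly R}).[y]) = fun=> 0 by apply/funext => y; rewrite horner0.
  by rewrite linear0 horner0; exact: deriv_cst.
have -> : (fun y : R => (p * 'X + c%:P).[y]) = fun y => p.[y] * y + c.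
  by apply/funext => y; rewrite !hornerE.
rewrite derivD derivM derivX derivC !hornerE.
by apply: is_derive_eq (deriv_add (deriv_mul ih (deriv_id x)) (deriv_cst c x)) _; ring.
Qed.
End der.
Section cont.
Implicit Types f g : R -> R.
Lemma is_derive_continuous f (f' : R -> R) : (forall x : R, is_derive x 1 f (f' x)) -> continuous f.
Proof.
by move=> df x; apply/differentiable_continuous/derivable1_diffP; have [] := df x.
Qed.
End cont.
End MeasCont.

Ltac mfun := repeat first [ assumption | exact: measurable_cst | exact: measurable_id
 | exact: measurable_fst | exact: measurable_snd
 | apply: measurable_expRf | apply: measurable_cosf | apply: measurable_sinf
 | apply: measurable_normf | apply: measurable_oppf | apply: measurable_hornerf
 | apply: measurable_funX | apply: measurable_funM | apply: measurable_funB | apply: measurable_funD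
 | apply: measurable_if_lt | apply: measurable_if_le
 | match goal with H : measurable_fun setT ?u |- measurable_fun setT (fun z => ?u (@?g z)) =>
     apply: (measurableT_comp H)
   | |- measurable_fun setT (fun z => fst (@?g z)) => apply: (measurableT_comp measurable_fst)
   | |- measurable_fun setT (fun z => snd (@?g z)) => apply: (measurableT_comp measurable_snd)
   end ].


Ltac der := repeat first [ exact: deriv_cst | exact: deriv_id | apply: deriv_expR | apply: deriv_cos | apply: deriv_sin
 | apply: deriv_opp | apply: deriv_sqr | apply: deriv_horner | apply: deriv_mul | apply: deriv_add ].

(** * Gaussian integrals and functions dominated by a Gaussian *)

Section Gaussian.
Context {R : realType}.
Local Notation mu := (@lebesgue_measure R).
Implicit Types (f g : R -> R) (a m x : R).

Lemma gauss_integral0 a : 0 < a ->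
  rint (fun x => expR (- (a * x ^+ 2))) /\
  \int[mu]_x expR (- (a * x ^+ 2)) = Num.sqrt (pi / a).
Proof.
move=> a0; pose s := (Num.sqrt (2 * a))^-1.
have s0 : s != 0 by rewrite invr_eq0 gt_eqF// sqrtr_gt0 mulr_gt0.
have s2 : s ^+ 2 = (2 * a)^-1 by rewrite exprVn sqr_sqrtr// mulr_ge0// ltW.
have -> : (fun x => expR (- (a * x ^+ 2))) =
   (fun x => (normal_peak s)^-1 * normal_pdf 0 s x).
  apply/funext => x; rewrite normal_pdfE// mulrA mulVf ?mul1r; last first.
    by rewrite gt_eqF// normal_peak_gt0.
  rewrite /normal_fun subr0 s2; congr expR.
  by rewrite -mulr_natr; field; rewrite gt_eqF.
have P := integrable_normal_pdf 0 s.
split; first exact: (rintZ _ P).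
rewrite RintZ// /Rintegral integral_normal_pdf mulr1 /normal_peak invrK s2.
by congr Num.sqrt; rewrite -mulr_natr; field; rewrite gt_eqF.
Qed.

Lemma gauss_integral a m : 0 < a ->
  rint (fun x => expR (- (a * (x - m) ^+ 2))) /\
  \int[mu]_x expR (- (a * (x - m) ^+ 2)) = Num.sqrt (pi / a).
Proof.
move=> a0; have [G <-] := gauss_integral0 a0.
exact: (rint_translate (- m) G).
Qed.

(* Domination by a Gaussian: integrable, vanishing at infinity, and stable under
   multiplication by polynomials and bounded functions. *)
Definition gdom f := exists C a, [/\ 0 <= C, 0 < a &
  forall x, `|f x| <= C * expR (- (a * x ^+ 2))].

Lemma gdom_rint f : measurable_fun setT f -> gdom f -> rint f.
Proof.
move=> mf [C [a [C0 a0 fC]]]; apply: (@rint_le _ _ (fun x => C * expR (- (a * x ^+ 2)))) => //.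
by apply: rintZ; have [] := gauss_integral0 a0.
Qed.

Lemma gdom_le f g : gdom g -> (forall x, `|f x| <= `|g x|) -> gdom f.
Proof.
by move=> [C [a [C0 a0 fC]]] fg; exists C, a; split=> // x; exact: le_trans (fg x) (fC x).
Qed.

Lemma gdomD f g : gdom f -> gdom g -> gdom (fun x => f x + g x).
Proof.
move=> [C [a [C0 a0 fC]]] [D [b [D0 b0 gD]]].
exists (C + D), (Num.min a b); split; [exact: addr_ge0|by rewrite lt_min a0|move=> x].
rewrite (le_trans (ler_normD _ _))// mulrDl lerD//.
- apply: le_trans (fC x) _; rewrite ler_wpM2l// ler_expR lerN2 ler_wpM2r ?sqr_ge0//.
  by rewrite ge_min lexx.
- apply: le_trans (gD x) _; rewrite ler_wpM2l// ler_expR lerN2 ler_wpM2r ?sqr_ge0//.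
  by rewrite ge_min lexx orbT.
Qed.

Lemma gdomM_bounded D f g : gdom f -> (forall x, `|g x| <= D) -> gdom (fun x => f x * g x).
Proof.
move=> [C [a [C0 a0 fC]]] gD; exists (C * `|D|), a; split=> //; first exact: mulr_ge0.
by move=> x; rewrite normrM mulrAC ler_pM// (le_trans (gD x))// ler_norm.
Qed.

Lemma gdomN f : gdom f -> gdom (fun x => - f x).
Proof. by move=> F; apply: (gdom_le F) => x; rewrite normrN. Qed.

(** Half of the exponent pays for the extra factor: |x| <= 1 + x^2 <= (1 + 2 / a) exp (a x^2 /
    2). *)
Lemma gdomMx f : gdom f -> gdom (fun x => f x * x).
Proof.
move=> [C [a [C0 a0 fC]]]; exists (C * (1 + 2 / a)), (a / 2).
have a20 : 0 <= 2 / a by rewrite divr_ge0// ltW.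
split; [by rewrite mulr_ge0// addr_ge0|by rewrite divr_gt0|move=> x].
rewrite normrM -mulrA.
apply: (@le_trans _ _ (C * expR (- (a * x ^+ 2)) * `|x|)); first by rewrite ler_wpM2r.
rewrite -mulrA ler_wpM2l//.
have -> : - (a * x ^+ 2) = - (a / 2 * x ^+ 2) - a / 2 * x ^+ 2 by field.
rewrite expRD mulrC mulrA ler_wpM2r ?expR_ge0// expRN.
have x2 : `|x| <= 1 + x ^+ 2.
  have -> : x ^+ 2 = `|x| ^+ 2 by rewrite real_normK// num_real.
  by have := sqr_ge0 (`|x| - 1); nra.
rewrite ler_pdivrMr ?expR_gt0//; apply: (le_trans x2).
have E := expR_ge1Dx (a / 2 * x ^+ 2).
have -> : 1 + x ^+ 2 = 1 + 2 / a * (a / 2 * x ^+ 2) by field; rewrite gt_eqF.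
have := mulr_ge0 (ltW (divr_gt0 a0 (ltr0n R 2))) (sqr_ge0 x).
move: (a / 2 * _) E => y E y0.
by have : 2 / a * y <= 2 / a * expR y; [rewrite ler_wpM2l//; lra|lra].
Qed.

Lemma gdom_horner (p : {poly R}) f : gdom f -> gdom (fun x => f x * p.[x]).
Proof.
move=> F; elim/poly_ind: p => [|p c ih].
  apply: (gdomM_bounded (D := 0) F) => x; by rewrite horner0 normr0.
have -> : (fun x => f x * (p * 'X + c%:P).[x]) = fun x => (f x * p.[x] * x + f x * c).
  by apply/funext => x; rewrite !hornerE mulrDr mulrA.
by apply: gdomD; [exact: gdomMx|exact: (gdomM_bounded (D := `|c|))].
Qed.

(** Half of the quadratic term absorbs the linear one by completing the square. *)
Lemma gdom_expR a p c : 0 < a -> gdom (fun x => expR (- (a * x ^+ 2) + p * x + c)).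
Proof.
move=> a0; exists (expR (p ^+ 2 / (2 * a) + c)), (a / 2); split.
- exact: expR_ge0.
- by rewrite divr_gt0.
move=> x; rewrite ger0_norm ?expR_ge0// -expRD ler_expR -subr_ge0.
have -> : p ^+ 2 / (2 * a) + c - a / 2 * x ^+ 2 - (- (a * x ^+ 2) + p * x + c) =
  a / 2 * (x - p / a) ^+ 2 by field; rewrite gt_eqF.
by rewrite mulr_ge0 ?sqr_ge0// ltW// divr_gt0.
Qed.

Lemma gdom_gauss a : 0 < a -> gdom (fun x => expR (- (a * x ^+ 2))).
Proof.
by move=> a0; exists 1, a; split=> // x; rewrite mul1r ger0_norm// expR_ge0.
Qed.

(** Since exp (- a x^2) <= 1 / (a x^2), the growth of [u] forces decay at least like C / (a n). *)
Lemma gdom_cvg0 f (u : R^nat) : gdom f -> (forall n, n%:R <= `|u n|) ->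
  f (u n) @[n --> \oo] --> 0.
Proof.
move=> [C [a [C0 a0 fC]]] un.
have H n : `|f (u n.+1)| <= C / a * n.+1%:R^-1.
  apply: le_trans (fC _) _; rewrite -mulrA ler_wpM2l// expRN -invfM.
  rewrite lef_pV2 ?posrE ?expR_gt0 ?mulr_gt0//.
  apply: le_trans (expR_ge1Dx _); apply: (@le_trans _ _ (a * u n.+1 ^+ 2)); last by lra.
  rewrite (ler_wpM2l (ltW a0))//.
  have -> : u n.+1 ^+ 2 = `|u n.+1| ^+ 2 by rewrite real_normK// num_real.
  apply: le_trans (un _) _; rewrite expr2 ler_peMr// (le_trans _ (un _))//.
  by rewrite ler1n.
rewrite -(cvg_shiftS (fun n => f (u n))) /=; apply: norm_cvg0.
apply: (@squeeze_cvgr _ _ _ _ (cst 0) (fun n => C / a * n.+1%:R^-1)).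
- by apply: nearW => n; rewrite normr_ge0 H.
- exact: cvg_cst.
- rewrite -(mulr0 (C / a)); apply: cvgM; [exact: cvg_cst|exact: cvg_harmonic].
Qed.

(** The source of all integrations by parts below: in the fundamental theorem on growing symmetric
    intervals the boundary terms vanish by Gaussian domination, and dominated convergence passes to
    the whole line. *)
Lemma gdom_int_derive F f : (forall x, is_derive x 1 F (f x)) -> continuous f ->
  gdom F -> gdom f -> \int[mu]_x f x = 0.
Proof.
move=> dF cf gF gf.
have mf : measurable_fun setT f by exact: continuous_measurable_fun.
have If := gdom_rint mf gf.
(* The radius is [n.+1] rather than [n] because the fundamental theorem needs a nondegenerate
   interval. *)
pose f_ n x := if x \in `[- n.+1%:R, n.+1%:R] then f x else 0.
have E n : \int[mu]_x f_ n x = F n.+1%:R - F (- n.+1%:R).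
  have lt : - n.+1%:R < n.+1%:R :> R by rewrite (@lt_trans _ _ 0)// oppr_lt0.
  have cF : continuous F := is_derive_continuous dF.
  have := @continuous_FTC2 R f F _ _ lt (continuous_subspaceT cf).
  rewrite (_ : \int[mu]_x f_ n x = \int[mu]_(x in `[- n.+1%:R, n.+1%:R]) f x)%R.
    move=> H; rewrite /Rintegral H//.
    - split.
      + by move=> x _; have [] := dF x.
      + by apply: cvg_at_right_filter; exact: cF.
      + by apply: cvg_at_left_filter; exact: cF.
    - by move=> x _; rewrite derive1E; have [_ ->] := dF x.
  rewrite [RHS]Rintegral_mkcond; apply: Rint_eq => x; rewrite /f_ patchE.
  by rewrite mem_setE.
have [||||_ H] := @rint_dct R f_ f (fun x => `|f x|).
- move=> n; have -> : f_ n = f \_ `[- n.+1%:R, n.+1%:R].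
    by apply/funext => x; rewrite /f_ patchE mem_setE.
  apply: (measurable_restrictT f (measurable_itv _)).1; exact: measurable_funTS.
- move=> x; apply: cvg_near_cst; near=> n.
  rewrite /f_ in_itv/= -ler_norml ifT//.
  apply: (@le_trans _ _ n%:R); last by rewrite ler_nat.
  by near: n; exact: nbhs_infty_ger.
- exact: rint_norm.
- by move=> n x; rewrite /f_; case: ifP => //; rewrite normr0.
suff H0 : \int[mu]_x f_ n x @[n --> \oo] --> (0 : R).
  by rewrite -(cvg_lim _ H)// (cvg_lim _ H0).
rewrite (_ : (fun n => _) = (fun n => F n.+1%:R - F (- n.+1%:R))); last exact/funext.
rewrite -(subr0 0); apply: cvgB; apply: gdom_cvg0 => // n.
- by rewrite ger0_norm// ler_nat.
- by rewrite normrN ger0_norm// ler_nat.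
Unshelve. all: by end_near.
Qed.
End Gaussian.

(** * The Fourier transform of a Gaussian *)

Section GaussFourier.
Context {R : realType}.
Local Notation mu := (@lebesgue_measure R).
Implicit Types (f g : R -> R) (a m x s t : R).

Lemma rint_cos f (h : R -> R) : rint f -> measurable_fun setT h -> rint (fun x => f x * cos (h x)).
Proof. by move=> F mh; apply: (rintM_bounded (C := 1) F) => [|x]; [mfun|exact: cos_max]. Qed.

Lemma rint_sin f (h : R -> R) : rint f -> measurable_fun setT h -> rint (fun x => f x * sin (h x)).
Proof. by move=> F mh; apply: (rintM_bounded (C := 1) F) => [|x]; [mfun|exact: sin_max]. Qed.

(** Differentiation under the integral sign: the derivative in s is dominated by [|E x * x|]
    uniformly in s, so any neighbourhood of s serves. *)
Lemma gauss_cos_derive a s : 0 < a ->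
  is_derive s 1 (fun s => \int[mu]_x (expR (- (a * x ^+ 2)) * cos (s * x)))
    (\int[mu]_x (- (expR (- (a * x ^+ 2)) * x * sin (s * x)))).
Proof.
move=> a0; pose E x := expR (- (a * x ^+ 2)).
have mE : measurable_fun setT E by rewrite /E; mfun.
have gE : gdom E by exact: gdom_gauss.
pose f s x := E x * cos (s * x).
have df x s' : is_derive s' 1 (f ^~ x) (- (E x * x * sin (s' * x))).
  apply: is_derive_eq (deriv_mul (deriv_cst _ _) (deriv_cos (deriv_mul (deriv_id s') (deriv_cst x s')))) _.
  by ring.
have pf s' x : partial1of2 f s' x = - (E x * x * sin (s' * x)).
  by rewrite partial1of2E ?derive1E; have [_ ->] := df x s'.
pose Gd x := `|E x * x|.
have iG : rint Gd by apply/rint_norm/gdom_rint; [mfun|exact: gdomMx].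
have Is : `]s - 1, s + 1[%classic s by rewrite /= in_itv/=; apply/andP; split; lra.
have If s' : `]s - 1, s + 1[%classic s' -> mu.-integrable setT (EFin \o f s').
  move=> _; apply: rint_cos; [exact: gdom_rint|mfun].
have dd s' x : `]s - 1, s + 1[%classic s' -> setT x -> derivable (f ^~ x) s' 1.
  by move=> _ _; have [] := df x s'.
have G0 x : 0 <= Gd x by exact: normr_ge0.
have Gb s' x : `]s - 1, s + 1[%classic s' -> setT x -> `|partial1of2 f s' x| <= Gd x.
  by move=> _ _; rewrite pf normrN normrM ler_piMr// sin_max.
have D := derivable_under_integral measurableT Is If dd G0 iG Gb.
have V := differentiation_under_integral measurableT Is If dd G0 iG Gb.
split; first exact: D.
rewrite -derive1E V; apply: Rint_eq => x; exact: pf.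
Qed.

(* Integrating by parts, the transform G satisfies G'(s) = - s G(s) / (2 a). *)
Lemma gauss_cos a s : 0 < a ->
  \int[mu]_x (expR (- (a * x ^+ 2)) * cos (s * x)) =
  Num.sqrt (pi / a) * expR (- (s ^+ 2 / (4 * a))).
Proof.
move=> a0; pose E x := expR (- (a * x ^+ 2)).
have an0 : a != 0 by rewrite gt_eqF.
have mE : measurable_fun setT E by rewrite /E; mfun.
have gE : gdom E by exact: gdom_gauss.
pose G s := \int[mu]_x (E x * cos (s * x)).
have iEc t : rint (fun x => E x * cos (t * x)) by apply: rint_cos; [exact: gdom_rint|mfun].
have iEs t : rint (fun x => E x * x * sin (t * x)).
  by apply: rint_sin; [apply: gdom_rint; [mfun|exact: gdomMx]|mfun].
have IBP t : \int[mu]_x (- (E x * x * sin (t * x))) = - (t / (2 * a)) * G t.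
  have H : \int[mu]_x (- (2 * a) * (E x * x * sin (t * x)) + t * (E x * cos (t * x))) = 0.
    apply: (@gdom_int_derive R (fun x => E x * sin (t * x))).
    - move=> x.
      apply: is_derive_eq (deriv_mul (deriv_expR (deriv_opp (deriv_mul (deriv_cst a x) (deriv_sqr (deriv_id x)))))
        (deriv_sin (deriv_mul (deriv_cst t x) (deriv_id x)))) _; rewrite /E; ring.
    - by rewrite /E; apply: is_derive_continuous => x; der.
    - by apply: (gdomM_bounded (D := 1) gE) => x; exact: sin_max.
    - apply: gdomD.
      + apply: (@gdom_le R _ (fun x => (E x * x) * (2 * a))).
          exact: (gdomM_bounded (D := `|2 * a|) (gdomMx gE)).
        move=> x; rewrite mulNr normrN [leLHS]normrM [leRHS]normrM mulrC ler_wpM2r//.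
        by rewrite normrM ler_piMr// sin_max.
      + apply: (@gdom_le R _ (fun x => E x * t)).
          exact: (gdomM_bounded (D := `|t|) gE).
        move=> x; rewrite mulrC [leLHS]normrM [leRHS]normrM ler_wpM2r//.
        by rewrite normrM ler_piMr// cos_max.
  rewrite RintD ?RintZ// in H; try exact: rintZ.
  rewrite -/(G t) in H; rewrite RintN//; move: H; set S := Rintegral _ _ _ => H.
  have aS : 2 * a * S = t * G t by lra.
  have a2 : 2 * a != 0 by rewrite mulf_neq0// pnatr_eq0.
  by rewrite mulNr; congr (- _); apply: (mulfI a2); rewrite aS; field.
(* Integrating factor: the differential equation makes K constant, and K 0 is the Gaussian
   integral. *)
pose K s := G s * expR (s ^+ 2 / (4 * a)).
have dK t : is_derive t 1 K 0.
  apply: is_derive_eq (deriv_mul (gauss_cos_derive t a0) (deriv_expR (deriv_mul (deriv_sqr (deriv_id t)) (deriv_cst (4 * a)^-1 t)))) _.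
  rewrite -/E IBP -/(G t); by field.
have := is_derive_0_is_cst s 0 dK.
rewrite /K expr0n/= mul0r expR0 mulr1 => KE.
have G0 : G 0 = Num.sqrt (pi / a).
  rewrite -(gauss_integral0 a0).2; apply: Rint_eq => x.
  by rewrite mul0r cos0 mulr1.
by rewrite -G0 -KE /G -mulrA -expRD subrr expR0 mulr1.
Qed.

Lemma gauss_sin a s : 0 < a ->
  \int[mu]_x (expR (- (a * x ^+ 2)) * sin (s * x)) = 0.
Proof.
move=> a0.
have i : rint (fun x => expR (- (a * x ^+ 2)) * sin (s * x)).
  by apply: rint_sin; [have [] := gauss_integral0 a0|mfun].
have [_] := rint_reflect i.
under Rint_eq do rewrite sqrrN mulrN sinN mulrN.
by rewrite RintN// => H; lra.
Qed.

(** The free phase t handles cosine and sine together: t = 0 gives the former, t = pi / 2 or - pi /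
    2 the latter up to sign. The addition formula reduces to the centred case, whose sine part
    vanishes by oddness. *)
Lemma gauss_cos_shift a m s t : 0 < a ->
  rint (fun x => expR (- (a * (x - m) ^+ 2)) * cos (s * x + t)) /\
  \int[mu]_x (expR (- (a * (x - m) ^+ 2)) * cos (s * x + t)) =
  Num.sqrt (pi / a) * expR (- (s ^+ 2 / (4 * a))) * cos (s * m + t).
Proof.
move=> a0; split.
  by apply: rint_cos; [have [] := gauss_integral m a0|mfun].
pose E x := expR (- (a * x ^+ 2)); have [gE _] := gauss_integral0 a0.
pose c := s * m + t.
have i1 : rint (fun x => cos c * (E x * cos (s * x))) by apply/rintZ/rint_cos => //; mfun.
have i2 : rint (fun x => sin c * (E x * sin (s * x))) by apply/rintZ/rint_sin => //; mfun.
pose f x := cos c * (E x * cos (s * x)) - sin c * (E x * sin (s * x)).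
have i : rint f by exact: rintB.
have fE x : f (x + (- m)) = E (x - m) * cos (s * x + t).
  have -> : s * x + t = s * (x - m) + c by rewrite /c; ring.
  by rewrite /f (cosD (s * (x - m)) c); ring.
have [_] := rint_translate (- m) i.
under Rint_eq do rewrite fE; move=> ->.
rewrite /f RintB// !RintZ ?gauss_cos ?gauss_sin//; first by rewrite mulr0 subr0 mulrC.
  by apply: rint_sin => //; mfun.
by apply: rint_cos => //; mfun.
Qed.
End GaussFourier.

(** * Square-integrable functions, bounded kernels and Gaussian convolution *)

Section L2.
Context {R : realType}.
Local Notation mu := (@lebesgue_measure R).
Implicit Types (f g h : R -> R) (a m x s t : R).

Lemma rint_mul f g : measurable_fun setT f -> measurable_fun setT g ->
  rint (fun x => f x ^+ 2) -> rint (fun x => g x ^+ 2) -> rint (fun x => f x * g x).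
Proof.
move=> mf mg f2 g2; apply: (@rint_le _ _ (fun x => f x ^+ 2 + g x ^+ 2)).
- by mfun.
- exact: rintD.
- move=> x; have := sqr_ge0 (f x + g x); have := sqr_ge0 (f x - g x).
  by rewrite ler_norml sqrrB sqrrD; move=> *; apply/andP; split; lra.
Qed.

Lemma rint_sqrD f g : measurable_fun setT f -> measurable_fun setT g ->
  rint (fun x => f x ^+ 2) -> rint (fun x => g x ^+ 2) -> rint (fun x => (f x + g x) ^+ 2).
Proof.
move=> mf mg f2 g2; apply: (@rint_le _ _ (fun x => 2 * f x ^+ 2 + 2 * g x ^+ 2)).
- by mfun.
- by apply: rintD; exact: rintZ.
- move=> x; rewrite ger0_norm ?sqr_ge0//; have := sqr_ge0 (f x - g x).
  by rewrite sqrrB sqrrD => *; lra.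
Qed.

Lemma rint_sqrB f g : measurable_fun setT f -> measurable_fun setT g ->
  rint (fun x => f x ^+ 2) -> rint (fun x => g x ^+ 2) -> rint (fun x => (f x - g x) ^+ 2).
Proof.
move=> mf mg f2 g2; apply: (@rint_sqrD _ (fun x => - g x)) => //; first by mfun.
by apply: rint_eq g2 => x; rewrite sqrrN.
Qed.

Lemma rint_sqr_bounded C f : rint f -> (forall x, `|f x| <= C) -> rint (fun x => f x ^+ 2).
Proof. by move=> F fC; apply: (rintM_bounded (C := C) F) => //; exact: rint_meas. Qed.

(** The multiplication formula of Fourier analysis for a general bounded kernel: f (x) h (k) K (k,
    x) is absolutely integrable on the plane because f and h are on the line. It serves for the
    cosine and sine kernels. *)
Lemma Rint_kernel_swap (K : R * R -> R) C f h : measurable_fun setT K ->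
  (forall z, `|K z| <= C) -> rint f -> rint h ->
  [/\ rint (fun k => h k * \int[mu]_x (f x * K (k, x))),
      rint (fun x => f x * \int[mu]_k (h k * K (k, x))) &
  \int[mu]_k (h k * \int[mu]_x (f x * K (k, x))) =
  \int[mu]_x (f x * \int[mu]_k (h k * K (k, x)))].
Proof.
move=> mK KC F H; have mf := rint_meas F; have mh := rint_meas H.
pose Phi z := h z.1 * (f z.2 * K z).
have mPhi : measurable_fun setT Phi by rewrite /Phi; mfun.
have mK1 k : measurable_fun setT (fun x => K (k, x)) by exact: measurable_fun_pair2 mK.
have mK2 x : measurable_fun setT (fun k => K (k, x)) by exact: measurable_fun_pair1 mK.
have i1 k : rint (fun x => f x * K (k, x)) by exact: (rintM_bounded (C := C)).
have i2 x : rint (fun k => h k * K (k, x)) by exact: (rintM_bounded (C := C)).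
have E1 k : \int[mu]_x Phi (k, x) = h k * \int[mu]_x (f x * K (k, x)) by rewrite -RintZ.
have E2 x : \int[mu]_k Phi (k, x) = f x * \int[mu]_k (h k * K (k, x)).
  by rewrite -RintZ//; apply: Rint_eq => k; rewrite /Phi/=; ring.
have [|||I1 I2 I3] := @Rint_fubini R Phi mPhi.
- by move=> k; exact: rint_eq (rintZ (h k) (i1 k)).
- move=> x; apply: rint_eq (rintZ (f x) (i2 x)) => k; rewrite /Phi/=; ring.
- have mN : measurable_fun setT (fun z => `|Phi z|) by mfun.
  apply: (@rint_le _ _ (fun k => `|h k| * (C * \int[mu]_x `|f x|))).
  + exact: (measurable_Rint mN).
  + by apply: rint_eq (rintZ (C * \int[mu]_x `|f x|) (rint_norm H)) => k; rewrite mulrC.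
  + move=> k; rewrite ger0_norm; last by apply: Rint_ge0.
    rewrite -!RintZ; [|by apply/rintZ/rint_norm|exact: rint_norm].
    apply: Rint_le.
    * apply: (@rint_norm R (fun x => Phi (k, x))).
      exact: rint_eq (rintZ (h k) (i1 k)).
    * by apply/rintZ/rintZ/rint_norm.
    * by move=> x; rewrite /Phi/= !normrM ler_wpM2l// mulrC ler_wpM2r.
split; [exact: rint_eq I1|exact: rint_eq I2|].
by rewrite -(Rint_eq E1) -(Rint_eq E2).
Qed.

(** The Gaussian is left unnormalized, with mass sqrt (pi / a); the factor sqrt (a / pi) is written
    out wherever an approximate identity is meant. *)
Definition gconv a f x := \int[mu]_y (f y * expR (- (a * (x - y) ^+ 2))).

Lemma expRN_le1 a x : 0 <= a -> `|expR (- (a * x ^+ 2))| <= 1.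
Proof. by move=> a0; rewrite ger0_norm ?expR_ge0// expR_le1 oppr_le0 mulr_ge0// sqr_ge0. Qed.

Lemma gconv_section a f x : 0 < a -> rint f -> rint (fun y => f y * expR (- (a * (x - y) ^+ 2))).
Proof.
move=> a0 F; apply: (rintM_bounded (C := 1) F) => [|y]; last exact/expRN_le1/ltW.
by mfun.
Qed.

Lemma gauss_integral_sym a x : 0 < a ->
  rint (fun y => expR (- (a * (x - y) ^+ 2))) /\
  \int[mu]_y expR (- (a * (x - y) ^+ 2)) = Num.sqrt (pi / a).
Proof.
move=> a0; have [G <-] := gauss_integral x a0.
have E y : expR (- (a * (x - y) ^+ 2)) = expR (- (a * (y - x) ^+ 2)) by rewrite -sqrrN opprB.
by split; [apply: rint_eq G => y; rewrite E|apply: Rint_eq].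
Qed.

Lemma gconv_rint a f : 0 < a -> rint f ->
  rint (gconv a f) /\ \int[mu]_x gconv a f x = Num.sqrt (pi / a) * \int[mu]_x f x.
Proof.
move=> a0 F; have mf := rint_meas F.
pose Phi z := f z.1 * expR (- (a * (z.2 - z.1) ^+ 2)).
have mPhi : measurable_fun setT Phi by rewrite /Phi; mfun.
have G y := gauss_integral y a0.
have E y : \int[mu]_x Phi (y, x) = Num.sqrt (pi / a) * f y.
  by rewrite -(G y).2 mulrC -RintZ//; exact: (G y).1.
have [||| I1 I2 I3] := @Rint_fubini R Phi mPhi.
- by move=> y; exact: rint_eq (rintZ (f y) (G y).1).
- by move=> x; exact: gconv_section.
- apply: rint_eq (rintZ (Num.sqrt (pi / a)) (rint_norm F)) => y.
  rewrite -(G y).2 mulrC -RintZ; last exact: (G y).1.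
  by apply: Rint_eq => x; rewrite /Phi/= normrM [X in _ = _ * X]ger0_norm// expR_ge0.
split; first exact: I2.
by rewrite -[LHS]I3 (Rint_eq E) RintZ.
Qed.

(* Schur test: |f(x) g(y)| <= l f(x)^2 + g(y)^2 / l. *)
Lemma gconv_schur a l f g : 0 < a -> 0 < l -> rint f -> rint g ->
  rint (fun x => f x ^+ 2) -> rint (fun x => g x ^+ 2) ->
  rint (fun x => f x * gconv a g x) /\
  `|\int[mu]_x (f x * gconv a g x)| <=
  Num.sqrt (pi / a) * (l * \int[mu]_x f x ^+ 2 + l^-1 * \int[mu]_x g x ^+ 2).
Proof.
move=> a0 l0 F G f2 g2; have mf := rint_meas F; have mg := rint_meas G.
have [H Hi] := gconv_rint a0 g2.
pose c := Num.sqrt (pi / a).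
have c0 : 0 <= c by exact: sqrtr_ge0.
have B x : `|f x * gconv a g x| <= l * c * f x ^+ 2 + l^-1 * gconv a (fun y => g y ^+ 2) x.
  have [S Si] := gauss_integral_sym x a0.
  rewrite -RintZ; last exact: gconv_section.
  have -> : l * c * f x ^+ 2 + l^-1 * gconv a (fun y => g y ^+ 2) x =
     \int[mu]_y ((l * f x ^+ 2) * expR (- (a * (x - y) ^+ 2)) +
        l^-1 * (g y ^+ 2 * expR (- (a * (x - y) ^+ 2)))).
    rewrite RintD; [|exact: rintZ|by apply: rintZ; exact: gconv_section].
    rewrite RintZ// Si RintZ; last exact: gconv_section.
    by rewrite -/c -/(gconv a _ _); ring.
  apply: Rint_norm_le.
  - by apply: rintZ; exact: gconv_section.
  - by apply: rintD; [exact: rintZ|apply: rintZ; exact: gconv_section].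
  - move=> y; rewrite mulrA normrM (ger0_norm (expR_ge0 _)) (mulrA l^-1) -mulrDl ler_wpM2r ?expR_ge0//.
    have -> : `|f x * g y| = l * (`|f x| * (l^-1 * `|g y|)).
      by rewrite normrM; field; rewrite gt_eqF.
    have -> : l^-1 * g y ^+ 2 = l * (l^-1 * `|g y|) ^+ 2.
      by rewrite exprMn real_normK ?num_real//; field; rewrite gt_eqF.
    rewrite -(@real_normK _ (f x)) ?num_real//.
    move: (`|f x|) (normr_ge0 (f x)) (l^-1 * `|g y|) => u u0 v.
    rewrite -mulrDr (ler_wpM2l (ltW l0))//; have := sqr_ge0 (u - v).
    by have := sqr_ge0 (u + v); rewrite sqrrB sqrrD => *; lra.
have I : rint (fun x => l * c * f x ^+ 2 + l^-1 * gconv a (fun y => g y ^+ 2) x).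
  by apply: rintD; exact: rintZ.
have IQ : rint (fun x => f x * gconv a g x).
  apply: rint_le I B; apply: measurable_funM => //.
  exact: rint_meas (gconv_rint a0 G).1.
split=> //; apply: le_trans (Rint_norm_le IQ I B) _.
rewrite RintD; [|exact: rintZ|exact: rintZ].
rewrite RintZ// RintZ// Hi -/c mulrDr; apply: lerD.
  by rewrite mulrA (mulrC c).
by rewrite mulrCA.
Qed.

Lemma gconv_cvg f (x : R) C : rint f -> (forall y, `|f y| <= C) -> {for x, continuous f} ->
  Num.sqrt (n.+1%:R / pi) * gconv n.+1%:R f x @[n --> \oo] --> f x.
Proof.
move=> F fC cf; have mf := rint_meas F.
have C0 : 0 <= C by exact: le_trans (normr_ge0 (f 0)) (fC 0).
have pi0 : 0 < pi :> R := pi_gt0 R.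
(* A bound with explicit dependence on a: continuity controls |x - y| < d, and the Gaussian tail
   contributes O (1 / a). *)
have key (eta d a : R) : 0 < eta -> 0 < d -> 0 < a ->
    (forall y, `|x - y| < d -> `|f x - f y| <= eta) ->
    `|f x - Num.sqrt (a / pi) * gconv a f x| <= eta + (8 * C / d ^+ 2) / a.
  move=> e0 d0 a0 fd.
  have [S Si] := gauss_integral_sym x a0.
  have [T Ti] := gauss_integral_sym x (divr_gt0 a0 (ltr0n R 2)).
  have c1 : Num.sqrt (a / pi) * Num.sqrt (pi / a) = 1.
    rewrite -sqrtrM; last by rewrite divr_ge0 ?ltW.
    by rewrite mulrA divfK ?divff ?sqrtr1// gt_eqF.
  have sg := gconv_section x a0 F.
  have E : f x - Num.sqrt (a / pi) * gconv a f x =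
     Num.sqrt (a / pi) * \int[mu]_y ((f x - f y) * expR (- (a * (x - y) ^+ 2))).
    rewrite (@Rint_eq _ (fun y => (f x - f y) * _) (fun y => f x * expR (- (a * (x - y) ^+ 2))
       - f y * expR (- (a * (x - y) ^+ 2)))); last by move=> y; rewrite mulrBl.
    rewrite RintB//; last exact: rintZ.
    by rewrite RintZ// Si mulrBr mulrCA c1 mulr1.
  rewrite E normrM ger0_norm ?sqrtr_ge0//.
  (* When |x - y| >= d, half of the exponent gives exp (a (x - y)^2 / 2) >= a d^2 / 2, and q is
     chosen so that q times this bound is 2 C. The other half keeps the estimate integrable in y;
     its larger mass costs the factor sqrt 2 <= 2. *)
  pose q := 4 * C / (a * d ^+ 2).
  have q0 : 0 <= q by rewrite divr_ge0 ?mulr_ge0 ?sqr_ge0// ltW.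
  have B y : `|(f x - f y) * expR (- (a * (x - y) ^+ 2))| <=
     eta * expR (- (a * (x - y) ^+ 2)) + q * expR (- (a / 2 * (x - y) ^+ 2)).
    rewrite normrM (ger0_norm (expR_ge0 _)).
    have [lt|ge] := ltP `|x - y| d.
      apply: (@le_trans _ _ (eta * expR (- (a * (x - y) ^+ 2)))).
        by rewrite ler_wpM2r ?expR_ge0// fd.
      by rewrite lerDl mulr_ge0 ?expR_ge0.
    apply: (@le_trans _ _ (q * expR (- (a / 2 * (x - y) ^+ 2)))); last first.
      by rewrite lerDr mulr_ge0 ?expR_ge0// ltW.
    have -> : - (a * (x - y) ^+ 2) = - (a / 2 * (x - y) ^+ 2) - a / 2 * (x - y) ^+ 2 by field.
    rewrite expRD (mulrC (expR _)) mulrA ler_wpM2r ?expR_ge0//.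
    have fxy : `|f x - f y| <= 2 * C.
      by apply: le_trans (ler_normB _ _) _; rewrite mulr_natl mulr2n lerD.
    rewrite expRN ler_pdivrMr ?expR_gt0//; apply: (le_trans fxy).
    have -> : 2 * C = q * (a / 2 * d ^+ 2).
      by rewrite /q; field; rewrite !gt_eqF.
    rewrite ler_wpM2l//; apply: (@le_trans _ _ (a / 2 * (x - y) ^+ 2)).
      apply: ler_wpM2l; first by rewrite divr_ge0// ltW.
      rewrite -(@real_normK _ (x - y)) ?num_real//.
      by rewrite ler_sqr ?nnegrE// ltW.
    by apply: le_trans (expR_ge1Dx _); lra.
  have IB : rint (fun y => eta * expR (- (a * (x - y) ^+ 2)) + q * expR (- (a / 2 * (x - y) ^+ 2))).
    by apply: rintD; exact: rintZ.
  have H := Rint_norm_le _ IB B.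
  apply: (@le_trans _ _ (Num.sqrt (a / pi) * (eta * Num.sqrt (pi / a) + q * Num.sqrt (pi / (a / 2))))).
    rewrite ler_wpM2l ?sqrtr_ge0//; apply: le_trans (H _) _.
      apply: rint_eq (rintB (rintZ (f x) S) sg) => y; by rewrite mulrBl.
    by rewrite RintD; [rewrite !RintZ// Si Ti|exact: rintZ|exact: rintZ].
  rewrite mulrDr mulrCA c1 mulr1 lerD2l mulrCA -sqrtrM; last by rewrite divr_ge0 ?ltW.
  have -> : a / pi * (pi / (a / 2)) = 2 by move: (@pi R) pi0 => p p0; field; rewrite !gt_eqF.
  have s2 : Num.sqrt 2 <= 2 :> R.
    by rewrite -[leRHS]ger0_norm// -sqrtr_sqr ler_sqrt ?exprn_gt0//; lra.
  have -> : 8 * C / d ^+ 2 / a = q * 2 by rewrite /q; field; rewrite !gt_eqF.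
  by rewrite ler_wpM2l.
apply/cvgrPdist_le => e e0.
have e20 : 0 < e / 2 by rewrite divr_gt0.
move/cvgrPdist_le : (cf) => /(_ _ e20) /nbhs_ballP [d /= d0 Hd].
near=> n.
have fd y : `|x - y| < d -> `|f x - f y| <= e / 2 by move=> xy; apply: Hd; exact: xy.
apply: le_trans (key (e / 2) d n.+1%:R e20 d0 (ltr0Sn _ n) fd) _.
rewrite [leRHS](splitr e) lerD2l.
set P := 8 * C / d ^+ 2.
have P0 : 0 <= P by rewrite divr_ge0 ?mulr_ge0// ltW// exprn_gt0.
rewrite ler_pdivrMr//; apply: (@le_trans _ _ (e / 2 * n%:R)); last first.
  by rewrite ler_wpM2l ?ler_nat// ltW.
rewrite mulrC -ler_pdivrMr//; near: n; exact: nbhs_infty_ger.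
Unshelve. all: by end_near.
Qed.
End L2.

(** * Approximation in L^2 by bounded, locally continuous functions *)

Section Density.
Context {R : realType}.
Local Notation mu := (@lebesgue_measure R).
Implicit Types (f g h : R -> R) (a m x s t k d : R).

Lemma continuous_near_eq f g x (N : R) : `|x| < N -> continuous g ->
  (forall y, `|y| < N -> f y = g y) -> {for x, continuous f}.
Proof.
move=> xN cg fg; suff : f @ x --> g x by rewrite -(fg x xN).
apply: cvg_trans (cg x).
apply: near_eq_cvg; near=> y; rewrite fg//.
by near: y; apply: (cvgr_lt `|x|) => //; exact: norm_continuous.
Unshelve. all: by end_near.
Qed.

(** Two approximants are produced because the pairing of [f1] with a convolution of [h] needs
    pointwise convergence only where [f1] is nonzero. As [f1] lives in |x| < N, [h] may jump at the
    two endpoints and no cutoff function has to be built. *)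
Lemma l2_approx f d : rint f -> rint (fun x => f x ^+ 2) -> 0 < d ->
  exists (N : R) f1 h,
  [/\ rint f1, rint (fun x => f1 x ^+ 2) & \int[mu]_x (f x - f1 x) ^+ 2 <= d] /\
  [/\ rint h, rint (fun x => h x ^+ 2) & \int[mu]_x (f x - h x) ^+ 2 <= d] /\
  [/\ forall x, `|h x| <= N, forall x, `|x| < N -> {for x, continuous h} &
      forall x, N <= `|x| -> f1 x = 0].
Proof.
move=> F F2 d0; have mf := rint_meas F.
pose f_ n x := if `|x| < n.+1%:R then (if `|f x| <= n.+1%:R then f x else 0) else 0.
have mf_ n : measurable_fun setT (f_ n) by rewrite /f_; mfun.
have ff n x : `|f_ n x| <= `|f x| by rewrite /f_; case: ifP => _; [case: ifP => _|]; rewrite ?normr0.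
have F_ n : rint (f_ n) by apply: (@rint_le _ _ (fun x => `|f x|)) => //; exact: rint_norm.
have fn n x : `|f_ n x| <= n.+1%:R by rewrite /f_; case: ifP => _; [case: ifP => // _|]; rewrite ?normr0.
have [||||_ H] := @rint_dct R (fun n x => (f x - f_ n x) ^+ 2) (fun=> 0) (fun x => f x ^+ 2).
- by move=> n; mfun.
- move=> x; apply: cvg_near_cst; near=> n; rewrite /f_ !ifT ?subrr ?expr0n//.
  + apply: (@le_trans _ _ n%:R); last by rewrite ler_nat.
    by near: n; exact: nbhs_infty_ger.
  + apply: (@le_lt_trans _ _ n%:R); last by rewrite ltr_nat.
    by near: n; exact: nbhs_infty_ger.
- by [].
- move=> n x; rewrite ger0_norm ?sqr_ge0// /f_.
  by case: ifP => _; [case: ifP => _|]; rewrite ?subrr ?subr0 ?expr0n//= ?sqr_ge0.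
rewrite Rint_zero in H.
have d40 : 0 < d / 4 by rewrite divr_gt0.
have [n Hn] : exists n, \int[mu]_x (f x - f_ n x) ^+ 2 <= d / 4.
  move/cvgrPdist_le : H => /(_ _ d40) [n _ Hn]; exists n.
  by have := Hn n (leqnn n); rewrite /= sub0r normrN; apply: le_trans; exact: ler_norm.
pose N : R := n.+1%:R; have N0 : 0 < N by rewrite ltr0n.
pose E := `[- N, N]%classic.
have iE : mu.-integrable E (EFin \o f_ n).
  by apply: integrableS (F_ n) => //; exact: measurable_itv.
have muE : (mu E < +oo)%E by rewrite lebesgue_measure_itv/=; case: ifP => _; rewrite ?ltry// -EFinD ltry.
have [g_ [cg ig Hg]] := approximation_continuous_integrable (measurable_itv _) muE iE.
(* Chosen so that 2 * (2 * N * d') = d / 2, the share of the second error in the final splitting. *)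
pose d' := d / (8 * N); have d'0 : 0 < d' by rewrite divr_gt0// mulr_gt0.
have [j Hj] : exists j, (\int[mu]_(z in E) `|(f_ n z - g_ j z)%:E| <= d'%:E)%E.
  have [fin /cvgrPdist_le /(_ _ d'0) near2] := (fine_cvgP _ _).1 Hg.
  have [j _ Hj] := filterI fin near2; exists j.
  have [fj] := Hj j (leqnn j); rewrite /= sub0r normrN => le.
  by rewrite -(fineK fj) lee_fin; apply: le_trans le; exact: ler_norm.
pose g := g_ j.
have mg : measurable_fun setT g by apply: continuous_measurable_fun; exact: cg.
(* Density of continuous functions is available in L^1. Clipping to [-N, N], where [f_ n] takes its
   values, does not increase the distance to it, and boundedness then turns the L^1 estimate into an
   L^2 one with a factor 2 N. *)
pose clip x := Num.max (- N) (Num.min N (g x)).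
have mclip : measurable_fun setT clip.
  by apply: measurable_maxr; [mfun|apply: measurable_minr; mfun].
have clipN x : `|clip x| <= N.
  rewrite ler_norml /clip le_max lexx/= ge_max ge_min lexx/=.
  by rewrite (@le_trans _ _ 0)// ?oppr_le0 ltW.
have cclip : continuous clip.
  move=> x; have c1 c : {for x, continuous (fun=> c : R^o)} by exact: cvg_cst.
  exact: (continuous_max (c1 (- N)) (continuous_min (c1 N) (cg j x))).
pose h x := if `|x| < N then clip x else 0.
have mh : measurable_fun setT h by rewrite /h; mfun.
pose D x := if x \in `[- N, N] then `|f_ n x - g x| else 0.
have mD : measurable_fun setT D.
  have -> : D = (fun x => `|f_ n x - g x|) \_ E.
    by apply/funext => x; rewrite /D patchE mem_setE.
  apply: (measurable_restrictT _ (measurable_itv _)).1; apply: measurable_funTS; mfun.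
have [ID DD] : rint D /\ \int[mu]_x D x <= d'.
  apply: ge0_rint => //; first by move=> x; rewrite /D; case: ifP.
  apply: le_trans Hj; rewrite [leRHS]integral_mkcond le_eqVlt; apply/orP; left; apply/eqP.
  by apply: eq_integral => x _; rewrite patchE /D mem_setE; case: ifP.
have clipd x : `|f_ n x - clip x| <= `|f_ n x - g x|.
  have := fn n x; rewrite -/N ler_norml => /andP[l u].
  rewrite /clip; case: (leP N (g x)) => gN.
    rewrite (max_idPr _); last by rewrite (le_trans _ (ltW N0))// oppr_le0 ltW.
    have a1 : f_ n x - N <= 0 by rewrite subr_le0.
    have a2 : f_ n x - g x <= 0 by rewrite subr_le0 (le_trans u).
    by rewrite !ler0_norm// lerN2 lerD2l lerN2.
  case: (leP (- N) (g x)) => gN' //.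
  have a1 : 0 <= f_ n x - - N by rewrite subr_ge0.
  have a2 : 0 <= f_ n x - g x by rewrite subr_ge0 (le_trans (ltW gN')).
  by rewrite !ger0_norm// lerD2l lerN2 ltW.
have hB x : (f_ n x - h x) ^+ 2 <= 2 * N * D x.
  rewrite /h /D in_itv/= -ler_norml; case: ltP => xN.
    rewrite (ltW xN) -(@real_normK _ (f_ n x - clip x)) ?num_real// expr2.
    apply: ler_pM => //; apply: le_trans (ler_normB _ _) _.
    by rewrite mulr_natl mulr2n lerD// fn.
  rewrite {1}/f_ -/N ltNge xN/= subrr expr0n/= mulr_ge0//; first by rewrite mulr_ge0// ltW.
  by case: ifP.
have hN x : `|h x| <= N by rewrite /h; case: ifP => // _; rewrite normr0 ltW.
have H_ : rint h.
  (* On |x| < N the factor exp (N^2) outweighs exp (- x^2), so a bounded function supported there is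
     dominated by a Gaussian. *)
  apply: gdom_rint => //; exists (N * expR (1 * N ^+ 2)), 1; split=> //.
    by rewrite mulr_ge0 ?expR_ge0// ltW.
  move=> x; rewrite -mulrA -expRD; have [xN|xN] := ltP `|x| N.
    apply: le_trans (hN x) _; rewrite ler_peMr ?(ltW N0)//.
    rewrite -[leLHS]expR0 ler_expR -mulrN -mulrDr mul1r subr_ge0.
    by rewrite -(@real_normK _ x) ?num_real// ler_sqr ?nnegrE// ltW.
  by rewrite /h ltNge xN/= normr0 mulr_ge0 ?expR_ge0// ltW.
have h2 := rint_sqr_bounded H_ hN.
have f2 := rint_sqr_bounded (F_ n) (fn n).
exists N, (f_ n), h; split; [split=> //|split; [split=> //|split=> //]].
- by apply: le_trans Hn _; lra.
- apply: (@le_trans _ _ (\int[mu]_x (2 * (f x - f_ n x) ^+ 2 + 2 * (2 * N * D x)))).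
    apply: Rint_le; first exact: rint_sqrB.
      by apply: rintD; apply: rintZ; [exact: rint_sqrB|exact: rintZ].
    move=> x; have := hB x; have := sqr_ge0 ((f x - f_ n x) - (f_ n x - h x)).
    have -> : f x - h x = (f x - f_ n x) + (f_ n x - h x) by ring.
    by rewrite sqrrB sqrrD => *; lra.
  rewrite RintD; [|exact/rintZ/rint_sqrB|exact/rintZ/rintZ].
  rewrite !RintZ//; [|exact: rintZ|exact: rint_sqrB].
  have : 2 * (2 * N * \int[mu]_x D x) <= d / 2.
    have -> : d / 2 = 2 * (2 * N * d') by rewrite /d'; field; rewrite gt_eqF.
    by rewrite ler_wpM2l// ler_wpM2l// mulr_ge0// ltW.
  by lra.
- move=> x xN; apply: (continuous_near_eq xN cclip) => y yN.
  by rewrite /h yN.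
- by move=> x xN; rewrite /f_ ltNge xN.
Unshelve. all: by end_near.
Qed.
End Density.

(** * Plancherel and Parseval identities *)

Section Plancherel.
Context {R : realType}.
Local Notation mu := (@lebesgue_measure R).
Implicit Types (f g h : R -> R) (a m x s t k d : R).

Lemma Rint_mul_le l f g : 0 < l -> measurable_fun setT f -> measurable_fun setT g ->
  rint (fun x => f x ^+ 2) -> rint (fun x => g x ^+ 2) ->
  `|\int[mu]_x (f x * g x)| <= l * \int[mu]_x f x ^+ 2 + l^-1 * \int[mu]_x g x ^+ 2.
Proof.
move=> l0 mf mg f2 g2; rewrite -!RintZ// -RintD; [|exact: rintZ|exact: rintZ].
apply: Rint_norm_le; [exact: rint_mul|by apply: rintD; exact: rintZ|move=> x].
have -> : f x * g x = l * (f x * (l^-1 * g x)) by field; rewrite gt_eqF.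
have -> : l^-1 * g x ^+ 2 = l * (l^-1 * g x) ^+ 2 by field; rewrite gt_eqF.
move: (f x) (l^-1 * g x) => u v.
rewrite normrM (gtr0_norm l0) -mulrDr (ler_wpM2l (ltW l0))//.
have := sqr_ge0 (u - v); have := sqr_ge0 (u + v); rewrite sqrrB sqrrD ler_norml => *.
by apply/andP; split; lra.
Qed.

Lemma sqrt_pi_inv a : 0 < a -> Num.sqrt (a / pi) * Num.sqrt (pi / a) = 1 :> R.
Proof.
move=> a0; rewrite -sqrtrM; last by rewrite divr_ge0 ?pi_ge0 ?ltW.
have p0 := pi_gt0 R.
by rewrite mulrA divfK ?divff ?sqrtr1// gt_eqF.
Qed.

Lemma gconvD a f g x : 0 < a -> rint f -> rint g ->
  gconv a (fun y => f y + g y) x = gconv a f x + gconv a g x.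
Proof.
move=> a0 F G; rewrite /gconv -RintD; try exact: gconv_section.
by apply: Rint_eq => y; rewrite mulrDl.
Qed.

(** The q's are the three pairings with a convolution, the j's their limits, M is the squared norm
    of f. The four small terms add up to 2 (w M + w) + 2 (w + w (2 M + 2)) = w (6 M + 8). *)
Lemma eps_split (w M e q1 q2 q3 j1 j2 j3 I1 I2 I3 : R) :
  `|q1| <= w * M + I1 -> `|q2| <= I2 + I3 -> `|j1| <= w * M + I1 -> `|j2| <= I2 + I3 ->
  I1 <= w -> I2 <= w -> I3 <= w * (2 * M + 2) -> w * (6 * M + 8) <= e / 2 ->
  `|j3 - q3| <= e / 2 -> `|j1 + (j2 + j3) - (q1 + (q2 + q3))| <= e.
Proof.
rewrite !ler_norml !mulrDr => /andP[? ?] /andP[? ?] /andP[? ?] /andP[? ?] ? ? ? ? /andP[? ?].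
by apply/andP; split; lra.
Qed.

(** With G the convolution, f G f = f G (f - h) + (f - f1) G h + f1 G h. The Schur test makes the
    first two terms small uniformly in n, and the third converges by dominated convergence. *)
Lemma gconv_cvg_L2 f : rint f -> rint (fun x => f x ^+ 2) ->
  Num.sqrt (n.+1%:R / pi) * \int[mu]_x (f x * gconv n.+1%:R f x) @[n --> \oo]
    --> \int[mu]_x f x ^+ 2.
Proof.
move=> F F2; have mf := rint_meas F.
pose M := \int[mu]_x f x ^+ 2.
have M0 : 0 <= M by apply: Rint_ge0 => x; exact: sqr_ge0.
pose c (n : nat) : R := Num.sqrt (n.+1%:R / pi).
have n0 (n : nat) : 0 < n.+1%:R :> R by rewrite ltr0n.
have qb l u v n : 0 < l -> rint u -> rint v -> rint (fun x => u x ^+ 2) -> rint (fun x => v x ^+ 2) ->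
   rint (fun x => u x * gconv n.+1%:R v x) /\
   `|c n * \int[mu]_x (u x * gconv n.+1%:R v x)| <= l * \int[mu]_x u x ^+ 2 + l^-1 * \int[mu]_x v x ^+ 2.
  move=> l0 U V u2 v2; have [I B] := gconv_schur (n0 n) l0 U V u2 v2; split=> //.
  rewrite normrM ger0_norm ?sqrtr_ge0//; apply: le_trans (ler_wpM2l (sqrtr_ge0 _) B) _.
  by rewrite mulrA sqrt_pi_inv// mul1r.
apply/cvgrPdist_le => e e0.
(* This w satisfies both w <= 1 and w (6 M + 8) <= e / 2. The approximation below is made to within
   w^2, so that an error divided by the weight w is still at most w. *)
pose w := e / (2 * (6 * M + 8) + e).
have D0 : 0 < 2 * (6 * M + 8) + e by lra.
have w0 : 0 < w by rewrite divr_gt0.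
have w1 : w <= 1 by rewrite ler_pdivrMr// mul1r; lra.
have we : w * (6 * M + 8) <= e / 2.
  rewrite /w mulrAC ler_pdivrMr//.
  have : 0 <= e * e by rewrite mulr_ge0// ltW.
  by move: (6 * M + 8) => Z; rewrite mulrDr => ?; lra.
have [N [f1 [h [[F1 f12 d1] [[H h2 d2] [hN ch f10]]]]]] := l2_approx F F2 (exprn_gt0 2 w0).
have mf1 := rint_meas F1; have mh := rint_meas H.
have B1 := rintB F H; have B12 : rint (fun x => (f x - h x) ^+ 2) by exact: rint_sqrB.
have B2 := rintB F F1; have B22 : rint (fun x => (f x - f1 x) ^+ 2) by exact: rint_sqrB.
have hM : \int[mu]_x h x ^+ 2 <= 2 * M + 2.
  apply: (@le_trans _ _ (\int[mu]_x (2 * f x ^+ 2 + 2 * (f x - h x) ^+ 2))).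
    apply: Rint_le => //; first by apply: rintD; exact: rintZ.
    move=> x; have -> : h x = f x - (f x - h x) by ring.
    have -> : f x - (f x - (f x - h x)) = f x - h x by ring.
    by have := sqr_ge0 (f x + (f x - h x)); rewrite sqrrB sqrrD => *; lra.
  rewrite RintD ?RintZ//; try exact: rintZ.
  have w21 : w ^+ 2 <= 1 by rewrite expr_le1// ltW.
  by rewrite -/M; lra.
have lim : c n * \int[mu]_x (f1 x * gconv n.+1%:R h x) @[n --> \oo] --> \int[mu]_x (f1 x * h x).
  have mg n : measurable_fun setT (gconv n.+1%:R h) by exact: rint_meas (gconv_rint (n0 n) H).1.
  have [||||_ L] := @rint_dct R (fun n x => f1 x * (c n * gconv n.+1%:R h x)) (fun x => f1 x * h x) (fun x => N * `|f1 x|).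
  - by move=> n; have := mg n; move: (gconv _ _) => G mG; mfun.
  - move=> x; have [xN|xN] := ltP `|x| N.
      by apply: cvgM; [exact: cvg_cst|exact: gconv_cvg H hN (ch x xN)].
    by rewrite f10// mul0r; apply: cvg_near_cst; apply: nearW => n; rewrite mul0r.
  - exact/rintZ/rint_norm.
  - move=> n x; rewrite normrM mulrC ler_wpM2r//.
    rewrite normrM ger0_norm ?sqrtr_ge0//.
    have [S Si] := gauss_integral_sym x (n0 n).
    have : `|gconv n.+1%:R h x| <= \int[mu]_y (N * expR (- (n.+1%:R * (x - y) ^+ 2))).
      apply: Rint_norm_le; [exact: gconv_section|exact: rintZ|move=> y].
      by rewrite normrM [X in _ * X <= _]ger0_norm ?expR_ge0// ler_wpM2r ?expR_ge0.
    rewrite RintZ// Si => B; apply: le_trans (ler_wpM2l (sqrtr_ge0 _) B) _.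
    by rewrite mulrCA sqrt_pi_inv// mulr1.
  rewrite (_ : (fun n => _) = (fun n => \int[mu]_x (f1 x * (c n * gconv n.+1%:R h x))))//.
  apply/funext => n; rewrite -RintZ; last exact: (qb 1 f1 h n ltr01 F1 H f12 h2).1.
  by apply: Rint_eq => x; rewrite mulrCA.
have e20 : 0 < e / 2 by lra.
move/cvgrPdist_le : lim => /(_ _ e20); apply: filterS => n Ln.
have [i1 b1] := qb w _ _ n w0 F B1 F2 B12.
have wi0 : 0 < w^-1 by rewrite invr_gt0.
have [i2 b2] := qb w^-1 _ _ n wi0 B2 H B22 h2.
have [i3 _] := qb 1 _ _ n ltr01 F1 H f12 h2.
have E : \int[mu]_x (f x * gconv n.+1%:R f x) = \int[mu]_x (f x * gconv n.+1%:R (fun y => f y - h y) x)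
   + (\int[mu]_x ((f x - f1 x) * gconv n.+1%:R h x) + \int[mu]_x (f1 x * gconv n.+1%:R h x)).
  rewrite -(RintD i2 i3) -(RintD i1 (rintD i2 i3)).
  apply: Rint_eq => x.
  have -> : gconv n.+1%:R f x = gconv n.+1%:R (fun y => f y - h y) x + gconv n.+1%:R h x.
    by rewrite -gconvD//; apply: Rint_eq => y; rewrite subrK.
  by ring.
have J : \int[mu]_x f x ^+ 2 = \int[mu]_x (f x * (f x - h x)) + (\int[mu]_x ((f x - f1 x) * h x) + \int[mu]_x (f1 x * h x)).
  have m1 : measurable_fun setT (fun x => f x - h x) by mfun.
  have m2 : measurable_fun setT (fun x => f x - f1 x) by mfun.
  rewrite -RintD; [|exact: rint_mul|exact: rint_mul].
  rewrite -RintD; [|exact: rint_mul|by apply: rintD; exact: rint_mul].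
  by apply: Rint_eq => x; ring.
have b3 : `|\int[mu]_x (f x * (f x - h x))| <= w * M + w^-1 * \int[mu]_x (f x - h x) ^+ 2.
  by apply: Rint_mul_le => //; mfun.
have b4 : `|\int[mu]_x ((f x - f1 x) * h x)| <= w^-1 * \int[mu]_x (f x - f1 x) ^+ 2 + w^-1^-1 * \int[mu]_x h x ^+ 2.
  by apply: Rint_mul_le => //; mfun.
have k1 : w^-1 * \int[mu]_x (f x - h x) ^+ 2 <= w.
  by rewrite mulrC ler_pdivrMr// -expr2.
have k2 : w^-1 * \int[mu]_x (f x - f1 x) ^+ 2 <= w.
  by rewrite mulrC ler_pdivrMr// -expr2.
have k3 : w^-1^-1 * \int[mu]_x h x ^+ 2 <= w * (2 * M + 2) by rewrite invrK ler_wpM2l// ltW.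
rewrite E J !mulrDr -/(c n).
exact: (eps_split b1 b2 b3 b4 k1 k2 k3 we Ln).
Qed.

(** For real f, [fcos f k] minus i times [fsin f k] is sqrt (2 pi) times the Fourier transform;
    leaving out the factor keeps the kernels bounded by 1. *)
Definition fcos f k := \int[mu]_x (f x * cos (k * x)).
Definition fsin f k := \int[mu]_x (f x * sin (k * x)).

Lemma measurable_cos2 : measurable_fun setT (fun z : R * R => cos (z.1 * z.2)).
Proof. by mfun. Qed.

Lemma measurable_sin2 : measurable_fun setT (fun z : R * R => sin (z.1 * z.2)).
Proof. by mfun. Qed.

Lemma measurable_fcos f : measurable_fun setT f -> measurable_fun setT (fcos f).
Proof.
move=> mf.
have H : measurable_fun setT (fun z : R * R => f z.2 * cos (z.1 * z.2)) by mfun.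
exact: measurable_Rint H.
Qed.

Lemma measurable_fsin f : measurable_fun setT f -> measurable_fun setT (fsin f).
Proof.
move=> mf.
have H : measurable_fun setT (fun z : R * R => f z.2 * sin (z.1 * z.2)) by mfun.
exact: measurable_Rint H.
Qed.

Lemma fcos_bound f k : rint f -> `|fcos f k| <= \int[mu]_x `|f x|.
Proof.
move=> F; apply: Rint_norm_le; [by apply: rint_cos => //; mfun|exact: rint_norm|move=> x].
by rewrite normrM ler_piMr// cos_max.
Qed.

Lemma fsin_bound f k : rint f -> `|fsin f k| <= \int[mu]_x `|f x|.
Proof.
move=> F; apply: Rint_norm_le; [by apply: rint_sin => //; mfun|exact: rint_norm|move=> x].
by rewrite normrM ler_piMr// sin_max.
Qed.

(* Regularizing by exp (- e k^2) turns the squared transform into a Gaussian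
   convolution, an approximate identity as e tends to 0. *)
Lemma gauss_fourier_sqr f e : 0 < e -> rint f -> rint (fun x => f x ^+ 2) ->
  rint (fun k => expR (- (e * k ^+ 2)) * (fcos f k ^+ 2 + fsin f k ^+ 2)) /\
  \int[mu]_k (expR (- (e * k ^+ 2)) * (fcos f k ^+ 2 + fsin f k ^+ 2)) =
  Num.sqrt (pi / e) * \int[mu]_x (f x * gconv (4 * e)^-1 f x).
Proof.
move=> e0 F F2; have mf := rint_meas F.
have mc := measurable_fcos mf; have ms := measurable_fsin mf.
pose E k := expR (- (e * k ^+ 2)).
have IE : rint E by have [] := gauss_integral0 e0.
have mE : measurable_fun setT E by rewrite /E; mfun.
have H1 : rint (fun k => E k * fcos f k).
  by apply: (rintM_bounded (C := \int[mu]_x `|f x|) IE) => // k; exact: fcos_bound.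
have H2 : rint (fun k => E k * fsin f k).
  by apply: (rintM_bounded (C := \int[mu]_x `|f x|) IE) => // k; exact: fsin_bound.
have cb (z : R * R) : `|cos (z.1 * z.2)| <= 1 by exact: cos_max.
have sb (z : R * R) : `|sin (z.1 * z.2)| <= 1 by exact: sin_max.
have [i1 j1 e1] := Rint_kernel_swap measurable_cos2 cb F H1.
have [i2 j2 e2] := Rint_kernel_swap measurable_sin2 sb F H2.
have I : rint (fun k => E k * (fcos f k ^+ 2 + fsin f k ^+ 2)).
  apply: rint_eq (rintD i1 i2) => k /=; rewrite -/(fcos f k) -/(fsin f k); ring.
split; first exact: I.
have -> : \int[mu]_k (E k * (fcos f k ^+ 2 + fsin f k ^+ 2)) =
   \int[mu]_k (E k * fcos f k * \int[mu]_x (f x * cos (k * x)) +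
               E k * fsin f k * \int[mu]_x (f x * sin (k * x))).
  by apply: Rint_eq => k; rewrite -/(fcos f k) -/(fsin f k); ring.
rewrite (RintD i1 i2) e1 e2 -(RintD j1 j2).
have P x : f x * \int[mu]_k (E k * fcos f k * cos (k * x)) +
           f x * \int[mu]_k (E k * fsin f k * sin (k * x)) =
           Num.sqrt (pi / e) * (f x * gconv (4 * e)^-1 f x).
  have mx y : measurable_fun setT (fun k : R => k * y) by mfun.
  have Hc : rint (fun k => E k * cos (k * x)) := rint_cos IE (mx x).
  have Hs : rint (fun k => E k * sin (k * x)) := rint_sin IE (mx x).
  have [u1 v1 w1] := Rint_kernel_swap measurable_cos2 cb F Hc.
  have [u2 v2 w2] := Rint_kernel_swap measurable_sin2 sb F Hs.
  rewrite -mulrDr mulrCA; congr (f x * _).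
  have -> : \int[mu]_k (E k * fcos f k * cos (k * x)) =
    \int[mu]_k (E k * cos (k * x) * fcos f k) by apply: Rint_eq => k; ring.
  have -> : \int[mu]_k (E k * fsin f k * sin (k * x)) =
    \int[mu]_k (E k * sin (k * x) * fsin f k) by apply: Rint_eq => k; ring.
  rewrite w1 w2 -(RintD v1 v2) -RintZ; last by apply: gconv_section; rewrite // invr_gt0 mulr_gt0.
  apply: Rint_eq => y.
  rewrite -mulrDr mulrCA; congr (f y * _).
  rewrite -(RintD (rint_cos Hc (mx y)) (rint_sin Hs (mx y))).
  have -> : expR (- ((4 * e)^-1 * (x - y) ^+ 2)) = expR (- ((x - y) ^+ 2 / (4 * e))).
    by rewrite mulrC.
  rewrite -(gauss_cos (x - y) e0); apply: Rint_eq => k /=.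
  have -> : (x - y) * k = k * x - k * y by ring.
  by rewrite cosB /E; ring.
rewrite (Rint_eq P) RintZ//.
have e40 : 0 < (4 * e)^-1 by rewrite invr_gt0 mulr_gt0.
exact: (gconv_schur e40 ltr01 F F F2 F2).1.
Qed.

(** The regularization parameter tends to 0 along [e n], for which the convolution exponent is
    exactly [n.+1]. Fatou with the uniform Schur bound first shows that the spectrum is integrable;
    it can then serve as its own dominating function, which identifies the integral. *)
Lemma plancherel f : rint f -> rint (fun x => f x ^+ 2) ->
  [/\ rint (fun k => fcos f k ^+ 2), rint (fun k => fsin f k ^+ 2) &
  \int[mu]_k (fcos f k ^+ 2 + fsin f k ^+ 2) = 2 * pi * \int[mu]_x f x ^+ 2].
Proof.
move=> F F2; have mf := rint_meas F.
have mc := measurable_fcos mf; have ms := measurable_fsin mf.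
pose e (n : nat) : R := (4 * n.+1%:R)^-1.
have n0 (n : nat) : 0 < n.+1%:R :> R by rewrite ltr0n.
have e0 n : 0 < e n by rewrite invr_gt0 mulr_gt0.
pose P k := fcos f k ^+ 2 + fsin f k ^+ 2.
have P0 k : 0 <= P k by rewrite addr_ge0// sqr_ge0.
have mP : measurable_fun setT P by rewrite /P; mfun.
pose T n := \int[mu]_k (expR (- (e n * k ^+ 2)) * P k).
have TE n : T n = 2 * pi * (Num.sqrt (n.+1%:R / pi) * \int[mu]_x (f x * gconv n.+1%:R f x)).
  have [_ Te] := gauss_fourier_sqr (e0 n) F F2; rewrite /T Te.
  have -> : (4 * e n)^-1 = n.+1%:R by rewrite /e invfM invrK mulrA mulVf ?mul1r.
  have -> : Num.sqrt (pi / e n) = 2 * pi * Num.sqrt (n.+1%:R / pi).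
    have p0 := pi_gt0 R.
    have -> : pi / e n = (2 * pi) ^+ 2 * (n.+1%:R / pi).
      by rewrite /e invrK; move: (n.+1%:R : R) (@pi R) p0 => N p p0; field; rewrite gt_eqF.
    by rewrite sqrtrM ?sqr_ge0// sqrtr_sqr ger0_norm// mulr_ge0// ltW.
  exact/esym/mulrA.
have cT : T n @[n --> \oo] --> 2 * pi * \int[mu]_x f x ^+ 2.
  rewrite (_ : T = fun n => 2 * pi * (Num.sqrt (n.+1%:R / pi) * \int[mu]_x (f x * gconv n.+1%:R f x))).
    by apply: cvgM; [exact: cvg_cst|exact: gconv_cvg_L2].
  by apply/funext => n; rewrite TE.
have ce k : expR (- (e n * k ^+ 2)) * P k @[n --> \oo] --> P k.
  rewrite -[X in _ --> X]mul1r; apply: cvgM; last exact: cvg_cst.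
  have c0 : - (e n * k ^+ 2) @[n --> \oo] --> - (0 * k ^+ 2).
    apply: cvgN; apply: cvgM; last exact: cvg_cst.
    rewrite (_ : e = fun n => 4^-1 * n.+1%:R^-1); last by apply/funext => n; rewrite /e invfM.
    by rewrite -(mulr0 4^-1); apply: cvgM; [exact: cvg_cst|exact: cvg_harmonic].
  have := cvg_comp _ _ c0 (@continuous_expR R (- (0 * k ^+ 2))).
  by rewrite mul0r oppr0 expR0.
have iT n : rint (fun k => expR (- (e n * k ^+ 2)) * P k) by have [] := gauss_fourier_sqr (e0 n) F F2.
have Tb n : T n <= 2 * pi * (2 * \int[mu]_x f x ^+ 2).
  rewrite TE ler_wpM2l//; first by rewrite mulr_ge0// pi_ge0.
  have [_ B] := gconv_schur (n0 n) ltr01 F F F2 F2.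
  apply: le_trans (ler_wpM2l (sqrtr_ge0 _) (le_trans (ler_norm _) B)) _.
  by rewrite mulrA sqrt_pi_inv// invr1; lra.
have [IP _] : rint P /\ \int[mu]_k P k <= 2 * pi * (2 * \int[mu]_x f x ^+ 2).
  apply: (rint_fatou iT) => // n k; by rewrite mulr_ge0// expR_ge0.
have [||||_ cT'] := @rint_dct R (fun n k => expR (- (e n * k ^+ 2)) * P k) P P.
- by move=> n; exact: rint_meas.
- exact: ce.
- exact: IP.
- move=> n k; rewrite normrM (ger0_norm (P0 k)) ler_piMl//.
  by apply: expRN_le1; exact: ltW.
have PE : \int[mu]_k P k = 2 * pi * \int[mu]_x f x ^+ 2.
  by rewrite -(cvg_lim _ cT)//; apply/esym/cvg_lim.
split=> //.
- apply: (@rint_le _ _ P) => //; first by mfun.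
  by move=> k; rewrite ger0_norm ?sqr_ge0// lerDl sqr_ge0.
- apply: (@rint_le _ _ P) => //; first by mfun.
  by move=> k; rewrite ger0_norm ?sqr_ge0// lerDr sqr_ge0.
Qed.

Lemma fcosD f g k : rint f -> rint g -> fcos (fun x => f x + g x) k = fcos f k + fcos g k.
Proof.
move=> F G; rewrite /fcos -RintD; try by apply: rint_cos => //; mfun.
by apply: Rint_eq => x; rewrite mulrDl.
Qed.

Lemma fsinD f g k : rint f -> rint g -> fsin (fun x => f x + g x) k = fsin f k + fsin g k.
Proof.
move=> F G; rewrite /fsin -RintD; try by apply: rint_sin => //; mfun.
by apply: Rint_eq => x; rewrite mulrDl.
Qed.

(** Polarization: Plancherel for f, g and f + g. *)
Lemma parseval f g : rint f -> rint (fun x => f x ^+ 2) -> rint g -> rint (fun x => g x ^+ 2) ->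
  rint (fun k => fcos f k * fcos g k + fsin f k * fsin g k) /\
  \int[mu]_k (fcos f k * fcos g k + fsin f k * fsin g k) = 2 * pi * \int[mu]_x (f x * g x).
Proof.
move=> F F2 G G2; have mf := rint_meas F; have mg := rint_meas G.
have mfc := measurable_fcos mf; have mfs := measurable_fsin mf.
have mgc := measurable_fcos mg; have mgs := measurable_fsin mg.
have [f1 f2 fE] := plancherel F F2; have [g1 g2 gE] := plancherel G G2.
have i1 : rint (fun k => fcos f k * fcos g k) by exact: rint_mul.
have i2 : rint (fun k => fsin f k * fsin g k) by exact: rint_mul.
have [_ _ H] := plancherel (rintD F G) (rint_sqrD mf mg F2 G2).
split; first exact: rintD.
move: H.
rewrite (@Rint_eq _ _ (fun k => (fcos f k ^+ 2 + fsin f k ^+ 2) + (fcos g k ^+ 2 + fsin g k ^+ 2)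
  + 2 * (fcos f k * fcos g k + fsin f k * fsin g k))); last first.
  by move=> k; rewrite fcosD// fsinD//; ring.
rewrite (@Rint_eq _ (fun x => (f x + g x) ^+ 2) (fun x => f x ^+ 2 + g x ^+ 2 + 2 * (f x * g x))); last first.
  by move=> k; ring.
have i3 : rint (fun x => f x * g x) by exact: rint_mul.
have Pf := rintD f1 f2; have Pg := rintD g1 g2; have Pc := rintD i1 i2.
rewrite (RintD (rintD Pf Pg) (rintZ 2 Pc)) (RintD Pf Pg) fE gE (RintZ 2 Pc).
rewrite (RintD (rintD F2 G2) (rintZ 2 i3)) (RintD F2 G2) (RintZ 2 i3).
move: (2 * pi) (\int[mu]_x f x ^+ 2) (\int[mu]_x g x ^+ 2) (\int[mu]_x (f x * g x)).
move: (Rintegral _ _ _) => q p A B C H.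
by clear -H; lra.
Qed.
End Plancherel.

(** * Bessel's inequality, Hermite functions and the exponential tail *)

Section Hermite.
Context {R : realType}.
Local Notation mu := (@lebesgue_measure R).
Implicit Types (f g h e r : R -> R) (m x s t k d : R) (p q : {poly R}).

Lemma Rint_cauchy_schwarz f g : measurable_fun setT f -> measurable_fun setT g ->
  rint (fun x => f x ^+ 2) -> rint (fun x => g x ^+ 2) ->
  (\int[mu]_x (f x * g x)) ^+ 2 <= (\int[mu]_x f x ^+ 2) * (\int[mu]_x g x ^+ 2).
Proof.
move=> mf mg f2 g2; have fg := rint_mul mf mg f2 g2.
pose F := \int[mu]_x f x ^+ 2; pose G := \int[mu]_x g x ^+ 2; pose B := \int[mu]_x (f x * g x).
have G0 : 0 <= G by apply: Rint_ge0 => x; exact: sqr_ge0.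
have H t : 0 <= F - 2 * t * B + t ^+ 2 * G.
  rewrite -RintZ// -RintZ// -RintB//; last exact: rintZ.
  rewrite -RintD; [|by apply: rintB => //; exact: rintZ|exact: rintZ].
  apply: Rint_ge0 => x.
  have -> : f x ^+ 2 - 2 * t * (f x * g x) + t ^+ 2 * g x ^+ 2 = (f x - t * g x) ^+ 2 by ring.
  exact: sqr_ge0.
change (B ^+ 2 <= F * G); have [G_eq|G_neq] := eqVneq G 0.
  rewrite G_eq mulr0; have [->|B0] := eqVneq B 0; first by rewrite expr0n.
  (* With G = 0 the quadratic form is affine in t; this t gives it the value -1, a contradiction. *)
  have := H ((F + 1) / (2 * B)); rewrite G_eq mulr0 addr0.
  have -> : 2 * ((F + 1) / (2 * B)) * B = F + 1 by field.
  by lra.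
have Gp : 0 < G by rewrite lt_neqAle eq_sym G_neq.
have := H (B / G).
have -> : F - 2 * (B / G) * B + (B / G) ^+ 2 * G = F - B ^+ 2 / G by field.
by rewrite subr_ge0 ler_pdivrMr.
Qed.

(** Subtracting from f its components along [g n], n < N, does not change its product with e, so
    Cauchy-Schwarz may be applied to the residual r. The components are removed one at a time; the
    clause on j >= N says that the later coefficients are still those of f. *)
Lemma bessel_orthogonal N (g : nat -> R -> R) (nu : nat -> R) e f :
  measurable_fun setT e -> measurable_fun setT f ->
  rint (fun x => e x ^+ 2) -> rint (fun x => f x ^+ 2) ->
  (forall n, measurable_fun setT (g n)) -> (forall n, rint (fun x => g n x ^+ 2)) ->
  (forall n, 0 < nu n) -> (forall n, \int[mu]_x g n x ^+ 2 = nu n) ->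
  (forall n j, (n < j)%N -> \int[mu]_x (g n x * g j x) = 0) ->
  (forall n, (n < N)%N -> \int[mu]_x (e x * g n x) = 0) ->
  (\int[mu]_x (e x * f x)) ^+ 2 <= (\int[mu]_x e x ^+ 2) *
    (\int[mu]_x f x ^+ 2 - \sum_(n < N) (\int[mu]_x (f x * g n x)) ^+ 2 / nu n).
Proof.
move=> me mf e2 f2 mg g2 nu0 gnu gort eg.
suff [r [mr r2 er rr _]] : exists r, [/\ measurable_fun setT r, rint (fun x => r x ^+ 2),
    \int[mu]_x (e x * r x) = \int[mu]_x (e x * f x),
    \int[mu]_x r x ^+ 2 = \int[mu]_x f x ^+ 2 - \sum_(n < N) (\int[mu]_x (f x * g n x)) ^+ 2 / nu n &
    forall j, (N <= j)%N -> \int[mu]_x (r x * g j x) = \int[mu]_x (f x * g j x)].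
  by rewrite -er -rr; exact: Rint_cauchy_schwarz.
elim: N eg => [|N ih] eg.
  by exists f; split=> //; rewrite big_ord0 subr0.
have [|r [mr r2 er rr rg]] := ih; first by move=> n nN; apply: eg; exact: ltnW.
pose a := \int[mu]_x (f x * g N x); have [c cE] : exists c, c = a / nu N by exists (a / nu N).
have mrN := rint_mul mr (mg N) r2 (g2 N).
have cg2 : rint (fun x => (c * g N x) ^+ 2).
  by apply: rint_eq (rintZ (c ^+ 2) (g2 N)) => x; rewrite -exprMn.
have mcg : measurable_fun setT (fun x => c * g N x).
  by apply: measurable_funM; [exact: measurable_cst|exact: mg].
exists (fun x => r x - c * g N x); split.
- exact: measurable_funB.
- exact: rint_sqrB.
- rewrite (@Rint_eq _ _ (fun x => e x * r x - c * (e x * g N x))); last by move=> x; ring.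
  have eN := rint_mul me (mg N) e2 (g2 N).
  by rewrite (RintB (rint_mul me mr e2 r2) (rintZ c eN)) (RintZ c eN) eg// mulr0 subr0.
- rewrite big_ord_recr/= opprD addrA -rr -/a.
  rewrite (@Rint_eq _ (fun x => (r x - c * g N x) ^+ 2) (fun x => r x ^+ 2 - 2 * c * (r x * g N x) + c ^+ 2 * g N x ^+ 2)); last by move=> x; ring.
  rewrite (RintD (rintB r2 (rintZ (2 * c) mrN)) (rintZ (c ^+ 2) (g2 N))).
  rewrite (RintB r2 (rintZ (2 * c) mrN)) (RintZ _ mrN) (RintZ _ (g2 N)) rg// gnu -/a cE.
  by field; rewrite gt_eqF.
- move=> j Nj; have rj := rint_mul mr (mg j) r2 (g2 j).
  have gj := rint_mul (mg N) (mg j) (g2 N) (g2 j).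
  rewrite (@Rint_eq _ _ (fun x => r x * g j x - c * (g N x * g j x))); last by move=> x; ring.
  by rewrite (RintB rj (rintZ c gj)) (RintZ c gj) gort// mulr0 subr0 rg// ltnW.
Qed.

Section HermitePoly.
Variable A : R.
Hypothesis A0 : 0 < A.

(* Hermite polynomials for the weight w(x) = exp (- 2 A x^2), normalized by
   hermp n.+1 * w = - (hermp n * w)'. *)
Fixpoint hermp n : {poly R} :=
  if n is n'.+1 then (4 * A) *: ('X * hermp n') - (hermp n')^`() else 1.

Lemma size_hermp n : (size (hermp n) <= n.+1)%N.
Proof.
elim: n => [|n ih]; first by rewrite size_poly1.
rewrite /= (leq_trans (size_polyD _ _))// geq_max size_polyN; apply/andP; split.
  by rewrite (leq_trans (size_scale_leq _ _))// (leq_trans (size_polyMleq _ _))// size_polyX.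
have [->|/lt_size_deriv h] := eqVneq (hermp n) 0; first by rewrite linear0 size_poly0.
exact: leq_trans (ltnW h) (leqW ih).
Qed.

Lemma coef_hermp n : (hermp n)`_n = (4 * A) ^+ n.
Proof.
elim: n => [|n ih]; first by rewrite coef1.
rewrite /= coefB coefZ coefXM/= ih coef_deriv exprS nth_default ?mul0rn ?subr0//.
exact: leq_trans (size_hermp n) _.
Qed.

Lemma horner_hermpS n x :
  (hermp n.+1).[x] = 4 * A * (x * (hermp n).[x]) - (hermp n)^`().[x].
Proof. by rewrite /= hornerD hornerN hornerZ hornerM hornerX. Qed.

Let w x := expR (- (2 * A * x ^+ 2)).
Let A20 : 0 < 2 * A. Proof. by rewrite mulr_gt0. Qed.

Lemma rint_hermw p q : rint (fun x => expR (- (2 * A * x ^+ 2)) * p.[x] * q.[x]).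
Proof.
apply: gdom_rint; first by mfun.
by do 2 apply: gdom_horner; exact: gdom_gauss.
Qed.

Lemma hermp_parts n q :
  \int[mu]_x (w x * q.[x] * (hermp n.+1).[x]) = \int[mu]_x (w x * q^`().[x] * (hermp n).[x]).
Proof.
have := @gdom_int_derive R (fun x => w x * q.[x] * (hermp n).[x])
  (fun x => w x * q^`().[x] * (hermp n).[x] - w x * q.[x] * (hermp n.+1).[x]).
rewrite RintB; [|exact: rint_hermw|exact: rint_hermw].
move=> H; apply/esym/eqP; rewrite -subr_eq0; apply/eqP; apply: H.
- move=> x; have dw := deriv_expR (deriv_opp (deriv_mul (deriv_cst (2 * A) x) (deriv_sqr (deriv_id x)))).
  apply: is_derive_eq (deriv_mul (deriv_mul dw (deriv_horner q x)) (deriv_horner (hermp n) x)) _.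
  by rewrite horner_hermpS /w; ring.
- by apply: is_derive_continuous => x; rewrite /w; der.
- by do 2 apply: gdom_horner; exact: gdom_gauss.
- apply: gdomD; last apply: gdomN;
  by do 2 apply: gdom_horner; exact: gdom_gauss.
Qed.

(** All n derivatives land on q. For q of degree below n this is orthogonality; for q = [hermp n]
    only the leading coefficient survives and gives the norm. *)
Lemma hermp_int n q : \int[mu]_x (w x * q.[x] * (hermp n).[x]) = \int[mu]_x (w x * q^`(n).[x]).
Proof.
elim: n q => [|n ih] q; first by apply: Rint_eq => x; rewrite derivn0 hornerC mulr1.
by rewrite hermp_parts ih; apply: Rint_eq => x; rewrite derivSn.
Qed.

(** Each factor takes half of the weight exponent 2 A. For A = beta^2 / 2 these functions lie in the
    Hermite space of the theorem. *)
Definition hermf n x := expR (- (A * x ^+ 2)) * (hermp n).[x].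
Definition hermnu n := (4 * A) ^+ n * n`!%:R * Num.sqrt (pi / (2 * A)).

Lemma hermf_mul n j x : hermf n x * hermf j x = w x * (hermp n).[x] * (hermp j).[x].
Proof.
rewrite /hermf /w (_ : - (2 * A * x ^+ 2) = - (A * x ^+ 2) + - (A * x ^+ 2)); last by ring.
by rewrite expRD; ring.
Qed.

Lemma hermf_orth n j : (n < j)%N -> \int[mu]_x (hermf n x * hermf j x) = 0.
Proof.
move=> nj; rewrite (Rint_eq (hermf_mul n j)) hermp_int derivn_poly0 ?(leq_trans (size_hermp n))//.
by rewrite -[RHS]Rint_zero; apply: Rint_eq => x; rewrite horner0 mulr0.
Qed.

Lemma rint_hermf_sqr n : rint (fun x => hermf n x ^+ 2).
Proof.
by apply: rint_eq (rint_hermw (hermp n) (hermp n)) => x; rewrite (expr2 (hermf n x)) hermf_mul.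
Qed.

Lemma measurable_hermf n : measurable_fun setT (hermf n).
Proof. by rewrite /hermf; mfun. Qed.

Lemma hermnu_gt0 n : 0 < hermnu n.
Proof.
by rewrite !mulr_gt0 ?exprn_gt0 ?mulr_gt0 ?ltr0n ?fact_gt0// sqrtr_gt0 divr_gt0 ?pi_gt0.
Qed.

Lemma hermf_norm n : \int[mu]_x hermf n x ^+ 2 = hermnu n.
Proof.
rewrite (@Rint_eq _ _ (fun x => w x * (hermp n).[x] * (hermp n).[x])); last first.
  by move=> x; rewrite (expr2 (hermf n x)) hermf_mul.
rewrite hermp_int.
have dn : (hermp n)^`(n) = ((4 * A) ^+ n * n`!%:R)%:P.
  apply/polyP => i; rewrite coef_derivn coefC; case: i => [|i].
    by rewrite addn0 coef_hermp/= ffactnn mulr_natr.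
  by rewrite nth_default ?mul0rn// (leq_trans (size_hermp n))// addnS ltnS leq_addr.
have [gi ge] := gauss_integral0 A20.
rewrite (@Rint_eq _ _ (fun x => (4 * A) ^+ n * n`!%:R * w x)); last first.
  by move=> x; rewrite dn hornerC mulrC.
by rewrite RintZ// ge.
Qed.

Section Coef.
Variables (c k : R).
(** The trailing 0 keeps the shape required by [gdom_expR]. E is what remains of window times
    Hermite weight after a constant is taken out. *)
Let E x := expR (- (2 * A * x ^+ 2) + c * x + 0).
Let gE : gdom E. Proof. exact: gdom_expR. Qed.
Let gEc p : gdom (fun x => E x * cos (k * x) * p.[x]).
Proof. by apply/gdom_horner/(gdomM_bounded (D := 1) gE) => x; exact: cos_max. Qed.
Let gEs p : gdom (fun x => E x * sin (k * x) * p.[x]).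
Proof. by apply/gdom_horner/(gdomM_bounded (D := 1) gE) => x; exact: sin_max. Qed.
Let Ic n := \int[mu]_x (E x * cos (k * x) * (hermp n).[x]).
Let Is n := \int[mu]_x (E x * sin (k * x) * (hermp n).[x]).
Let rEc p : rint (fun x => E x * cos (k * x) * p.[x]).
Proof. by apply: gdom_rint => //; rewrite /E; mfun. Qed.
Let rEs p : rint (fun x => E x * sin (k * x) * p.[x]).
Proof. by apply: gdom_rint => //; rewrite /E; mfun. Qed.

Let gZ f a : gdom f -> gdom (fun x => a * f x).
Proof.
by move=> F; apply: (gdom_le (gdomM_bounded (g := fun=> a) (D := `|a|) F _)) => // x; rewrite mulrC.
Qed.

(** With I_n = Ic n + i Is n, this recurrence and the next say I_(n+1) = (c + i k) I_n. Hence the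
    squared modulus is multiplied by c^2 + k^2 at each step. *)
Let IcS n : Ic n.+1 = c * Ic n - k * Is n.
Proof.
have := @gdom_int_derive R (fun x => E x * cos (k * x) * (hermp n).[x])
  (fun x => c * (E x * cos (k * x) * (hermp n).[x]) - k * (E x * sin (k * x) * (hermp n).[x])
     - E x * cos (k * x) * (hermp n.+1).[x]).
rewrite RintB//; last by apply: rintB; exact: rintZ.
rewrite RintB; [|exact: rintZ|exact: rintZ].
rewrite !RintZ// -/(Ic n) -/(Is n) -/(Ic n.+1).
move=> H; apply/esym/eqP; rewrite -subr_eq0; apply/eqP; apply: H => //.
- move=> x; have dE := deriv_expR (deriv_add (deriv_add (deriv_opp (deriv_mul (deriv_cst (2 * A) x) (deriv_sqr (deriv_id x)))) (deriv_mul (deriv_cst c x) (deriv_id x))) (deriv_cst 0 x)).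
  apply: is_derive_eq (deriv_mul (deriv_mul dE (deriv_cos (deriv_mul (deriv_cst k x) (deriv_id x)))) (deriv_horner (hermp n) x)) _.
  by rewrite horner_hermpS /E; ring.
- by apply: is_derive_continuous => x; rewrite /E; der.
- by apply: gdomD; [apply: gdomD; [exact: gZ|apply: gdomN; exact: gZ]|exact: gdomN].
Qed.

Let IsS n : Is n.+1 = c * Is n + k * Ic n.
Proof.
have := @gdom_int_derive R (fun x => E x * sin (k * x) * (hermp n).[x])
  (fun x => c * (E x * sin (k * x) * (hermp n).[x]) + k * (E x * cos (k * x) * (hermp n).[x])
     - E x * sin (k * x) * (hermp n.+1).[x]).
rewrite RintB//; last by apply: rintD; exact: rintZ.
rewrite RintD; [|exact: rintZ|exact: rintZ].
rewrite !RintZ// -/(Ic n) -/(Is n) -/(Is n.+1).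
move=> H; apply/esym/eqP; rewrite -subr_eq0; apply/eqP; apply: H => //.
- move=> x; have dE := deriv_expR (deriv_add (deriv_add (deriv_opp (deriv_mul (deriv_cst (2 * A) x) (deriv_sqr (deriv_id x)))) (deriv_mul (deriv_cst c x) (deriv_id x))) (deriv_cst 0 x)).
  apply: is_derive_eq (deriv_mul (deriv_mul dE (deriv_sin (deriv_mul (deriv_cst k x) (deriv_id x)))) (deriv_horner (hermp n) x)) _.
  by rewrite horner_hermpS /E; ring.
- by apply: is_derive_continuous => x; rewrite /E; der.
- by apply: gdomD; [apply: gdomD; exact: gZ|exact: gdomN].
Qed.

Lemma hermp_exp_coef n :
  (\int[mu]_x (expR (- (2 * A * x ^+ 2) + c * x + 0) * cos (k * x) * (hermp n).[x])) ^+ 2 +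
  (\int[mu]_x (expR (- (2 * A * x ^+ 2) + c * x + 0) * sin (k * x) * (hermp n).[x])) ^+ 2 =
  (c ^+ 2 + k ^+ 2) ^+ n * (pi / (2 * A) * expR ((c ^+ 2 - k ^+ 2) / (4 * A))).
Proof.
rewrite -/(Ic n) -/(Is n).
have -> : Ic n ^+ 2 + Is n ^+ 2 = (c ^+ 2 + k ^+ 2) ^+ n * (Ic 0 ^+ 2 + Is 0 ^+ 2).
  elim: n => [|n ih]; first by rewrite expr0 mul1r.
  by rewrite IcS IsS (exprS (c ^+ 2 + k ^+ 2) n) -[RHS]mulrA -ih; ring.
congr (_ * _).
(* The centre obtained by completing the square in - 2 A x^2 + c x. *)
pose m := c / (4 * A).
have A_neq0 : A != 0 by rewrite gt_eqF.
have EE x : E x = expR (c ^+ 2 / (8 * A)) * expR (- (2 * A * (x - m) ^+ 2)).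
  by rewrite -expRD /E /m; congr expR; field.
have [g1 i1] := gauss_cos_shift m k 0 A20.
have [g2 i2] := gauss_cos_shift m k (- (pi / 2)) A20.
pose S := expR (c ^+ 2 / (8 * A)) * (Num.sqrt (pi / (2 * A)) * expR (- (k ^+ 2 / (4 * (2 * A))))).
have Ic0 : Ic 0 = S * cos (k * m).
  have -> : S * cos (k * m) = expR (c ^+ 2 / (8 * A)) *
      (Num.sqrt (pi / (2 * A)) * expR (- (k ^+ 2 / (4 * (2 * A)))) * cos (k * m + 0)).
    by rewrite addr0 [RHS]mulrA.
  rewrite -i1 -RintZ//.
  by apply: Rint_eq => x; rewrite hornerC mulr1 EE addr0 mulrA.
have Is0 : Is 0 = S * sin (k * m).
  have -> : S * sin (k * m) = expR (c ^+ 2 / (8 * A)) *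
      (Num.sqrt (pi / (2 * A)) * expR (- (k ^+ 2 / (4 * (2 * A)))) * cos (k * m - pi / 2)).
    by rewrite cosBpihalf [RHS]mulrA.
  rewrite -i2 -RintZ//.
  by apply: Rint_eq => x; rewrite hornerC mulr1 EE cosBpihalf mulrA.
have -> : Ic 0 ^+ 2 + Is 0 ^+ 2 = S ^+ 2 * (cos (k * m) ^+ 2 + sin (k * m) ^+ 2).
  by rewrite Ic0 Is0 (exprMn _ S) (exprMn _ S) -mulrDr.
rewrite cos2Dsin2 mulr1 /S !exprMn sqr_sqrtr; last by rewrite divr_ge0 ?pi_ge0// ltW.
rewrite -!expRM_natl mulrCA -expRD; congr (_ * expR _).
by field.
Qed.
End Coef.

End HermitePoly.

(* Chernoff bound: x^n <= 2^-N (2 x)^n for N <= n. *)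
Lemma exp_tail (N : nat) x : 0 <= x ->
  expR x - \sum_(n < N) x ^+ n / n`!%:R <= (2 ^+ N)^-1 * expR (2 * x).
Proof.
move=> x0.
have cv y : series (exp_coeff y) n @[n --> \oo] --> expR y by exact: is_cvg_series_exp_coeff.
have x20 : 0 <= 2 * x by rewrite mulr_ge0.
have le2 M : series (exp_coeff (2 * x)) M <= expR (2 * x).
  apply: nondecreasing_cvgn_le; last exact: is_cvg_series_exp_coeff.
  apply/nondecreasing_seqP => n; rewrite !seriesEord/= big_ord_recr/= lerDl.
  exact: exp_coeff_ge0.
have key M : series (exp_coeff x) (N + M)%N - \sum_(n < N) x ^+ n / n`!%:R <= (2 ^+ N)^-1 * expR (2 * x).
  rewrite seriesEord/= big_split_ord/= addrAC subrr add0r.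
  apply: (@le_trans _ _ ((2 ^+ N)^-1 * series (exp_coeff (2 * x)) (N + M)%N)); last first.
    by rewrite ler_wpM2l// invr_ge0 exprn_ge0.
  rewrite seriesEord/= big_split_ord/= mulrDr.
  rewrite -[leLHS]add0r lerD//.
    by rewrite mulr_ge0 ?invr_ge0 ?exprn_ge0// sumr_ge0// => i _; exact: exp_coeff_ge0.
  rewrite mulr_sumr ler_sum// => i _; rewrite /exp_coeff/= exprMn -mulrA (mulrA (2 ^+ N)^-1).
  rewrite ler_peMl ?divr_ge0 ?exprn_ge0 ?ler0n//.
  by rewrite exprD mulKf ?expf_neq0// exprn_ege1// ler1n.
pose S := \sum_(n < N) x ^+ n / n`!%:R.
have H : series (exp_coeff x) n - S @[n --> \oo] --> expR x - S by apply: cvgB; [exact: cv|exact: cvg_cst].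
have K : (2 ^+ N)^-1 * expR (2 * x) @[_ --> \oo] --> (2 ^+ N)^-1 * expR (2 * x) by exact: cvg_cst.
apply: (ler_cvg_to H K).
near=> M; rewrite -(@subnKC N M); first exact: key.
by near: M; exact: nbhs_infty_ge.
Unshelve. all: by end_near.
Qed.
End Hermite.

(** * The windowed Fourier transform and its coefficients in the Hermite basis *)

Section Window.
Context {R : realType}.
Local Notation mu := (@lebesgue_measure R).
Implicit Types (f g h e u : R -> R) (A M m x s t q k d : R) (p : {poly R}).

Definition win A q x := expR (- (A * (q - x) ^+ 2)).

Lemma measurable_win A q : measurable_fun setT (win A q).
Proof. by rewrite /win; mfun. Qed.

Lemma win_sqr A q x : win A q x ^+ 2 = win (2 * A) q x.
Proof. by rewrite expr2 -expRD; congr expR; ring. Qed.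

Lemma win_int A q : 0 < A -> rint (win A q) /\ \int[mu]_x win A q x = Num.sqrt (pi / A).
Proof. by move=> A0; exact: gauss_integral_sym. Qed.

Lemma rint_win_sqr A q : 0 < A -> rint (fun x => win A q x ^+ 2).
Proof.
move=> A0; have A20 : 0 < 2 * A by rewrite mulr_gt0.
by apply: rint_eq (win_int q A20).1 => x; rewrite win_sqr.
Qed.

Lemma rint_mul_win A q f : 0 < A -> measurable_fun setT f -> rint (fun x => f x ^+ 2) ->
  rint (fun x => f x * win A q x).
Proof. by move=> A0 mf f2; exact: (rint_mul mf (measurable_win A q) f2 (rint_win_sqr q A0)). Qed.

Lemma rint_mul_win_sqr A q f : 0 < A -> measurable_fun setT f -> rint (fun x => f x ^+ 2) ->
  rint (fun x => (f x * win A q x) ^+ 2).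
Proof.
move=> A0 mf f2; have A20 : 0 < 2 * A by rewrite mulr_gt0.
apply: rint_eq (gconv_section q A20 f2) => x.
by rewrite exprMn win_sqr.
Qed.

(* Real and imaginary parts (up to sign) of the windowed Fourier transform of f
   at the phase-space point (q, k). *)
Definition Vc A f q k := fcos (fun x => f x * win A q x) k.
Definition Vs A f q k := fsin (fun x => f x * win A q x) k.
Definition V2 A f q k := Vc A f q k ^+ 2 + Vs A f q k ^+ 2.

Lemma V2_ge0 A f q k : 0 <= V2 A f q k.
Proof. by rewrite addr_ge0 ?sqr_ge0. Qed.

Lemma measurable_Vc A f : measurable_fun setT f ->
  measurable_fun setT (fun z : R * R => Vc A f z.1 z.2).
Proof.
move=> mf.
have H : measurable_fun setT (fun z : (R * R) * R => f z.2 * win A z.1.1 z.2 * cos (z.1.2 * z.2)).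
  by rewrite /win; mfun.
exact: measurable_Rint H.
Qed.

Lemma measurable_Vs A f : measurable_fun setT f ->
  measurable_fun setT (fun z : R * R => Vs A f z.1 z.2).
Proof.
move=> mf.
have H : measurable_fun setT (fun z : (R * R) * R => f z.2 * win A z.1.1 z.2 * sin (z.1.2 * z.2)).
  by rewrite /win; mfun.
exact: measurable_Rint H.
Qed.

Lemma measurable_V2 A f : measurable_fun setT f ->
  measurable_fun setT (fun z : R * R => V2 A f z.1 z.2).
Proof.
move=> mf; have mc := @measurable_Vc A f mf; have ms := @measurable_Vs A f mf.
by apply: measurable_funD; apply: measurable_funX.
Qed.

Lemma V2_int A f q : 0 < A -> measurable_fun setT f -> rint (fun x => f x ^+ 2) ->
  rint (V2 A f q) /\ \int[mu]_k V2 A f q k = 2 * pi * gconv (2 * A) (fun x => f x ^+ 2) q.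
Proof.
move=> A0 mf f2.
have [c s E] := plancherel (rint_mul_win q A0 mf f2) (rint_mul_win_sqr q A0 mf f2).
split; first exact: rintD c s.
rewrite [LHS]E; congr (_ * _); apply: Rint_eq => x.
by rewrite exprMn win_sqr.
Qed.

(* Resolution of the identity by the windowed waves. *)
Lemma window_parseval A u e : 0 < A -> measurable_fun setT u -> measurable_fun setT e ->
  rint (fun x => u x ^+ 2) -> rint (fun x => e x ^+ 2) ->
  [/\ forall q, rint (fun k => Vc A u q k * Vc A e q k + Vs A u q k * Vs A e q k),
      rint (fun q => \int[mu]_k (Vc A u q k * Vc A e q k + Vs A u q k * Vs A e q k)) &
      \int[mu]_q \int[mu]_k (Vc A u q k * Vc A e q k + Vs A u q k * Vs A e q k) =
      2 * pi * (Num.sqrt (pi / (2 * A)) * \int[mu]_x (u x * e x))].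
Proof.
move=> A0 mu_ me u2 e2; have A20 : 0 < 2 * A by rewrite mulr_gt0.
have P q := parseval (rint_mul_win q A0 mu_ u2) (rint_mul_win_sqr q A0 mu_ u2)
  (rint_mul_win q A0 me e2) (rint_mul_win_sqr q A0 me e2).
have [G1 G2] := gconv_rint A20 (rint_mul mu_ me u2 e2).
have E q : \int[mu]_k (Vc A u q k * Vc A e q k + Vs A u q k * Vs A e q k) =
   2 * pi * gconv (2 * A) (fun x => u x * e x) q.
  have [_ ->] := P q; congr (_ * _); apply: Rint_eq => x.
  by rewrite -/(win (2 * A) q x) -win_sqr; ring.
split; first by move=> q; have [] := P q.
- by apply: rint_eq (rintZ (2 * pi) G1) => q; rewrite E.
- by rewrite (Rint_eq E) (RintZ _ G1) G2.
Qed.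

Lemma gconv_ge0 a f x : (forall y, 0 <= f y) -> 0 <= gconv a f x.
Proof. by move=> f0; apply: Rint_ge0 => y; rewrite mulr_ge0// expR_ge0. Qed.

Definition tail M f x := if M < `|x| then f x else 0.

Lemma measurable_tail M f : measurable_fun setT f -> measurable_fun setT (tail M f).
Proof. by move=> mf; rewrite /tail; mfun. Qed.

Lemma rint_tail M f : rint f -> rint (tail M f).
Proof.
move=> F; have mt : measurable_fun setT (tail M f) := measurable_tail M (rint_meas F).
apply: (rint_le mt (rint_norm F)) => x.
by rewrite /tail; case: ifP => // _; rewrite normr0.
Qed.

(** For q > 2 M, q - x is the sum of the nonnegative numbers M and q - M - x, so its square is at
    least the sum of their squares; q < - 2 M is symmetric. The remaining Gaussian is retained for
    integrability in q, and adding both translates covers both signs of q. *)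
Lemma gauss_tail_pointwise A M q x : 0 < A -> 0 <= M -> 2 * M < `|q| -> `|x| <= M ->
  expR (- (A * (q - x) ^+ 2)) <=
  expR (- (A * M ^+ 2)) * (expR (- (A * (q - M - x) ^+ 2)) + expR (- (A * (q + M - x) ^+ 2))).
Proof.
move=> A0 M0 qM; rewrite ler_norml => /andP[xl xu].
rewrite mulrDr -!expRD.
have [q0|q0] := leP 0 q.
  rewrite ger0_norm// in qM.
  apply: (@le_trans _ _ (expR (- (A * M ^+ 2) + - (A * (q - M - x) ^+ 2)))).
    rewrite ler_expR -opprD lerN2 -mulrDr ler_pM2l//.
    have : 0 <= 2 * M * (q - M - x) by rewrite mulr_ge0// ?mulr_ge0//; lra.
    have -> : (q - x) ^+ 2 = M ^+ 2 + (q - M - x) ^+ 2 + 2 * M * (q - M - x) by ring.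
    by lra.
  by rewrite lerDl expR_ge0.
rewrite ltr0_norm// in qM.
apply: (@le_trans _ _ (expR (- (A * M ^+ 2) + - (A * (q + M - x) ^+ 2)))).
  rewrite ler_expR -opprD lerN2 -mulrDr ler_pM2l//.
  have : 0 <= 2 * M * (x - q - M) by rewrite mulr_ge0// ?mulr_ge0//; lra.
  have -> : (q - x) ^+ 2 = M ^+ 2 + (q + M - x) ^+ 2 + 2 * M * (x - q - M) by ring.
  by lra.
by rewrite lerDr expR_ge0.
Qed.

Lemma addM_ge0 (a c x y : R) : 0 <= a -> 0 <= c -> 0 <= x -> 0 <= y -> 0 <= a + c * (x + y).
Proof. by move=> a0 c0 x0 y0; rewrite addr_ge0// mulr_ge0// addr_ge0. Qed.

Lemma le_addM (z a c x y : R) : 0 <= a -> 0 <= c -> 0 <= x -> 0 <= y ->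
  a * z <= a * z + c * (a * x + a * y).
Proof. by move=> a0 c0 x0 y0; rewrite lerDl mulr_ge0// addr_ge0// mulr_ge0. Qed.

Lemma le_scaleM (z a c x y : R) : 0 <= a -> z <= c * (x + y) ->
  a * z <= 0 * z + c * (a * x + a * y).
Proof. by move=> a0 H; rewrite mul0r add0r -mulrDr mulrCA ler_wpM2l. Qed.

Lemma tail_sumE (s t c z : R) : s * t + c * (s * z + s * z) = s * (t + 2 * c * z).
Proof. by ring. Qed.

(** Mass of f beyond M may spread anywhere; mass within M reaches |q| > 2 M only through the
    Gaussian tail. The factor 2 counts the two translates, each of which has the full mass of the
    convolution. *)
Lemma gconv_tail A M f : 0 < A -> 0 <= M -> rint f -> (forall x, 0 <= f x) ->
  rint (tail (2 * M) (gconv A f)) /\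
  \int[mu]_q tail (2 * M) (gconv A f) q <=
  Num.sqrt (pi / A) * (\int[mu]_x tail M f x + 2 * expR (- (A * M ^+ 2)) * \int[mu]_x f x).
Proof.
move=> A0 M0 F f0.
have [G Gi] := gconv_rint A0 F.
have tf0 x : 0 <= tail M f x by rewrite /tail; case: ifP.
have iT := rint_tail M F.
have [T Ti] := gconv_rint A0 iT.
have [G1 G1i] := rint_translate (- M) G.
have [G2 G2i] := rint_translate M G.
pose c := expR (- (A * M ^+ 2)).
have c0 : 0 <= c by exact: expR_ge0.
have S q := gconv_section q A0 F.
have B q : tail (2 * M) (gconv A f) q <=
    gconv A (tail M f) q + c * (gconv A f (q - M) + gconv A f (q + M)).
  have g0 y : 0 <= gconv A f y := gconv_ge0 A y f0.
  have t0 : 0 <= gconv A (tail M f) q := gconv_ge0 A q tf0.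
  have rhs0 := addM_ge0 t0 c0 (g0 (q - M)) (g0 (q + M)).
  have -> : tail (2 * M) (gconv A f) q = if 2 * M < `|q| then gconv A f q else 0 by [].
  case: ifPn => [qM|_]; last exact: rhs0.
  have Sq := S q; have S1 := S (q - M); have S2 := S (q + M).
  have S3 := rintD (gconv_section q A0 iT) (rintZ c (rintD S1 S2)).
  have <- : \int[mu]_x (tail M f x * expR (- (A * (q - x) ^+ 2)) +
      c * (f x * expR (- (A * (q - M - x) ^+ 2)) + f x * expR (- (A * (q + M - x) ^+ 2)))) =
      gconv A (tail M f) q + c * (gconv A f (q - M) + gconv A f (q + M)).
    by rewrite (RintD (gconv_section q A0 iT) (rintZ c (rintD S1 S2))) (RintZ c (rintD S1 S2)) (RintD S1 S2).
  apply: (Rint_le Sq S3) => x.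
  have -> : tail M f x = if M < `|x| then f x else 0 by [].
  case: ifPn => [_|]; first exact: (le_addM _ (f0 x) c0 (expR_ge0 _) (expR_ge0 _)).
  rewrite -leNgt => xM.
  exact: (le_scaleM (f0 x) (gauss_tail_pointwise A0 M0 qM xM)).
have I := rintD T (rintZ c (rintD G1 G2)).
have It : rint (tail (2 * M) (gconv A f)) by exact: rint_tail.
split; first exact: It.
apply: le_trans (Rint_le It I B) _.
rewrite (RintD T (rintZ c (rintD G1 G2))) (RintZ c (rintD G1 G2)) (RintD G1 G2) G1i G2i Gi Ti.
by rewrite -/c tail_sumE lexx.
Qed.

Lemma norm_sqrM_le (a c : R) : `|c| <= 1 -> `|(a * c) ^+ 2| <= a ^+ 2.
Proof.
move=> c1; rewrite normrX normrM exprMn real_normK ?num_real// ler_piMr ?sqr_ge0//.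
by rewrite expr_le1.
Qed.

Lemma mul4_regroup (a b c d f h : R) : a * b = c * d -> a * f * (b * h) = c * (d * f * h).
Proof. by move=> H; rewrite -[d * f * h]mulrA [RHS]mulrA -H; ring. Qed.

Lemma coef_alg (E1 E2 E F Y f S : R) : F != 0 -> f != 0 -> S != 0 -> E1 * E2 = E ->
  E1 * (F * Y * (S * S * E2)) / (F * f * S) = S * E * (Y / f).
Proof. by move=> F0 f0 S0 <-; field; rewrite F0 f0 S0. Qed.

(** Bessel is applied to the cosine and sine windows separately, but only the sums of their squared
    norms and squared coefficients are explicit. Degree at most N means [N.+1] Hermite functions,
    hence the exponent of 2. *)
Lemma hermite_window A (N : nat) e q k : 0 < A ->
  measurable_fun setT e -> rint (fun x => e x ^+ 2) ->
  (forall p, (size p <= N.+1)%N -> \int[mu]_x (e x * (expR (- (A * x ^+ 2)) * p.[x])) = 0) ->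
  V2 A e q k <= (\int[mu]_x e x ^+ 2) *
    (Num.sqrt (pi / (2 * A)) * ((2 ^+ N.+1)^-1 * expR (A * q ^+ 2 + k ^+ 2 / (4 * A)))).
Proof.
move=> A0 me e2 eo; have A20 : 0 < 2 * A by rewrite mulr_gt0.
have mw := measurable_win A q.
have mc : measurable_fun setT (fun x => win A q x * cos (k * x)) by mfun.
have ms : measurable_fun setT (fun x => win A q x * sin (k * x)) by mfun.
have w2 := rint_win_sqr q A0.
have c2 : rint (fun x => (win A q x * cos (k * x)) ^+ 2).
  apply: (@rint_le _ _ (fun x => win A q x ^+ 2)) => //; first by mfun.
  by move=> x; apply: norm_sqrM_le; exact: cos_max.
have s2 : rint (fun x => (win A q x * sin (k * x)) ^+ 2).
  apply: (@rint_le _ _ (fun x => win A q x ^+ 2)) => //; first by mfun.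
  by move=> x; apply: norm_sqrM_le; exact: sin_max.
have ort n : (n < N.+1)%N -> \int[mu]_x (e x * hermf A n x) = 0.
  by move=> nN; apply: eo; apply: leq_trans (size_hermp A n) _.
have B f (mf : measurable_fun setT f) (f2 : rint (fun x => f x ^+ 2)) :=
  bessel_orthogonal me mf e2 f2 (measurable_hermf A) (rint_hermf_sqr A0) (hermnu_gt0 A0)
   (hermf_norm A0) (@hermf_orth R A A0) ort.
have Bc := B _ mc c2; have Bs := B _ ms s2.
pose a n := \int[mu]_x (win A q x * cos (k * x) * hermf A n x).
pose b n := \int[mu]_x (win A q x * sin (k * x) * hermf A n x).
pose S := Num.sqrt (pi / (2 * A)).
have S0 : 0 < S by rewrite sqrtr_gt0 divr_gt0 ?pi_gt0.
pose X := A * q ^+ 2 + k ^+ 2 / (4 * A).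
have X0 : 0 <= X.
  apply: addr_ge0; first by apply: mulr_ge0; [exact: ltW|exact: sqr_ge0].
  by apply: divr_ge0; [exact: sqr_ge0|apply/ltW/mulr_gt0].
have norm : \int[mu]_x (win A q x * cos (k * x)) ^+ 2 + \int[mu]_x (win A q x * sin (k * x)) ^+ 2 = S.
  rewrite -(RintD c2 s2) /S -(win_int q A20).2; apply: Rint_eq => x.
  by rewrite !exprMn -mulrDr cos2Dsin2 mulr1 win_sqr.
have coef n : (a n ^+ 2 + b n ^+ 2) / hermnu A n = S * expR (- X) * (X ^+ n / n`!%:R).
  (* The product of window and Hermite Gaussian is exp (- A q^2) times an exponential with linear
     coefficient c = 2 A q; then c^2 + k^2 = 4 A X, and the powers of 4 A cancel against
     [hermnu]. *)
  have K (f : R -> R) x : win A q x * f x * hermf A n x =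
     expR (- (A * q ^+ 2)) * (expR (- (2 * A * x ^+ 2) + 2 * A * q * x + 0) * f x * (hermp A n).[x]).
    have EXP : expR (- (A * (q - x) ^+ 2)) * expR (- (A * x ^+ 2)) =
        expR (- (A * q ^+ 2)) * expR (- (2 * A * x ^+ 2) + 2 * A * q * x + 0).
      by rewrite -!expRD; congr expR; ring.
    exact: (mul4_regroup _ _ EXP).
  have gE : gdom (fun x => expR (- (2 * A * x ^+ 2) + 2 * A * q * x + 0)) by exact: gdom_expR.
  have rc : rint (fun x => expR (- (2 * A * x ^+ 2) + 2 * A * q * x + 0) * cos (k * x) * (hermp A n).[x]).
    apply: gdom_rint; first by mfun.
    by apply/gdom_horner/(gdomM_bounded (D := 1) gE) => x; exact: cos_max.
  have rs : rint (fun x => expR (- (2 * A * x ^+ 2) + 2 * A * q * x + 0) * sin (k * x) * (hermp A n).[x]).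
    apply: gdom_rint; first by mfun.
    by apply/gdom_horner/(gdomM_bounded (D := 1) gE) => x; exact: sin_max.
  rewrite /a (Rint_eq (K (fun x => cos (k * x)))) (RintZ _ rc).
  rewrite /b (Rint_eq (K (fun x => sin (k * x)))) (RintZ _ rs).
  rewrite (exprMn _ (expR (- (A * q ^+ 2)))) (exprMn _ (expR (- (A * q ^+ 2)))) -mulrDr.
  rewrite (hermp_exp_coef A0).
  have cX : (2 * A * q) ^+ 2 + k ^+ 2 = 4 * A * X by rewrite /X; field; rewrite gt_eqF.
  have SS : pi / (2 * A) = S * S.
    rewrite -expr2 sqr_sqrtr//; apply: divr_ge0; [exact: pi_ge0|exact: ltW].
  rewrite cX (exprMn _ (4 * A)) /hermnu -/S SS -expRM_natl.
  have EX : expR (2%:R * - (A * q ^+ 2)) * expR (((2 * A * q) ^+ 2 - k ^+ 2) / (4 * A)) = expR (- X).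
    by rewrite -expRD /X; congr expR; field; rewrite gt_eqF.
  have F0 : (4 * A) ^+ n != 0 by rewrite expf_neq0// gt_eqF// mulr_gt0.
  have f0 : n`!%:R != 0 :> R by rewrite pnatr_eq0 -lt0n fact_gt0.
  have Sn0 : S != 0 by rewrite gt_eqF.
  exact: (coef_alg _ F0 f0 Sn0 EX).
have VcE : Vc A e q k = \int[mu]_x (e x * (win A q x * cos (k * x))).
  by apply: Rint_eq => x; rewrite mulrA.
have VsE : Vs A e q k = \int[mu]_x (e x * (win A q x * sin (k * x))).
  by apply: Rint_eq => x; rewrite mulrA.
rewrite /V2 VcE VsE; apply: le_trans (lerD Bc Bs) _.
have e0 : 0 <= \int[mu]_x e x ^+ 2 by apply: Rint_ge0 => x; exact: sqr_ge0.
rewrite -mulrDr (ler_wpM2l e0)//.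
have -> : \int[mu]_x (win A q x * cos (k * x)) ^+ 2 - \sum_(n < N.+1) a n ^+ 2 / hermnu A n +
  (\int[mu]_x (win A q x * sin (k * x)) ^+ 2 - \sum_(n < N.+1) b n ^+ 2 / hermnu A n) =
  S * (expR (- X) * (expR X - \sum_(n < N.+1) X ^+ n / n`!%:R)).
  rewrite addrACA norm -opprD -big_split/=.
  rewrite (eq_bigr (fun n : 'I_N.+1 => S * expR (- X) * (X ^+ n / n`!%:R))); last first.
    by move=> n _; rewrite -mulrDl coef.
  rewrite -mulr_sumr mulrBr -expRD addNr expR0.
  by move: (\sum_(i < _) _) => Z; ring.
rewrite (ler_wpM2l (ltW S0))//.
apply: le_trans (ler_wpM2l (expR_ge0 _) (exp_tail N.+1 X0)) _.
rewrite mulrCA -expRD.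
by have -> : - X + 2 * X = X by ring.
Qed.
End Window.

(** * Exchange of time and frequency, and numerical estimates *)

Section Core.
Context {R : realType}.
Local Notation mu := (@lebesgue_measure R).
Implicit Types (f g h e u : R -> R) (A M m x s t q k d : R) (p : {poly R}).

(** The exponent 1 / (4 A) is dual to A: the transform of this window is again a window, of exponent
    A. *)
Lemma win_fourier A k s t : 0 < A ->
  rint (fun x => win (4 * A)^-1 k x * cos (s * x + t)) /\
  \int[mu]_x (win (4 * A)^-1 k x * cos (s * x + t)) =
  Num.sqrt (pi * (4 * A)) * expR (- (A * s ^+ 2)) * cos (s * k + t).
Proof.
move=> A0; have A0' : 0 < (4 * A)^-1 by rewrite invr_gt0 mulr_gt0.
have [g i] := gauss_cos_shift k s t A0'.
have E x : expR (- ((4 * A)^-1 * (x - k) ^+ 2)) * cos (s * x + t) = win (4 * A)^-1 k x * cos (s * x + t).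
  by rewrite /win -sqrrN opprB.
split; first exact: rint_eq g.
rewrite -(Rint_eq E) i invrK (_ : s ^+ 2 / (4 * (4 * A)^-1) = A * s ^+ 2)//.
by field; rewrite gt_eqF.
Qed.

Section Freq.
Variables (A : R) (u : R -> R).
Hypotheses (A0 : 0 < A) (U : rint u) (u2 : rint (fun x => u x ^+ 2)).
Let A' := (4 * A)^-1.
Let A0' : 0 < A'. Proof. by rewrite invr_gt0 mulr_gt0. Qed.
Let s := Num.sqrt (pi * (4 * A)).
Let mu_ := rint_meas U.
Let mc := measurable_fcos mu_.
Let ms := measurable_fsin mu_.
Let mx y : measurable_fun setT (fun x : R => y * x). Proof. by mfun. Qed.
Let mk y : measurable_fun setT (fun x : R => x * y). Proof. by mfun. Qed.

Let cb (z : R * R) : `|cos (z.1 * z.2)| <= 1. Proof. exact: cos_max. Qed.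
Let sb (z : R * R) : `|sin (z.1 * z.2)| <= 1. Proof. exact: sin_max. Qed.
Let wc k q : rint (fun x => win A' k x * cos (q * x)) := rint_cos (win_int k A0').1 (mx q).
Let ws k q : rint (fun x => win A' k x * sin (q * x)) := rint_sin (win_int k A0').1 (mx q).

Let iVc q k : rint (fun x => u x * win A q x * cos (k * x)).
Proof. exact: rint_cos (rint_mul_win q A0 mu_ u2) (mx k). Qed.
Let iVs q k : rint (fun x => u x * win A q x * sin (k * x)).
Proof. exact: rint_sin (rint_mul_win q A0 mu_ u2) (mx k). Qed.

(* Up to a rotation by the angle k q, the windowed transform of u is the windowed
   transform of its Fourier transform, with q and k exchanged. *)
Lemma freq_sum q k : Vc A' (fcos u) k q + Vs A' (fsin u) k q =
  s * (cos (k * q) * Vc A u q k + sin (k * q) * Vs A u q k).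
Proof.
have [_ j1 e1] := Rint_kernel_swap (@measurable_cos2 R) cb U (wc k q).
have [_ j2 e2] := Rint_kernel_swap (@measurable_sin2 R) sb U (ws k q).
have -> : Vc A' (fcos u) k q = \int[mu]_x (win A' k x * cos (q * x) * \int[mu]_y (u y * cos (x * y))).
  by apply: Rint_eq => x; rewrite -/(fcos u x) -[LHS]mulrA mulrC.
have -> : Vs A' (fsin u) k q = \int[mu]_x (win A' k x * sin (q * x) * \int[mu]_y (u y * sin (x * y))).
  by apply: Rint_eq => x; rewrite -/(fsin u x) -[LHS]mulrA mulrC.
rewrite e1 e2 -(RintD j1 j2) /Vc /Vs /fcos /fsin.
rewrite -(RintZ _ (iVc q k)) -(RintZ _ (iVs q k)).
rewrite -(RintD (rintZ _ (iVc q k)) (rintZ _ (iVs q k))).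
rewrite -(RintZ _ (rintD (rintZ _ (iVc q k)) (rintZ _ (iVs q k)))).
apply: Rint_eq => x; rewrite /=.
rewrite -[LHS]mulrDr -(RintD (rint_cos (wc k q) (mk x)) (rint_sin (ws k q) (mk x))).
have [_ i] := win_fourier k (x - q) 0 A0.
rewrite (@Rint_eq _ _ (fun y => win A' k y * cos ((x - q) * y + 0))); last first.
  move=> y; rewrite (_ : (x - q) * y + 0 = y * x - q * y); last by ring.
  by rewrite cosB; ring.
rewrite i -/s (_ : (x - q) * k + 0 = k * x - k * q); last by ring.
rewrite cosB (_ : expR (- (A * (x - q) ^+ 2)) = win A q x); last by rewrite /win -sqrrN opprB.
by ring.
Qed.

(** The other component of the rotated vector; its sine integral is [win_fourier] at phase pi /
    2. *)
Lemma freq_diff q k : Vs A' (fcos u) k q - Vc A' (fsin u) k q =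
  s * (sin (k * q) * Vc A u q k - cos (k * q) * Vs A u q k).
Proof.
have [_ j1 e1] := Rint_kernel_swap (@measurable_cos2 R) cb U (ws k q).
have [_ j2 e2] := Rint_kernel_swap (@measurable_sin2 R) sb U (wc k q).
have -> : Vs A' (fcos u) k q = \int[mu]_x (win A' k x * sin (q * x) * \int[mu]_y (u y * cos (x * y))).
  by apply: Rint_eq => x; rewrite -/(fcos u x) -[LHS]mulrA mulrC.
have -> : Vc A' (fsin u) k q = \int[mu]_x (win A' k x * cos (q * x) * \int[mu]_y (u y * sin (x * y))).
  by apply: Rint_eq => x; rewrite -/(fsin u x) -[LHS]mulrA mulrC.
rewrite e1 e2 -(RintB j1 j2) /Vc /Vs /fcos /fsin.
rewrite -(RintZ _ (iVc q k)) -(RintZ _ (iVs q k)).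
rewrite -(RintB (rintZ _ (iVc q k)) (rintZ _ (iVs q k))).
rewrite -(RintZ _ (rintB (rintZ _ (iVc q k)) (rintZ _ (iVs q k)))).
apply: Rint_eq => x; rewrite /=.
rewrite -[LHS]mulrBr -(RintB (rint_cos (ws k q) (mk x)) (rint_sin (wc k q) (mk x))).
have [_ i] := win_fourier k (x - q) (pi / 2) A0.
rewrite (@Rint_eq _ _ (fun y => win A' k y * cos ((x - q) * y + pi / 2))); last first.
  move=> y; rewrite cosDpihalf (_ : (x - q) * y = y * x - q * y); last by ring.
  by rewrite sinB; ring.
rewrite i -/s cosDpihalf (_ : (x - q) * k = k * x - k * q); last by ring.
rewrite sinB (_ : expR (- (A * (x - q) ^+ 2)) = win A q x); last by rewrite /win -sqrrN opprB.
by ring.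
Qed.

Lemma rotation_sqr (c d a b t : R) : c ^+ 2 + d ^+ 2 = 1 ->
  (t * (c * a + d * b)) ^+ 2 + (t * (d * a - c * b)) ^+ 2 = t ^+ 2 * (a ^+ 2 + b ^+ 2).
Proof.
move=> H; rewrite (_ : _ + _ = t ^+ 2 * ((c ^+ 2 + d ^+ 2) * (a ^+ 2 + b ^+ 2))); last by ring.
by rewrite H mul1r.
Qed.

Lemma sqr_sum_le (a b c d : R) :
  (a + d) ^+ 2 + (b - c) ^+ 2 <= 2 * ((a ^+ 2 + b ^+ 2) + (c ^+ 2 + d ^+ 2)).
Proof.
by have := sqr_ge0 (a - d); have := sqr_ge0 (b + c); rewrite !sqrrB !sqrrD => *; lra.
Qed.

Lemma le_divl_scale (p v z : R) : 0 < p -> p * v <= 2 * z -> v <= 2 * p^-1 * z.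
Proof. by move=> p0 H; rewrite (mulrC 2) -mulrA -ler_pdivrMl ?invr_gt0// invrK. Qed.

(** The transform of u is complex, while [V2] is defined for real functions. Its cosine and sine
    parts are windowed separately, and the factor 2 is the price of dropping their cross terms. *)
Lemma V2_freq_le q k :
  V2 A u q k <= (2 * (pi * (4 * A))^-1) * (V2 A' (fcos u) k q + V2 A' (fsin u) k q).
Proof.
have p0 : 0 < pi * (4 * A) by rewrite !mulr_gt0 ?pi_gt0.
have s2 : s ^+ 2 = pi * (4 * A) by rewrite sqr_sqrtr// ltW.
have E := rotation_sqr (Vc A u q k) (Vs A u q k) s (cos2Dsin2 (k * q)).
rewrite -freq_sum -freq_diff s2 in E.
have := sqr_sum_le (Vc A' (fcos u) k q) (Vs A' (fcos u) k q) (Vc A' (fsin u) k q) (Vs A' (fsin u) k q).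
rewrite E => H; exact: (le_divl_scale p0 H).
Qed.

Let W k := fcos u k ^+ 2 + fsin u k ^+ 2.

Lemma rint_spec : rint W /\ \int[mu]_k W k = 2 * pi * \int[mu]_x u x ^+ 2.
Proof. by have [c d E] := plancherel U u2; split; [exact: rintD|]. Qed.

Lemma freq_const (p a g : R) : 0 < p -> 0 < a -> 2 * (p * (4 * a))^-1 * (2 * p * g) = a^-1 * g.
Proof. by move=> p0 a0; field; rewrite !gt_eqF. Qed.

Lemma V2_freq_int k : rint (fun q => V2 A u q k) /\
  \int[mu]_q V2 A u q k <= A^-1 * gconv (2 * A') W k.
Proof.
have [c d _] := plancherel U u2.
have [i1 e1] := V2_int k A0' mc c; have [i2 e2] := V2_int k A0' ms d.
have mV : measurable_fun setT (fun q => V2 A u q k).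
  have H := measurable_V2 A mu_.
  by have := @measurable_fun_pair1 _ _ _ _ _ _ _ k H.
have I := rintZ (2 * (pi * (4 * A))^-1) (rintD i1 i2).
have B q : `|V2 A u q k| <= (2 * (pi * (4 * A))^-1) * (V2 A' (fcos u) k q + V2 A' (fsin u) k q).
  by rewrite ger0_norm ?V2_ge0//; exact: V2_freq_le.
have J := rint_le mV I B.
split; first exact: J.
apply: le_trans (Rint_le J I (fun q => V2_freq_le q k)) _.
rewrite (RintZ _ (rintD i1 i2)) (RintD i1 i2) e1 e2 -mulrDr.
have A20' : 0 < 2 * A' by rewrite mulr_gt0.
rewrite -(gconvD k A20' c d) -/W.
by rewrite (freq_const _ (pi_gt0 R) A0) lexx.
Qed.

(** Tonelli moves the q integral inside. For fixed k it is controlled by a convolution of the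
    spectral density W, so [gconv_tail] applies with W as the mass and the dual exponent. *)
Lemma freq_tail M : 0 <= M ->
  rint (fun q => \int[mu]_k tail (2 * M) (V2 A u q) k) /\
  \int[mu]_q \int[mu]_k tail (2 * M) (V2 A u q) k <=
  A^-1 * (Num.sqrt (pi / (2 * A')) *
    (\int[mu]_k tail M W k + 2 * expR (- (2 * A' * M ^+ 2)) * (2 * pi * \int[mu]_x u x ^+ 2))).
Proof.
move=> M0; have A20' : 0 < 2 * A' by rewrite mulr_gt0.
have [iW eW] := rint_spec; rewrite -eW.
have W0 k : 0 <= W k by rewrite addr_ge0// sqr_ge0.
have [g1 g2] := gconv_tail A20' M0 iW W0.
pose Phi (z : R * R) := if 2 * M < `|z.1| then V2 A u z.2 z.1 else 0.
have mV : measurable_fun setT (fun z : R * R => V2 A u z.2 z.1).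
  exact: (measurableT_comp (measurable_V2 A mu_) (@measurable_swap _ _ _ _)).
have mPhi : measurable_fun setT Phi.
  by apply: measurable_if_lt => //; mfun.
have Phi0 z : 0 <= Phi z by rewrite /Phi; case: ifP => // _; exact: V2_ge0.
have s1 k : rint (fun q => Phi (k, q)).
  rewrite /Phi/=; case: (2 * M < `|k|); last exact: rint0.
  exact: (V2_freq_int k).1.
have s2 q : rint (fun k => Phi (k, q)).
  exact: (rint_tail (2 * M) (V2_int q A0 mu_ u2).1).
have B k : \int[mu]_q Phi (k, q) <= A^-1 * tail (2 * M) (gconv (2 * A') W) k.
  rewrite /Phi/= /tail; case: (2 * M < `|k|); last by rewrite Rint_zero mulr0.
  exact: (V2_freq_int k).2.
have I : rint (fun k => \int[mu]_q Phi (k, q)).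
  apply: (rint_le (measurable_Rint mPhi) (rintZ A^-1 g1)) => k.
  by rewrite ger0_norm; [exact: B|apply: Rint_ge0 => q; exact: Phi0].
have [I2 E] := Rint_tonelli mPhi Phi0 s1 s2 I.
split; first exact: I2.
rewrite -[leLHS]E; apply: le_trans (Rint_le I (rintZ A^-1 g1) B) _.
rewrite (RintZ _ g1).
by apply: ler_wpM2l; [rewrite invr_ge0; exact: ltW|exact: g2].
Qed.
End Freq.

Definition box (r x : R) : R := if `|x| <= r then 1 else 0.

Lemma box_int (r : R) : 0 <= r -> rint (box r) /\ \int[mu]_x box r x = 2 * r.
Proof.
move=> r0.
have i : (\int[mu]_x (box r x)%:E = (2 * r)%:E)%E.
  transitivity (\int[mu]_x (\1_(`[(- r), r]%classic : set R) x : R)%:E)%E.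
    apply: eq_integral => x _; rewrite indicE mem_setE in_itv/= -ler_norml /box.
    by case: (_ <= _).
  rewrite integral_indic//= setIT lebesgue_measure_itv/= lte_fin.
  case: ifPn => [_|]; first by rewrite -EFinB; congr EFin; ring.
  by rewrite -leNgt => rr; have -> : r = 0; [lra|rewrite mulr0].
have mb : measurable_fun setT (box r) by rewrite /box; mfun.
have b0 x : 0 <= box r x by rewrite /box; case: ifP.
have le : (\int[mu]_x (box r x)%:E <= (2 * r)%:E)%E by rewrite i lexx.
have [I _] := ge0_rint mb b0 le.
by split=> //; rewrite /Rintegral i.
Qed.

Lemma ler_pM_trans (a b A B C : R) : 0 <= a -> 0 <= b -> a <= A -> b <= B -> A * B <= C -> a * b <= C.
Proof. by move=> a0 b0 aA bB; apply: le_trans; exact: ler_pM. Qed.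

(** The claim amounts to N exp (5 N / 8) <= 25 * 2^(N+1). Bernoulli gives N <= 25 (1 + 1/25)^N, so
    (1 + 1/25) exp (5/8) <= 2 is enough; 25 is tuned to this. The bound on exp (5/8) is the tenth
    power of exp (1/16) <= 16/15, which comes from 1 - 1/16 <= exp (- 1/16). *)
Lemma exp_decay (N : nat) : N%:R * ((2 ^+ N.+1)^-1 * expR (N%:R / 2)) <= 25 * expR (- (N%:R / 8)) :> R.
Proof.
have y0 := expR_ge0 (1 / 16 : R).
have e16 : expR (1 / 16) <= 16 / 15 :> R.
  have := expR_ge1Dx (- (1 / 16) : R); rewrite expRN => H.
  have yp := expR_gt0 (1 / 16 : R).
  have H2 : 15 / 16 * expR (1 / 16) <= (expR (1 / 16))^-1 * expR (1 / 16) :> R.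
    by apply: ler_wpM2r => //; apply: le_trans H; lra.
  by rewrite mulVf ?gt_eqF// in H2; move: H2; clear; move=> ?; lra.
have e58 : expR (5 / 8) <= 1909 / 1000 :> R.
  have -> : 5 / 8 = 10%:R * (1 / 16) :> R by field.
  rewrite expRM_natl; move: (expR (1 / 16)) y0 e16 => y y0 y1.
  have -> : y ^+ 10 = y * y * (y * y) * y * (y * y * (y * y) * y) by ring.
  have y2 : y * y <= 1138 / 1000 by apply: (ler_pM_trans y0 y0 y1 y1); clear; lra.
  have p2 : 0 <= y * y by rewrite mulr_ge0.
  have y4 : y * y * (y * y) <= 12951 / 10000 by apply: (ler_pM_trans p2 p2 y2 y2); clear; lra.
  have p4 : 0 <= y * y * (y * y) by rewrite mulr_ge0.
  have y5 : y * y * (y * y) * y <= 13815 / 10000 by apply: (ler_pM_trans p4 y0 y4 y1); clear; lra.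
  have p5 : 0 <= y * y * (y * y) * y by rewrite mulr_ge0.
  by apply: (ler_pM_trans p5 p5 y5 y5); clear; lra.
have k1 : (1 + 1 / 25) * expR (5 / 8) <= 2 :> R by move: e58; clear; move=> ?; lra.
have bern (n : nat) : 1 + n%:R / 25 <= (1 + 1 / 25) ^+ n :> R.
  elim: n => [|n ih]; first by rewrite mul0r addr0 expr0.
  rewrite exprS -natr1; apply: (@le_trans _ _ ((1 + 1 / 25) * (1 + n%:R / 25))).
    by have : 0 <= n%:R :> R by []; move: (n%:R : R) => z z0; lra.
  by rewrite ler_wpM2l//; lra.
rewrite -(@ler_pM2r _ (expR (N%:R / 8)))// -[leRHS]mulrA -expRD addNr expR0 mulr1.
rewrite -!mulrA -expRD (_ : N%:R / 2 + N%:R / 8 = N%:R * (5 / 8)); last by field.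
rewrite expRM_natl.
have k2 : ((1 + 1 / 25) * expR (5 / 8)) ^+ N <= 2 ^+ N :> R.
  by rewrite lerXn2r ?nnegrE// mulr_ge0 ?expR_ge0//; lra.
rewrite exprMn in k2.
have N25 : N%:R <= 25 * (1 + 1 / 25) ^+ N :> R.
  by have := bern N; move: (_ ^+ N) (N%:R : R) => y z ?; lra.
rewrite mulrCA -ler_pdivlMl ?invr_gt0 ?exprn_gt0// invrK.
apply: (@le_trans _ _ (25 * (1 + 1 / 25) ^+ N * expR (5 / 8) ^+ N)).
  by rewrite ler_wpM2r// exprn_ge0// expR_ge0.
rewrite -mulrA mulrC ler_wpM2r// exprS; apply: (le_trans k2).
by rewrite ler_peMl ?exprn_ge0//; lra.
Qed.

Lemma amgm2 (w a b c d : R) : 0 < w ->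
  a * c + b * d <= w * (a ^+ 2 + b ^+ 2) + (4 * w)^-1 * (c ^+ 2 + d ^+ 2).
Proof.
move=> w0; have w4 : 0 < 4 * w by rewrite mulr_gt0.
rewrite -subr_ge0 (_ : _ - _ = (4 * w)^-1 * ((2 * w * a - c) ^+ 2 + (2 * w * b - d) ^+ 2)).
  apply: mulr_ge0; first by rewrite invr_ge0; exact: ltW.
  by apply: addr_ge0; exact: sqr_ge0.
by field; rewrite gt_eqF.
Qed.


(* AM-GM with weight 1 outside the box of phase space and weight w inside it, where
   the windowed transform of e is uniformly small. *)
Lemma region_bound (w v2 e2 h t t' c c' Bd : R) : 0 < w -> 0 <= v2 -> 0 <= e2 -> 0 <= Bd ->
  (forall l, 0 < l -> h <= l * v2 + (4 * l)^-1 * e2) ->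
  (t = v2 /\ 0 <= t' \/ t' = v2 /\ 0 <= t \/ [/\ 0 <= t, 0 <= t', c = 1, c' = 1 & e2 <= Bd]) ->
  0 <= c * c' ->
  h <= t + t' + w * v2 + (4^-1 * e2 + (4 * w)^-1 * Bd * c * c').
Proof.
move=> w0 v0 e0 B0 H; have w4 : 0 <= (4 * w)^-1 by rewrite invr_ge0 mulr_ge0// ltW.
have wv : 0 <= w * v2 by rewrite mulr_ge0// ltW.
have := H 1 ltr01; rewrite mul1r mulr1 => H1.
case=> [[-> t0]|[[-> t0]|[t0 t'0 -> -> eB]]] c0.
- have : 0 <= (4 * w)^-1 * Bd * c * c' by rewrite -mulrA mulr_ge0// mulr_ge0.
  by move: H1; clear -t0 wv; lra.
- have : 0 <= (4 * w)^-1 * Bd * c * c' by rewrite -mulrA mulr_ge0// mulr_ge0.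
  by move: H1; clear -t0 wv; lra.
- have := H w w0; have : (4 * w)^-1 * e2 <= (4 * w)^-1 * Bd by rewrite ler_wpM2l.
  rewrite !mulr1; move: e0 t0 t'0; clear; move=> *; lra.
Qed.

(** Expresses the frequency-side constant through sqrt (pi / (2 A)), the factor common to all other
    terms. *)
Lemma window_const (A : R) : 0 < A ->
  A^-1 * Num.sqrt (pi / (2 * (4 * A)^-1)) = 2 * Num.sqrt (pi / (2 * A)).
Proof.
move=> A0; have p0 := pi_gt0 R.
have -> : pi / (2 * (4 * A)^-1) = (2 * A) ^+ 2 * (pi / (2 * A)).
  by move: (@pi R) p0 A0; clear => p p0 A0; field; rewrite !gt_eqF.
rewrite sqrtrM ?sqr_ge0// sqrtr_sqr ger0_norm; last by rewrite mulr_ge0// ltW.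
by rewrite mulrA; congr (_ * _); field; rewrite gt_eqF.
Qed.

(** Division by 2 P S, with P standing for pi. The 31 is 2 from leakage in time, 4 from leakage in
    frequency and 25 from the weight in the box. Half of E remains: a quarter from weight 1 and at
    most a quarter from the box. *)
Lemma core_alg (S P eps x tx tw U E N Q : R) : 0 < S -> 1 <= P -> 0 <= tw -> 0 <= U -> 0 <= E -> 0 < eps ->
  N * Q <= 25 * eps ->
  2 * P * (S * x) <= 2 * P * (S * (tx + 2 * eps * U)) + 2 * S * (tw + 2 * eps * (2 * P * U)) +
    25 * eps * (2 * P * (S * U)) + (4^-1 * (2 * P * (S * E)) +
    (4 * (25 * eps))^-1 * (E * (S * Q)) * (2 * N)) ->
  x <= tx + tw + 31 * eps * U + 2^-1 * E.
Proof.
move=> S0 P1 tw0 U0 E0 e0 NQ H.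
have P0 : 0 < P by lra.
have PS : 0 < 2 * P * S by rewrite !mulr_gt0.
have H1 : (4 * (25 * eps))^-1 * (E * (S * Q)) * (2 * N) <= 2^-1 * (S * E).
  have -> : (4 * (25 * eps))^-1 * (E * (S * Q)) * (2 * N) = (2^-1 * (S * E)) * ((N * Q) / (25 * eps)).
    by field; rewrite gt_eqF.
  rewrite ler_piMr//; first by rewrite mulr_ge0// mulr_ge0// ltW.
  by rewrite ler_pdivrMr ?mul1r// mulr_gt0.
have H2 : 2^-1 * (S * E) <= 4^-1 * (2 * P * (S * E)).
  have SE : 0 <= S * E by rewrite mulr_ge0// ltW.
  have : S * E <= P * (S * E) by rewrite ler_peMl.
  by rewrite -(mulrA 2 P); move: (P * (S * E)) (S * E); clear; move=> *; lra.
have H3 : 2 * S * tw <= 2 * P * (S * tw).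
  have ST : 0 <= S * tw by rewrite mulr_ge0// ltW.
  have : S * tw <= P * (S * tw) by rewrite ler_peMl.
  by rewrite -!mulrA; move: (P * (S * tw)) (S * tw); clear; move=> *; lra.
rewrite -(ler_pM2l PS).
have -> : 2 * P * S * (tx + tw + 31 * eps * U + 2^-1 * E) =
  2 * P * (S * (tx + 2 * eps * U)) + (2 * P * (S * tw) + 2 * S * (2 * eps * (2 * P * U))) +
    25 * eps * (2 * P * (S * U)) + (4^-1 * (2 * P * (S * E)) + 4^-1 * (2 * P * (S * E))) by field.
rewrite -[leLHS]mulrA; move: H; rewrite (mulrDr (2 * S)).
move: (2 * P * (S * x)) (2 * P * (S * (tx + 2 * eps * U))) (2 * S * tw) (2 * P * (S * tw)) H1 H2 H3.
move: (2 * S * (2 * eps * (2 * P * U))) (25 * eps * (2 * P * (S * U))) (4^-1 * (2 * P * (S * E))).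
move: (_^-1 * _ * _) (2^-1 * (S * E)); clear; move=> *; lra.
Qed.

End Core.

(** * The phase-space estimate for an integrable function *)

Section CoreEstimate.
Context {R : realType}.

Lemma eq_leq_real (a b : R) : a = b -> a <= b.
Proof. by move=> ->. Qed.

Local Notation mu := (@lebesgue_measure R).
Implicit Types (f g h e u r i : R -> R) (A M m x s t q k d : R) (p : {poly R}).

Lemma window_region A M M' (N : nat) e u q k w : 0 < A -> 0 <= M -> 0 <= M' -> 0 < w ->
  2 * A * M ^+ 2 = N%:R / 8 -> 2 * (4 * A)^-1 * M' ^+ 2 = N%:R / 8 ->
  measurable_fun setT e -> rint (fun x => e x ^+ 2) ->
  (forall p, (size p <= N.+1)%N -> \int[mu]_x (e x * (expR (- (A * x ^+ 2)) * p.[x])) = 0) ->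
  Vc A u q k * Vc A e q k + Vs A u q k * Vs A e q k <=
  (if 2 * M < `|q| then V2 A u q k else 0) + tail (2 * M') (V2 A u q) k + w * V2 A u q k +
  (4^-1 * V2 A e q k + (4 * w)^-1 *
    ((\int[mu]_x e x ^+ 2) * (Num.sqrt (pi / (2 * A)) * ((2 ^+ N.+1)^-1 * expR (N%:R / 2)))) *
    box (2 * M) q * box (2 * M') k).
Proof.
move=> A0 M0 M'0 w0 hM hM' me e2 eo.
have e0 : 0 <= \int[mu]_x e x ^+ 2 by apply: Rint_ge0 => x; exact: sqr_ge0.
have B0 : 0 <= Num.sqrt (pi / (2 * A)) * ((2 ^+ N.+1)^-1 * expR (N%:R / 2)).
  by apply: mulr_ge0; [exact: sqrtr_ge0|apply: mulr_ge0; [rewrite invr_ge0; exact: exprn_ge0|exact: expR_ge0]].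
have b0 c x : 0 <= box c x by rewrite /box; case: ifP.
apply: (region_bound w0 (V2_ge0 _ _ _ _) (V2_ge0 _ _ _ _) (mulr_ge0 e0 B0)).
- by move=> l l0; exact: amgm2.
- have v0 := V2_ge0 A u q k.
  rewrite /tail /box; case: (leP `|q| (2 * M)) => qM; last by left; split=> //; case: ifP.
  case: (leP `|k| (2 * M')) => kM; last by right; left; split.
  right; right; split=> //.
  apply: le_trans (hermite_window q k A0 me e2 eo) _.
  apply: (ler_wpM2l e0); apply: (ler_wpM2l (sqrtr_ge0 _)).
  apply: ler_wpM2l; first by rewrite invr_ge0; exact: exprn_ge0.
  rewrite ler_expR.
  have q2 : q ^+ 2 <= 4 * M ^+ 2.
    rewrite (_ : 4 * M ^+ 2 = (2 * M) ^+ 2); last by ring.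
    by rewrite -(real_normK (num_real q)) ler_sqr ?nnegrE// mulr_ge0.
  have k2 : k ^+ 2 <= 4 * M' ^+ 2.
    rewrite (_ : 4 * M' ^+ 2 = (2 * M') ^+ 2); last by ring.
    by rewrite -(real_normK (num_real k)) ler_sqr ?nnegrE// mulr_ge0.
  apply: (@le_trans _ _ (A * (4 * M ^+ 2) + 4 * M' ^+ 2 / (4 * A))).
    apply: lerD; first exact: (ler_wpM2l (ltW A0)).
    by apply: ler_wpM2r => //; rewrite invr_ge0 mulr_ge0// ltW.
  have -> : A * (4 * M ^+ 2) = 2 * (2 * A * M ^+ 2) by ring.
  have -> : 4 * M' ^+ 2 / (4 * A) = 2 * (2 * (4 * A)^-1 * M' ^+ 2) by ring.
  by rewrite hM hM'; clear; lra.
- exact: mulr_ge0.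
Qed.

(** The first two identities fix the leakage exponents and the range of X in the box, the third
    fixes its area. The function e need only be square integrable, so the projection error can be
    used without truncation. *)
Lemma core A M M' (N : nat) e u : 0 < A -> 0 <= M -> 0 <= M' ->
  2 * A * M ^+ 2 = N%:R / 8 -> 2 * (4 * A)^-1 * M' ^+ 2 = N%:R / 8 -> M * M' = N%:R / 8 ->
  rint u -> rint (fun x => u x ^+ 2) ->
  measurable_fun setT e -> rint (fun x => e x ^+ 2) ->
  (forall p, (size p <= N.+1)%N -> \int[mu]_x (e x * (expR (- (A * x ^+ 2)) * p.[x])) = 0) ->
  \int[mu]_x (u x * e x) <= \int[mu]_x tail M (fun x => u x ^+ 2) x +
    \int[mu]_k tail M' (fun k => fcos u k ^+ 2 + fsin u k ^+ 2) k +
    31 * expR (- (N%:R / 8)) * \int[mu]_x u x ^+ 2 + 2^-1 * \int[mu]_x e x ^+ 2.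
Proof.
move=> A0 M0 M'0 hM hM' hMM U u2 me e2 eo.
have mu_ := rint_meas U; have A20 : 0 < 2 * A by rewrite mulr_gt0.
have [P1 P2 P3] := window_parseval A0 mu_ me u2 e2.
pose eps := expR (- (N%:R / 8)) : R.
have eps0 : 0 < eps by exact: expR_gt0.
have w0 : 0 < 25 * eps by rewrite mulr_gt0.
pose Q := (2 ^+ N.+1)^-1 * expR (N%:R / 2) : R.
pose S := Num.sqrt (pi / (2 * A)).
pose Bd := (\int[mu]_x e x ^+ 2) * (S * Q).
pose dl := (4 * (25 * eps))^-1 * Bd.
have [b1 b1i] := box_int (mulr_ge0 (ler0n R 2) M0).
have [b2 b2i] := box_int (mulr_ge0 (ler0n R 2) M'0).
have iu q := V2_int q A0 mu_ u2.
have ie q := V2_int q A0 me e2.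
have it q : rint (tail (2 * M') (V2 A u q)) := rint_tail (2 * M') (iu q).1.
have ia q : rint (fun k => if 2 * M < `|q| then V2 A u q k else 0).
  by case: (2 * M < `|q|); [exact: (iu q).1|exact: rint0].
have aE q : \int[mu]_k (if 2 * M < `|q| then V2 A u q k else 0) =
   2 * pi * tail (2 * M) (gconv (2 * A) (fun x => u x ^+ 2)) q.
  rewrite /tail; case: (2 * M < `|q|); first exact: (iu q).2.
  by rewrite Rint_zero mulr0.
have r1 q := rintD (ia q) (it q).
have r2 q := rintZ (25 * eps) (iu q).1.
have r3 q := rintZ 4^-1 (ie q).1.
have r4 q := rintZ (dl * box (2 * M) q) b2.
have rk q := rintD (rintD (r1 q) (r2 q)) (rintD (r3 q) (r4 q)).
have Hq q := Rint_le (P1 q) (rk q)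
  (fun k => window_region u q k A0 M0 M'0 w0 hM hM' me e2 eo).
have Eq q : \int[mu]_k ((if 2 * M < `|q| then V2 A u q k else 0) + tail (2 * M') (V2 A u q) k +
     25 * eps * V2 A u q k + (4^-1 * V2 A e q k + dl * box (2 * M) q * box (2 * M') k)) =
  2 * pi * tail (2 * M) (gconv (2 * A) (fun x => u x ^+ 2)) q + \int[mu]_k tail (2 * M') (V2 A u q) k +
  25 * eps * (2 * pi * gconv (2 * A) (fun x => u x ^+ 2) q) +
  (4^-1 * (2 * pi * gconv (2 * A) (fun x => e x ^+ 2) q) + dl * (2 * (2 * M')) * box (2 * M) q).
  rewrite (RintD (rintD (r1 q) (r2 q)) (rintD (r3 q) (r4 q))) (RintD (r1 q) (r2 q)) (RintD (r3 q) (r4 q)).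
  rewrite (RintD (ia q) (it q)) aE (RintZ _ (iu q).1) (RintZ _ (ie q).1) (RintZ _ b2) b2i (iu q).2 (ie q).2.
  by congr (_ + (_ + _)); exact: mulrAC.
have [G G1] := gconv_rint A20 u2; have [Ge Ge1] := gconv_rint A20 e2.
have u0 x : 0 <= u x ^+ 2 by exact: sqr_ge0.
have [g1 g2] := gconv_tail A20 M0 u2 u0.
have [t1 t2] := freq_tail A0 U u2 M'0.
have s1 := rintD (rintZ (2 * pi) g1) t1.
have s2 := rintZ (25 * eps) (rintZ (2 * pi) G).
have s3 := rintZ 4^-1 (rintZ (2 * pi) Ge).
have s4 := rintZ (dl * (2 * (2 * M'))) b1.
have sq := rintD (rintD s1 s2) (rintD s3 s4).
have HH := Rint_le P2 sq (fun q => le_trans (Hq q) (eq_leq_real (Eq q))).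
have RE := RintD (rintD s1 s2) (rintD s3 s4).
rewrite (RintD s1 s2) (RintD s3 s4) (RintD (rintZ (2 * pi) g1) t1) (RintZ _ g1) in RE.
rewrite (RintZ _ (rintZ (2 * pi) G)) (RintZ _ G) (RintZ _ (rintZ (2 * pi) Ge)) (RintZ _ Ge) in RE.
rewrite (RintZ _ b1) b1i G1 Ge1 in RE.
rewrite P3 RE in HH.
have S0 : 0 < S by rewrite sqrtr_gt0 divr_gt0// pi_gt0.
have p1 : 1 <= pi :> R by apply: le_trans (pi_ge2 R); rewrite ler1n.
have W0 k : 0 <= fcos u k ^+ 2 + fsin u k ^+ 2 by apply: addr_ge0; exact: sqr_ge0.
have tw0 : 0 <= \int[mu]_k tail M' (fun k => fcos u k ^+ 2 + fsin u k ^+ 2) k.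
  by apply: Rint_ge0 => k; rewrite /tail; case: (M' < `|k|) => //; exact: W0.
have U0 : 0 <= \int[mu]_x u x ^+ 2 by apply: Rint_ge0 => x; exact: sqr_ge0.
have E0 : 0 <= \int[mu]_x e x ^+ 2 by apply: Rint_ge0 => x; exact: sqr_ge0.
apply: (core_alg S0 p1 tw0 U0 E0 eps0 (exp_decay N)).
apply: le_trans HH _.
rewrite hM in g2; rewrite hM' (mulrA A^-1) (window_const A0) in t2.
have p2 : 0 <= 2 * pi :> R by rewrite mulr_ge0// pi_ge0.
apply: lerD; last first.
  apply: lerD; first exact: lexx.
  (* The box has sides 4 M and 4 M', hence area 16 M M' = 2 N. *)
  apply: eq_leq_real; rewrite /dl (_ : 2 * N%:R = 16 * (M * M')); last by rewrite hMM; field.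
  by rewrite /Bd; move: (_^-1) (_ * (S * Q)); clear; move=> *; ring.
apply: lerD; last exact: lexx.
apply: lerD; last exact: t2.
exact: (ler_wpM2l p2 g2).
Qed.
End CoreEstimate.

(** * Truncations and their Fourier transforms *)

Section Trunc.
Context {R : realType}.
Local Notation mu := (@lebesgue_measure R).
Implicit Types (f g h e u r i ur ui : R -> R) (A M m x s t q k d : R) (p : {poly R}).

Definition trunc (n : nat) u x : R := if `|x| <= n%:R then u x else 0.

Lemma truncE n u x : trunc n u x = u x * box n%:R x.
Proof. by rewrite /trunc /box; case: ifP => _; rewrite ?mulr1 ?mulr0. Qed.

Lemma norm_trunc n u x : `|trunc n u x| <= `|u x|.
Proof. by rewrite /trunc; case: ifP => // _; rewrite normr0. Qed.

Lemma trunc_sqr_le n u x : trunc n u x ^+ 2 <= u x ^+ 2.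
Proof. by rewrite /trunc; case: ifP => // _; rewrite expr0n/= sqr_ge0. Qed.

Lemma measurable_trunc n u : measurable_fun setT u -> measurable_fun setT (trunc n u).
Proof. by move=> m; rewrite /trunc; mfun. Qed.

Lemma rint_trunc n u : measurable_fun setT u -> rint (fun x => u x ^+ 2) ->
  rint (trunc n u) /\ rint (fun x => trunc n u x ^+ 2).
Proof.
move=> m u2; have [b _] := box_int (ler0n R n).
have b2 : rint (fun x => box n%:R x ^+ 2).
  by apply: rint_eq b => x; rewrite /box; case: ifP => _; rewrite ?expr1n ?expr0n.
split.
  by apply: rint_eq (rint_mul m (rint_meas b) u2 b2) => x; rewrite truncE.
have mt : measurable_fun setT (fun x => trunc n u x ^+ 2).
  by apply: measurable_funX; exact: measurable_trunc.
apply: (rint_le mt u2) => x.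
by rewrite ger0_norm ?sqr_ge0//; exact: trunc_sqr_le.
Qed.

Lemma Rint_trunc_cvg u e : measurable_fun setT u -> measurable_fun setT e ->
  rint (fun x => u x * e x) ->
  \int[mu]_x (trunc n u x * e x) @[n --> \oo] --> \int[mu]_x (u x * e x).
Proof.
move=> mu_ me ue.
have [||||//] := @rint_dct R (fun n x => trunc n u x * e x) (fun x => u x * e x) (fun x => `|u x * e x|).
- by move=> n; apply: measurable_funM => //; exact: measurable_trunc.
- move=> x; apply: cvg_near_cst; near=> n; rewrite /trunc ifT//.
  by near: n; exact: nbhs_infty_ger.
- exact: rint_norm.
- by move=> n x; rewrite !normrM ler_wpM2r//; exact: norm_trunc.
Unshelve. all: by end_near.
Qed.

Lemma trunc_fourier_reE n ur ui k : measurable_fun setT ur -> measurable_fun setT ui ->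
  rint (fun x => ur x ^+ 2) -> rint (fun x => ui x ^+ 2) ->
  trunc_fourier_re n ur ui k =
  (Num.sqrt (2 * pi))^-1 * (fcos (trunc n ur) k + fsin (trunc n ui) k).
Proof.
move=> mr mi r2 i2; have [r _] := rint_trunc n mr r2; have [i _] := rint_trunc n mi i2.
have mk : measurable_fun setT (fun x : R => k * x) by mfun.
rewrite /trunc_fourier_re; congr (_ * _).
rewrite /fcos /fsin -(RintD (rint_cos r mk) (rint_sin i mk)) Rintegral_mkcond.
apply: Rint_eq => x; rewrite patchE /trunc.
have -> : (x \in [set x : R | `|x| <= n%:R]) = (`|x| <= n%:R) by apply/idP/idP; rewrite inE.
by case: ifP => // _; rewrite !mul0r addr0.
Qed.

Lemma trunc_fourier_imE n ur ui k : measurable_fun setT ur -> measurable_fun setT ui ->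
  rint (fun x => ur x ^+ 2) -> rint (fun x => ui x ^+ 2) ->
  trunc_fourier_im n ur ui k =
  (Num.sqrt (2 * pi))^-1 * (fcos (trunc n ui) k - fsin (trunc n ur) k).
Proof.
move=> mr mi r2 i2; have [r _] := rint_trunc n mr r2; have [i _] := rint_trunc n mi i2.
have mk : measurable_fun setT (fun x : R => k * x) by mfun.
rewrite /trunc_fourier_im; congr (_ * _).
rewrite /fcos /fsin -(RintB (rint_cos i mk) (rint_sin r mk)) Rintegral_mkcond.
apply: Rint_eq => x; rewrite patchE /trunc.
have -> : (x \in [set x : R | `|x| <= n%:R]) = (`|x| <= n%:R) by apply/idP/idP; rewrite inE.
by case: ifP => // _; rewrite !mul0r subr0.
Qed.

Lemma fcosN f k : fcos f (- k) = fcos f k.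
Proof. by apply: Rint_eq => x; rewrite mulNr cosN. Qed.

Lemma fsinN f k : rint f -> fsin f (- k) = - fsin f k.
Proof.
move=> F; have mk : measurable_fun setT (fun x : R => k * x) by mfun.
rewrite /fsin -(RintN (rint_sin F mk)).
by apply: Rint_eq => x; rewrite mulNr sinN mulrN.
Qed.

(* The cross terms are odd in k, so they cancel over the symmetric tail. *)
Lemma spec_split M r i : rint r -> rint i -> rint (fun x => r x ^+ 2) -> rint (fun x => i x ^+ 2) ->
  rint (fun k => (fcos r k + fsin i k) ^+ 2 + (fcos i k - fsin r k) ^+ 2) /\
  \int[mu]_k tail M (fun k => fcos r k ^+ 2 + fsin r k ^+ 2) k +
  \int[mu]_k tail M (fun k => fcos i k ^+ 2 + fsin i k ^+ 2) k =
  \int[mu]_k tail M (fun k => (fcos r k + fsin i k) ^+ 2 + (fcos i k - fsin r k) ^+ 2) k.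
Proof.
move=> F G r2 i2; have [c1 s1 _] := plancherel F r2; have [c2 s2 _] := plancherel G i2.
have mc1 := measurable_fcos (rint_meas F); have mc2 := measurable_fcos (rint_meas G).
have ms1 := measurable_fsin (rint_meas F); have ms2 := measurable_fsin (rint_meas G).
have X := rintD (rint_sqrD mc1 ms2 c1 s2) (rint_sqrB mc2 ms1 c2 s1).
split; first exact: X.
have Y := rintB (rint_mul mc1 ms2 c1 s2) (rint_mul mc2 ms1 c2 s1).
have tY := rint_tail M Y.
have Y0 : \int[mu]_k tail M (fun k => fcos r k * fsin i k - fcos i k * fsin r k) k = 0.
  have [_] := rint_reflect tY.
  rewrite (@Rint_eq _ (fun k => tail M _ (- k)) (fun k => - tail M (fun k => fcos r k * fsin i k - fcos i k * fsin r k) k)).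
    by rewrite (RintN tY); move: (Rintegral _ _ _); clear; move=> z H; lra.
  move=> k; rewrite /tail normrN; case: (M < `|k|); last by rewrite oppr0.
  by rewrite !fcosN (fsinN _ F) (fsinN _ G) !mulrN opprB opprK addrC.
have t1 := rint_tail M (rintD c1 s1); have t2 := rint_tail M (rintD c2 s2).
rewrite -(RintD t1 t2) -[LHS]addr0 -(mulr0 2) -Y0 -(RintZ 2 tY) -(RintD (rintD t1 t2) (rintZ 2 tY)).
apply: Rint_eq => k; rewrite /tail; case: (M < `|k|); last by rewrite mulr0 !addr0.
by ring.
Qed.

Lemma sqr_add_le (x y z w : R) :
  (x + z) ^+ 2 + (y + w) ^+ 2 <= 2 * (z ^+ 2 + w ^+ 2) + 2 * (x ^+ 2 + y ^+ 2).
Proof.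
by have := sqr_ge0 (x - z); have := sqr_ge0 (y - w); rewrite !sqrrB !sqrrD => *; lra.
Qed.

(** Meant for (a, b) the transform of a truncation and (c, d) its L^2 limit. The error is charged
    over the whole line, where it tends to 0 by the definition of the limit. *)
Lemma tail_pair_le M (a b c d : R -> R) k :
  tail M (fun k => a k ^+ 2 + b k ^+ 2) k <=
  2 * tail M (fun k => c k ^+ 2 + d k ^+ 2) k + 2 * ((a k - c k) ^+ 2 + (b k - d k) ^+ 2).
Proof.
have p := addr_ge0 (sqr_ge0 (a k - c k)) (sqr_ge0 (b k - d k)).
rewrite /tail; case: (M < `|k|); last by rewrite mulr0 add0r mulr_ge0.
rewrite -{1}(subrK (c k) (a k)) -{1}(subrK (d k) (b k)).
exact: sqr_add_le.
Qed.

Lemma l2norm_sqr f g : l2norm f g ^+ 2 = \int[mu]_x (f x ^+ 2 + g x ^+ 2).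
Proof. by rewrite sqr_sqrtr//; apply: Rint_ge0 => x; apply: addr_ge0; exact: sqr_ge0. Qed.

Lemma l2norm_ge0 f g : 0 <= l2norm f g. Proof. exact: sqrtr_ge0. Qed.

Lemma L2c_rint f g : L2c f g -> [/\ measurable_fun setT f, measurable_fun setT g,
  rint (fun x => f x ^+ 2) & rint (fun x => g x ^+ 2)].
Proof.
move=> [mf [mg fg]].
have mP : measurable_fun setT (fun x => f x ^+ 2 + g x ^+ 2) by mfun.
have P0 x : 0 <= f x ^+ 2 + g x ^+ 2 by apply: addr_ge0; exact: sqr_ge0.
have P : rint (fun x => f x ^+ 2 + g x ^+ 2).
  apply/integrableP; split; first exact/measurable_EFinP.
  by under eq_integral do rewrite /= ger0_norm//.
split=> //.
- have m2 : measurable_fun setT (fun x => f x ^+ 2) by mfun.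
  by apply: (rint_le m2 P) => x; rewrite ger0_norm ?sqr_ge0// lerDl sqr_ge0.
- have m2 : measurable_fun setT (fun x => g x ^+ 2) by mfun.
  by apply: (rint_le m2 P) => x; rewrite ger0_norm ?sqr_ge0// lerDr sqr_ge0.
Qed.

End Trunc.

(** * Constants, complex-valued functions and the passage to the limit *)

Section Assembly.
Context {R : realType}.
Local Notation mu := (@lebesgue_measure R).

(** Every coefficient of the squared bound is at most C = 8 P + 62, a sum of squares of nonnegative
    numbers is at most the square of their sum, and C <= C^2 since C >= 1. *)
Lemma final_alg (P x t k v s : R) : 0 <= P -> 0 <= x -> 0 <= t -> 0 <= k -> 0 <= v -> 0 <= s ->
  x ^+ 2 <= 2 * t ^+ 2 + 8 * P * k ^+ 2 + 62 * s ^+ 2 * v ^+ 2 ->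
  x <= (8 * P + 62) * (t + k + v * s).
Proof.
move=> P0 x0 t0 k0 v0 s0 H.
set C := 8 * P + 62; have C1 : 1 <= C by rewrite /C; lra.
have C0 : 0 <= C by lra.
have vs0 : 0 <= v * s by rewrite mulr_ge0.
have sum0 : 0 <= t + k + v * s by rewrite !addr_ge0.
rewrite -ler_sqr ?nnegrE ?mulr_ge0//; apply: (le_trans H).
rewrite exprMn; apply: (@le_trans _ _ (C * (t + k + v * s) ^+ 2)); last first.
  by rewrite ler_wpM2r ?sqr_ge0// expr2 ler_peMl.
have t2 : 0 <= t ^+ 2 by exact: sqr_ge0. have k2 : 0 <= k ^+ 2 by exact: sqr_ge0.
have v2 : 0 <= (v * s) ^+ 2 by exact: sqr_ge0.
apply: (@le_trans _ _ (C * (t ^+ 2 + k ^+ 2 + (v * s) ^+ 2))).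
  rewrite (_ : 62 * s ^+ 2 * v ^+ 2 = 62 * (v * s) ^+ 2); last by ring.
  rewrite !mulrDr; apply: lerD; [apply: lerD|]; rewrite ler_wpM2r// /C; lra.
rewrite ler_wpM2l// (_ : (t + k + v * s) ^+ 2 = t ^+ 2 + k ^+ 2 + (v * s) ^+ 2 + 2 * (t * k + t * (v * s) + k * (v * s))); last by ring.
by rewrite lerDl mulr_ge0// !addr_ge0// mulr_ge0.
Qed.

(** All three identities reduce to a^2 = 1/8; beta cancels because position scales by 1 / beta and
    frequency by beta. *)
Lemma scale_consts (b N : R) : 0 < b -> 0 <= N ->
  let a := (2 * Num.sqrt 2)^-1 in let A := b ^+ 2 / 2 in
  [/\ 2 * A * (a * Num.sqrt N / b) ^+ 2 = N / 8,
      2 * (4 * A)^-1 * (a * Num.sqrt N * b) ^+ 2 = N / 8 &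
      (a * Num.sqrt N / b) * (a * Num.sqrt N * b) = N / 8].
Proof.
move=> b0 N0 a A.
have bn : b != 0 by rewrite gt_eqF.
have s2 : Num.sqrt 2 ^+ 2 = 2 :> R by rewrite sqr_sqrtr.
have a2 : a ^+ 2 = 8^-1 by rewrite /a exprVn exprMn s2; congr (_^-1); ring.
have n2 : Num.sqrt N ^+ 2 = N by rewrite sqr_sqrtr.
have -> : N / 8 = a ^+ 2 * Num.sqrt N ^+ 2 by rewrite a2 n2 mulrC.
rewrite /A; move: (Num.sqrt N) a {a2 s2 n2} => z a.
by split; field.
Qed.

Lemma measurable_hermite (b : R) p : measurable_fun setT (fun x : R => expR (- (b ^+ 2 * x ^+ 2) / 2) * p.[x]).
Proof. by mfun. Qed.

Lemma rint_hermite_sqr (b : R) p : 0 < b -> rint (fun x : R => (expR (- (b ^+ 2 * x ^+ 2) / 2) * p.[x]) ^+ 2).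
Proof.
move=> b0; have A0 : 0 < b ^+ 2 by rewrite exprn_gt0.
have g : gdom (fun x => expR (- (b ^+ 2 * x ^+ 2)) * p.[x] * p.[x]).
  by do 2 apply: gdom_horner; exact: gdom_gauss.
have m : measurable_fun setT (fun x : R => expR (- (b ^+ 2 * x ^+ 2)) * p.[x] * p.[x]) by mfun.
apply: rint_eq (gdom_rint m g) => x.
have -> : expR (- (b ^+ 2 * x ^+ 2)) =
    expR (- (b ^+ 2 * x ^+ 2) / 2) * expR (- (b ^+ 2 * x ^+ 2) / 2).
  by rewrite -expRD; congr expR; field.
by ring.
Qed.

Lemma trunc_alg (x y a1 a2 s1 s2 u1 u2 E1 E2 T X P H G D r i e : R) :
  x <= a1 + s1 + e * u1 + 2^-1 * E1 -> y <= a2 + s2 + e * u2 + 2^-1 * E2 ->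
  a1 + a2 <= T -> s1 + s2 = X -> X = 2 * P * H -> H <= 2 * G + 2 * D ->
  u1 <= r -> u2 <= i -> 0 <= e -> 0 <= P ->
  x + y <= T + 4 * P * (G + D) + e * (r + i) + 2^-1 * (E1 + E2).
Proof.
move=> hx hy hT hs hX hH hr hi e0 P0.
have h1 : e * u1 <= e * r by rewrite ler_wpM2l.
have h2 : e * u2 <= e * i by rewrite ler_wpM2l.
have h3 : 2 * P * H <= 4 * P * (G + D).
  by rewrite (_ : 4 * P * (G + D) = 2 * P * (2 * G + 2 * D)); [rewrite ler_wpM2l ?mulr_ge0|ring].
rewrite -hX -hs in h3; rewrite (mulrDr e).
move: (4 * P * (G + D)) (e * u1) (e * u2) (e * r) (e * i) hx hy hT h1 h2 h3; clear; move=> *; lra.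
Qed.

(** The left side is the real part of the inner product of the truncated u with e, so [core] is
    applied to the real and to the imaginary parts. [spec_split] then recombines their spectra into
    that of the complex truncation. *)
Lemma trunc_bound (A M M' : R) (N n : nat) (ur ui er ei gr gi : R -> R) :
  0 < A -> 0 <= M -> 0 <= M' ->
  2 * A * M ^+ 2 = N%:R / 8 -> 2 * (4 * A)^-1 * M' ^+ 2 = N%:R / 8 -> M * M' = N%:R / 8 ->
  L2c ur ui -> L2c er ei -> L2c gr gi ->
  (forall p : {poly R}, (size p <= N.+1)%N -> \int[mu]_x (er x * (expR (- (A * x ^+ 2)) * p.[x])) = 0) ->
  (forall p : {poly R}, (size p <= N.+1)%N -> \int[mu]_x (ei x * (expR (- (A * x ^+ 2)) * p.[x])) = 0) ->
  \int[mu]_x (trunc n ur x * er x) + \int[mu]_x (trunc n ui x * ei x) <=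
  l2norm (fun x => if M < `|x| then ur x else 0) (fun x => if M < `|x| then ui x else 0) ^+ 2 +
  4 * pi * (l2norm (fun k => if M' < `|k| then gr k else 0) (fun k => if M' < `|k| then gi k else 0) ^+ 2 +
    l2norm (fun k => trunc_fourier_re n ur ui k - gr k) (fun k => trunc_fourier_im n ur ui k - gi k) ^+ 2) +
  31 * expR (- (N%:R / 8)) * l2norm ur ui ^+ 2 + 2^-1 * l2norm er ei ^+ 2.
Proof.
move=> A0 M0 M'0 hM hM' hMM Lu Le Lg er0 ei0.
have [mr mi r2 i2] := L2c_rint Lu; have [mer mei er2 ei2] := L2c_rint Le.
have [mgr mgi gr2 gi2] := L2c_rint Lg.
have [tr tr2] := rint_trunc n mr r2; have [ti ti2] := rint_trunc n mi i2.
have Kr := core A0 M0 M'0 hM hM' hMM tr tr2 mer er2 er0.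
have Ki := core A0 M0 M'0 hM hM' hMM ti ti2 mei ei2 ei0.
have [X SX] := spec_split M' tr ti tr2 ti2.
pose sc : R := (Num.sqrt (2 * pi))^-1.
have p2 : 0 < 2 * pi :> R by rewrite mulr_gt0// pi_gt0.
(* Converts the unnormalized spectra into the unitary transform. *)
have sc2 : 2 * pi * sc ^+ 2 = 1 by rewrite /sc exprVn sqr_sqrtr ?(ltW p2)// divff// gt_eqF.
pose Fr k := fcos (trunc n ur) k + fsin (trunc n ui) k.
pose Fi k := fcos (trunc n ui) k - fsin (trunc n ur) k.
have [c1 s1 _] := plancherel tr tr2; have [c2 s2 _] := plancherel ti ti2.
have mFr : measurable_fun setT Fr.
  by apply: measurable_funD; [exact: measurable_fcos (rint_meas tr)|exact: measurable_fsin (rint_meas ti)].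
have mFi : measurable_fun setT Fi.
  by apply: measurable_funB; [exact: measurable_fcos (rint_meas ti)|exact: measurable_fsin (rint_meas tr)].
have Fr2 : rint (fun k => Fr k ^+ 2).
  exact: rint_sqrD (measurable_fcos (rint_meas tr)) (measurable_fsin (rint_meas ti)) c1 s2.
have Fi2 : rint (fun k => Fi k ^+ 2).
  exact: rint_sqrB (measurable_fcos (rint_meas ti)) (measurable_fsin (rint_meas tr)) c2 s1.
have hr : trunc_fourier_re n ur ui = (fun k => sc * Fr k) by apply/funext => k; exact: trunc_fourier_reE.
have hi : trunc_fourier_im n ur ui = (fun k => sc * Fi k) by apply/funext => k; exact: trunc_fourier_imE.
have mhr : measurable_fun setT (trunc_fourier_re n ur ui) by rewrite hr; mfun.
have mhi : measurable_fun setT (trunc_fourier_im n ur ui) by rewrite hi; mfun.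
have hr2 : rint (fun k => trunc_fourier_re n ur ui k ^+ 2).
  by rewrite hr; apply: rint_eq (rintZ (sc ^+ 2) Fr2) => k; rewrite -exprMn.
have hi2 : rint (fun k => trunc_fourier_im n ur ui k ^+ 2).
  by rewrite hi; apply: rint_eq (rintZ (sc ^+ 2) Fi2) => k; rewrite -exprMn.
have d1 := rintD (rint_sqrB mhr mgr hr2 gr2) (rint_sqrB mhi mgi hi2 gi2).
have tg := rint_tail M' (rintD gr2 gi2).
have th := rint_tail M' (rintD hr2 hi2).
have B1 := Rint_le th (rintD (rintZ 2 tg) (rintZ 2 d1)) (tail_pair_le M' _ _ gr gi).
rewrite (RintD (rintZ 2 tg) (rintZ 2 d1)) (RintZ 2 tg) (RintZ 2 d1) in B1.
have XE : \int[mu]_k tail M' (fun k => Fr k ^+ 2 + Fi k ^+ 2) k =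
   2 * pi * \int[mu]_k tail M' (fun k => trunc_fourier_re n ur ui k ^+ 2 + trunc_fourier_im n ur ui k ^+ 2) k.
  rewrite -(RintZ _ th); apply: Rint_eq => k; rewrite /tail; case: (M' < `|k|); last by rewrite mulr0.
  by rewrite hr hi !exprMn -mulrDr mulrA sc2 mul1r.
have tl a b M1 : l2norm (fun x => if M1 < `|x| then a x else 0) (fun x => if M1 < `|x| then b x else 0) ^+ 2 =
    \int[mu]_x tail M1 (fun x => a x ^+ 2 + b x ^+ 2) x.
  rewrite l2norm_sqr; apply: Rint_eq => x; rewrite /tail; case: (M1 < `|x|) => //.
  by rewrite expr0n addr0.
rewrite (tl ur ui M) (tl gr gi M') (l2norm_sqr ur ui) (l2norm_sqr er ei).
rewrite (l2norm_sqr (fun k => _ - gr k)) (RintD r2 i2) (RintD er2 ei2).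
have T1 : \int[mu]_x tail M (fun x => trunc n ur x ^+ 2) x + \int[mu]_x tail M (fun x => trunc n ui x ^+ 2) x <=
    \int[mu]_x tail M (fun x => ur x ^+ 2 + ui x ^+ 2) x.
  rewrite -(RintD (rint_tail M tr2) (rint_tail M ti2)).
  apply: (Rint_le (rintD (rint_tail M tr2) (rint_tail M ti2)) (rint_tail M (rintD r2 i2))) => x.
  rewrite /tail; case: (M < `|x|); last by rewrite addr0.
  by apply: lerD; exact: trunc_sqr_le.
have T2 := Rint_le tr2 r2 (trunc_sqr_le n ur).
have T3 := Rint_le ti2 i2 (trunc_sqr_le n ui).
have eps0 : 0 <= 31 * expR (- (N%:R / 8)) :> R by rewrite mulr_ge0// expR_ge0.
exact: (trunc_alg Kr Ki T1 SX XE B1 T2 T3 eps0 (pi_ge0 R)).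
Qed.
(** The product [0 * 0] is the form in which the limit of the squared transform error arrives. *)
Lemma absorb_half (E T P K e U : R) :
  E <= T + 4 * P * (K + 0 * 0) + 31 * e * U + 2^-1 * E ->
  E <= 2 * T + 8 * P * K + 62 * e * U.
Proof.
rewrite mulr0 addr0 => H.
have -> : 62 * e * U = 2 * (31 * e * U) by ring.
have -> : 8 * P * K = 2 * (4 * P * K) by ring.
by move: (31 * e * U) (4 * P * K) H; clear; move=> *; lra.
Qed.
End Assembly.

Unset Implicit Arguments.
Set Strict Implicit.

Theorem theorem2p4 (R : realType) :
  exists C : R, 0 < C /\
  forall (ur ui : R -> R) (N : nat) (beta : R) (pr pi_ gr gi : R -> R),
    L2c ur ui -> 0 < beta ->
    is_hatPi N beta ur ui pr pi_ ->
    is_L2_fourier ur ui gr gi ->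
    let a := (2 * Num.sqrt 2)^-1 in
    let b := (2 * Num.sqrt 2)^-1 in
    let c := (16 : R)^-1 in
    l2norm (fun x => ur x - pr x) (fun x => ui x - pi_ x) <=
      C * ( l2norm (fun x => if a * Num.sqrt N%:R / beta < `|x| then ur x else 0)
                   (fun x => if a * Num.sqrt N%:R / beta < `|x| then ui x else 0)
          + l2norm (fun k => if b * Num.sqrt N%:R * beta < `|k| then gr k else 0)
                   (fun k => if b * Num.sqrt N%:R * beta < `|k| then gi k else 0)
          + l2norm ur ui * expR (- (c * N%:R))).
Proof.
have pi0 := pi_ge0 R; have pip := pi_gt0 R.
(* The coefficients 2, 8 pi and 62 of the squared estimate are each at most this constant. *)
exists (8 * pi + 62); split; first by rewrite addr_gt0// mulr_gt0.
move=> ur ui N beta pr pi_ gr gi Lu b0 [[p1 [p2 [sp1 [sp2 [prE piE]]]]] orth] [Lg cF].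
cbv zeta; set a : R := (2 * Num.sqrt 2)^-1.
have [mr mi r2 i2] := L2c_rint Lu.
pose P p x := expR (- (beta ^+ 2 * x ^+ 2) / 2) * (p : {poly R}).[x].
have mP p : measurable_fun setT (P p) := measurable_hermite beta p.
have P2 p : rint (fun x => P p x ^+ 2) := rint_hermite_sqr p b0.
pose er x := ur x - pr x; pose ei x := ui x - pi_ x.
have mpr : measurable_fun setT pr by rewrite prE; exact: mP.
have mpi : measurable_fun setT pi_ by rewrite piE; exact: mP.
have pr2 : rint (fun x => pr x ^+ 2) by rewrite prE; exact: P2.
have pi2 : rint (fun x => pi_ x ^+ 2) by rewrite piE; exact: P2.
have mer : measurable_fun setT er by exact: measurable_funB.
have mei : measurable_fun setT ei by exact: measurable_funB.
have er2 : rint (fun x => er x ^+ 2) := rint_sqrB mr mpr r2 pr2.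
have ei2 : rint (fun x => ei x ^+ 2) := rint_sqrB mi mpi i2 pi2.
have Le : L2c er ei.
  by split=> //; split=> //; rewrite (rint_fin (rintD er2 ei2)) ltry.
pose A := beta ^+ 2 / 2; have A0 : 0 < A by rewrite divr_gt0// exprn_gt0.
have PE p x : P p x = expR (- (A * x ^+ 2)) * p.[x].
  by rewrite /P /A; congr (expR _ * _); field.
have P00 x : P 0 x = 0 by rewrite /P horner0 mulr0.
(* Testing against real polynomials suffices: the real part of the inner product isolates [er], the
   imaginary part isolates [ei]. *)
have hP (p : {poly R}) : (size p <= N.+1)%N -> in_hatP N beta (P p) (P 0).
  by move=> sp; exists p, 0; split=> //; split; [rewrite size_poly0|split].
have er0 (p : {poly R}) : (size p <= N.+1)%N -> \int[@lebesgue_measure R]_x (er x * (expR (- (A * x ^+ 2)) * p.[x])) = 0.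
  move=> sp; have [<- _] := orth _ _ (hP p sp); apply: Rint_eq => x.
  by rewrite P00 mulr0 addr0 PE.
have ei0 (p : {poly R}) : (size p <= N.+1)%N -> \int[@lebesgue_measure R]_x (ei x * (expR (- (A * x ^+ 2)) * p.[x])) = 0.
  move=> sp; have [_ <-] := orth _ _ (hP p sp); apply: Rint_eq => x.
  by rewrite P00 mulr0 subr0 PE.
have [hM hM' hMM] := scale_consts b0 (ler0n R N).
have a0 : 0 <= a by rewrite invr_ge0 mulr_ge0// sqrtr_ge0.
have M0 : 0 <= a * Num.sqrt N%:R / beta by rewrite divr_ge0 ?mulr_ge0 ?sqrtr_ge0// ltW.
have M'0 : 0 <= a * Num.sqrt N%:R * beta by rewrite !mulr_ge0 ?sqrtr_ge0// ltW.
have B n := trunc_bound n A0 M0 M'0 hM hM' hMM Lu Le Lg er0 ei0.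
have iur := rint_mul mr mer r2 er2; have iui := rint_mul mi mei i2 ei2.
(* The projection is itself an admissible test function, so (u, e) = (e, e). Only the real part is
   needed, since the value is real. *)
have EL : \int[@lebesgue_measure R]_x (ur x * er x) + \int[@lebesgue_measure R]_x (ui x * ei x) = l2norm er ei ^+ 2.
  have ipr : in_hatP N beta pr pi_ by exists p1, p2.
  have [H _] := orth _ _ ipr.
  have ipp := rintD (rint_mul mer mpr er2 pr2) (rint_mul mei mpi ei2 pi2).
  rewrite l2norm_sqr -(RintD iur iui) -[RHS]addr0 -H -(RintD (rintD er2 ei2) ipp).
  by apply: Rint_eq => x; rewrite /er /ei; ring.
pose Tx := l2norm (fun x => if a * Num.sqrt N%:R / beta < `|x| then ur x else 0)
                  (fun x => if a * Num.sqrt N%:R / beta < `|x| then ui x else 0).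
pose Tk := l2norm (fun k => if a * Num.sqrt N%:R * beta < `|k| then gr k else 0)
                  (fun k => if a * Num.sqrt N%:R * beta < `|k| then gi k else 0).
pose eps : R := expR (- (N%:R / 8)).
(* In the bound for truncations only the transform error depends on n, and it vanishes in the
   limit. *)
have cR : Tx ^+ 2 + 4 * pi * (Tk ^+ 2 + l2norm (fun k => trunc_fourier_re n ur ui k - gr k)
      (fun k => trunc_fourier_im n ur ui k - gi k) ^+ 2) + 31 * eps * l2norm ur ui ^+ 2 + 2^-1 * l2norm er ei ^+ 2 @[n --> \oo] -->
    Tx ^+ 2 + 4 * pi * (Tk ^+ 2 + 0 * 0) + 31 * eps * l2norm ur ui ^+ 2 + 2^-1 * l2norm er ei ^+ 2.
  apply: cvgD; last exact: cvg_cst.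
  apply: cvgD; last exact: cvg_cst.
  apply: cvgD; first exact: cvg_cst.
  apply: cvgM; first exact: cvg_cst.
  apply: cvgD; first exact: cvg_cst.
  exact: (cvgM cF cF).
have cL : \int[@lebesgue_measure R]_x (trunc n ur x * er x) +
    \int[@lebesgue_measure R]_x (trunc n ui x * ei x) @[n --> \oo] --> l2norm er ei ^+ 2.
  by rewrite -EL; apply: cvgD; exact: Rint_trunc_cvg.
have fin : l2norm er ei ^+ 2 <= Tx ^+ 2 + 4 * pi * (Tk ^+ 2 + 0 * 0) + 31 * eps * l2norm ur ui ^+ 2 +
    2^-1 * l2norm er ei ^+ 2.
  by apply: (ler_cvg_to cL cR); apply: nearW => n; exact: B.
(* The rate halves on taking square roots: N / 8 becomes N / 16. *)
have s2 : expR (- (16^-1 * N%:R)) ^+ 2 = eps.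
  by rewrite -expRM_natl /eps; congr expR; field.
apply: (final_alg pi0 (l2norm_ge0 er ei) (l2norm_ge0 _ _) (l2norm_ge0 _ _) (l2norm_ge0 ur ui) (expR_ge0 _)).
rewrite s2; exact: absorb_half fin.
Qed.
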